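(* Let $d\ge1$ and $0<p\leq 1$. If $q>p$ then the operators $\mathbb{E}_N$ are unbounded on $B^{d/p-d}_{p,q}(\mathbb{R}^d)$.
   Context: $B^s_{p,q}(\mathbb{R}^d)$ is the usual inhomogeneous Besov space, $0<q\le\infty$. With $I_{N,\mu}=2^{-N}(\mu+[0,1)^d)$, $N\in\mathbb{N}_0$, the dyadic averaging operator is $$\mathbb{E}_Nf(x)=\sum_{\mu\in\mathbb{Z}^d}\mathbf{1}_{I_{N,\mu}}(x)\,2^{Nd}\int_{I_{N,\mu}}f(y)\,dy,\qquad f\in L^1_{loc}(\mathbb{R}^d).$$ ''Unbounded'' refers to each individual operator $\mathbb{E}_N$: there is no bounded extension of $\mathbb{E}_N$ from the Schwartz class to $B^{d/p-d}_{p,q}(\mathbb{R}^d)$, i.e. no finite $C$ with $\|\mathbb{E}_Nf\|_{B^{d/p-d}_{p,q}}\le C\|f\|_{B^{d/p-d}_{p,q}}$ for all Schwartz $f$. *)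

(* Defs.v *)
From HB Require Import structures.
From mathcomp Require Import all_boot all_order all_algebra.
From mathcomp Require Import complex.
From mathcomp Require Import all_classical all_reals all_analysis.
Import Order.TTheory GRing.Theory Num.Theory.
Import numFieldNormedType.Exports.

Set Implicit Arguments.
Unset Strict Implicit.
Unset Printing Implicit Defensive.

Local Open Scope classical_set_scope.
Local Open Scope ring_scope.

Definition row_display : measure_display -> measure_display.
Proof. exact. Qed.

(* Row vectors carry the sigma-algebra generated by the coordinates; for
   'rV[R]_n this is the Borel sigma-algebra. *)
Section row_measurable.
Context {d : measure_display} {T : measurableType d}.
Variable n : nat.

Let coord (i : 'I_n) (x : 'rV[T]_n) : T := x 0 i.

Let row_set0 : g_sigma_preimage coord set0.
Proof. exact: sigma_algebra0. Qed.

Let row_setC A : g_sigma_preimage coord A -> g_sigma_preimage coord (~` A).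
Proof. exact: sigma_algebraC. Qed.

Let row_bigcup (F : (set 'rV[T]_n)^nat) :
  (forall i, g_sigma_preimage coord (F i)) ->
  g_sigma_preimage coord (\bigcup_i (F i)).
Proof. exact: sigma_algebra_bigcup. Qed.

HB.instance Definition _ := @isMeasurable.Build (row_display d)
  'rV[T]_n (g_sigma_preimage coord) row_set0 row_setC row_bigcup.

Lemma measurable_row_coord (i : 'I_n) :
  measurable_fun [set: 'rV[T]_n] (fun x : 'rV[T]_n => x 0 i).
Proof.
move=> _ Y mY; rewrite setTI; apply: sub_sigma_algebra => /=.
rewrite -bigcup_seq/=; exists i => /=; first by rewrite mem_index_enum.
by exists Y => //; rewrite setTI.
Qed.

Lemma measurable_fun_row d1 (T1 : measurableType d1) (f : T1 -> 'rV[T]_n) :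
  (forall i, measurable_fun [set: T1] (fun t => f t 0 i)) ->
  measurable_fun [set: T1] f.
Proof.
move=> mf _ A; rewrite setTI => mA.
suff : g_sigma_preimage coord `<=` [set B | measurable (f @^-1` B)] by exact.
apply: smallest_sub.
  split => /=.
  - by rewrite preimage_set0.
  - by move=> B mB; rewrite setTD -preimage_setC; exact: measurableC.
  - by move=> B mB; rewrite preimage_bigcup; exact: bigcupT_measurable.
rewrite -bigcup_seq; apply: bigcup_sub => i _ B [C mC <-] /=.
rewrite setTI -comp_preimage -[X in measurable X]setTI; exact: mf.
Qed.
End row_measurable.

Section lebesgue.
Context {R : realType}.

Definition row_cons n (p : measurableTypeR R * 'rV[R]_n) : 'rV[R]_n.+1 := row_mx p.1%:M p.2.

Definition row_uncons n (x : 'rV[R]_n.+1) : measurableTypeR R * 'rV[R]_n :=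
  (x 0 0, \row_j x 0 (lift 0 j)).

Lemma row_consE n (p : measurableTypeR R * 'rV[R]_n) (j : 'I_n.+1) :
  row_cons p 0 j = oapp (p.2 0) p.1 (unlift 0 j).
Proof.
rewrite /row_cons; case: unliftP => [k ->|->] /=.
  have -> : lift 0 k = rshift 1 k by exact/val_inj.
  exact: (@row_mxEr _ 1 1 n).
have -> : 0 = lshift n 0 :> 'I_(1 + n) by exact/val_inj.
by rewrite (@row_mxEl _ 1 1 n) !mxE.
Qed.

Lemma row_consK n : cancel (@row_cons n) (@row_uncons n).
Proof.
move=> [a x]; rewrite /row_uncons row_consE unlift_none /=; congr pair.
by apply/rowP => j; rewrite mxE row_consE liftK.
Qed.

Lemma measurable_row_cons n : measurable_fun setT (@row_cons n).
Proof.
apply: measurable_fun_row => i; case: (unliftP 0 i) => [k ->|->].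
  under eq_fun do rewrite row_consE liftK /=.
  exact: (measurableT_comp (measurable_row_coord k) measurable_snd).
under eq_fun do rewrite row_consE unlift_none /=.
exact: measurable_fst.
Qed.

Lemma measurable_row_uncons n : measurable_fun setT (@row_uncons n).
Proof.
apply: measurable_fun_pair; first exact: measurable_row_coord.
apply: measurable_fun_row => i; under eq_fun do rewrite mxE.
exact: measurable_row_coord.
Qed.

Section step.
Variables (n : nat) (mu : {sigma_finite_measure set 'rV[R]_n -> \bar R}).

Definition lebesgue_row_step : set 'rV[R]_n.+1 -> \bar R :=
  pushforward (lebesgue_measure \x mu)%E (@row_cons n).

HB.instance Definition _ := Measure.copy lebesgue_row_step
  (measure_function_pushforward__canonical__measure_function_Measure
     (lebesgue_measure \x mu)%E (@measurable_row_cons n)).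

Lemma lebesgue_row_step_sigma_finite : sigma_finite setT lebesgue_row_step.
Proof.
have /sigma_finiteP[F [TF ndF Foo]] := sigma_finiteT (@lebesgue_measure R).
have /sigma_finiteP[G [TG ndG Goo]] := sigma_finiteT mu.
exists (fun k => @row_uncons n @^-1` (F k `*` G k)).
  rewrite -preimage_bigcup; apply/seteqP; split=> // x _.
  have [[k _ Fk] [l _ Gl]] : (\bigcup_i F i) (row_uncons x).1 /\
    (\bigcup_i G i) (row_uncons x).2 by rewrite -TF -TG.
  exists (maxn k l) => //; split.
    by move: Fk; exact/subsetPset/ndF/leq_maxl.
  by move: Gl; exact/subsetPset/ndG/leq_maxr.
move=> k; have [mF Foo_k] := Foo k; have [mG Goo_k] := Goo k; split.
  rewrite -[X in measurable X]setTI; apply: measurable_row_uncons => //.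
  exact: measurableX.
rewrite /lebesgue_row_step /pushforward -comp_preimage.
rewrite (_ : @row_uncons n \o @row_cons n = id); last first.
  by apply/funext => p /=; rewrite row_consK.
by rewrite preimage_id product_measure1E// lte_mul_pinfty// ge0_fin_numE.
Qed.

HB.instance Definition _ := Measure_isSigmaFinite.Build _ _ _ lebesgue_row_step
  lebesgue_row_step_sigma_finite.

End step.

(* Lebesgue measure on R^n, as the n-fold product measure. *)
Fixpoint lebesgue_row n : {sigma_finite_measure set 'rV[R]_n -> \bar R} :=
  if n is n'.+1 then lebesgue_row_step (lebesgue_row n') else \d_(0 : 'rV[R]_0).

End lebesgue.

Section besov.
Context {R : realType} {d : nat}.
Local Notation V := 'rV[R]_d.
Local Notation mu := (@lebesgue_row R d).
Implicit Types (x xi : V) (g : V -> R) (f phi : V -> R[i]).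

Definition dot x xi : R := \sum_j x 0 j * xi 0 j.

Definition enorm x : R := Num.sqrt (dot x x).

Definition partial (s : seq 'I_d) g : V -> R :=
  foldr (fun i h => 'D_(delta_mx 0 i) h) g s.

Definition smooth g : Prop :=
  forall s x, {for x, continuous (partial s g)} /\
    forall i, derivable (partial s g) x (delta_mx 0 i).

Definition schwartz_real g : Prop :=
  smooth g /\
  forall s m, exists M : R, forall x, enorm x ^+ m * `|partial s g x| <= M.

Definition schwartz f : Prop :=
  schwartz_real (fun x => complex.Re (f x)) /\
  schwartz_real (fun x => complex.Im (f x)).

Definition cintegral (A : set V) f : R[i] :=
  ((\int[mu]_(x in A) complex.Re (f x))%R +i*
   (\int[mu]_(x in A) complex.Im (f x))%R)%C.

(* exp(2 pi i <x, xi>) *)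
Definition character x xi : R[i] :=
  let t := 2 * pi * dot x xi in (cos t +i* sin t)%C.

Definition fourier f : V -> R[i] :=
  fun xi => cintegral setT (fun x => f x * character (- x) xi).

(* Distributions are functionals on functions, of which only the values on
   Schwartz functions are meaningful. *)
Definition distr := (V -> R[i]) -> R[i].

Definition regular_distr f : distr :=
  fun phi => cintegral setT (fun x => f x * phi x).

Definition fourier_distr (u : distr) : distr :=
  fun phi => u (fourier phi).

Definition mul_distr f (u : distr) : distr :=
  fun phi => u (fun x => f x * phi x).

(* The inverse Fourier transform of a compactly supported distribution u is
   the smooth function x |-> <u, exp(2 pi i <x, .>)>. *)
Definition inv_fourier_compact (u : distr) : V -> R[i] :=
  fun x => u (character x).

Definition cutoff phi : Prop :=
  [/\ schwartz phi,
      forall xi, enorm xi <= 1 -> phi xi = 1 &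
      forall xi, 2 <= enorm xi -> phi xi = 0].

(* The smooth dyadic resolution of unity generated by a cutoff. *)
Definition dyadic phi (k : nat) : V -> R[i] :=
  if k is k'.+1 then fun xi => phi (2 ^- k *: xi) - phi (2 ^- k' *: xi)
  else phi.

Definition lp_piece phi (k : nat) (u : distr) : V -> R[i] :=
  inv_fourier_compact (mul_distr (dyadic phi k) (fourier_distr u)).

(* The value lies in [0, +oo]; it is +oo when u is not in B^s_{p,q}. *)
Definition besov_norm phi (s p : R) (q : \bar R) (u : distr) : \bar R :=
  'N[counting]_q[(fun k : nat => (2 `^ (k%:R * s))%:E *
    'N[mu]_(p%:E)[(fun x => (Normc.normc (lp_piece phi k u x))%:E)])]%E.

Definition dyadic_cube (N : nat) (m : 'rV[int]_d) : set V :=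
  [set 2 ^- N *: (map_mx intr m + t) | t in [set t : V | forall j, 0 <= t 0 j < 1]].

Definition averaging (N : nat) f : V -> R[i] := fun x =>
  \sum_(m \in [set: 'rV[int]_d])
    (\1_(dyadic_cube N m) x * 2 ^+ (N * d))%:C%C * cintegral (dyadic_cube N m) f.

Definition bounded_on_besov phi (s p : R) (q : \bar R)
    (T : (V -> R[i]) -> (V -> R[i])) : Prop :=
  exists C : R, forall f, schwartz f ->
    (besov_norm phi s p q (regular_distr (T f)) <=
     C%:E * besov_norm phi s p q (regular_distr f))%E.

End besov.

(* Main.v *)
Require Import Defs.
From mathcomp Require Import all_boot all_order all_algebra.
From mathcomp Require Import complex.
From mathcomp Require Import ring lra.
From mathcomp Require Import all_classical all_reals all_analysis measurable_realfun ess_sup_inf.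
Import Order.TTheory GRing.Theory Num.Theory.
Import numFieldNormedType.Exports.

(** The averaging operator is tested on sums of [L] atoms whose images lose all
    memory of the scales of the atoms.

    Let [F] be smooth and compactly supported with a positive half in the open
    positive orthant and the opposite half in the negative one, so that its mean
    vanishes. Take [f = \sum_(i < L) F_i], where [F_i] is a copy of [F] with the
    same integrals of the halves, concentrated at scale [2 ^- (N + 3 + i)] around
    a point [z_i] of the dyadic lattice of level [N].

    Upper bound. At the smoothness [s = d / p - d] every atom contributes an amount
    of order 1 to the [p]-th power of the weighted norm of the piece at its own
    frequency, and geometrically less to the other ones ([corr_main]): the lower
    frequencies see the zero mean of [F], the higher ones its smoothness. The atoms
    have different frequencies, so the [p]-th powers of the weighted norms of the
    pieces of [f] are bounded and have a sum of order [L]. As [q > p], the Besov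
    norm of [f] is at most of order [L ^ (1 / q)] ([atoms_besov_upper]).

    Lower bound. The positive half of each atom lies in one dyadic cube of level [N]
    touching [z_i], the negative half in the diagonally opposite one, and averaging
    only sees their integrals. Hence the average of [f] is a sum of translates
    [g (x - z_i)] of one fixed step function ([averaging_atom]), all living at the
    same frequencies. The zeroth piece of [g] is not identically zero: its transform
    does not vanish at some low frequency ([ift_step_neq0]), and the inverse Fourier
    integral is injective ([ift_injective]). For [z_i] far enough from each other
    the translates do not interact, and the [p]-th power of the [p]-norm of the
    zeroth piece is at least of order [L] ([translates_lower_bound]).

    So the norm of the average is at least of order [L ^ (1 / p)], and letting [L]
    grow contradicts boundedness since [1 / p > 1 / q].

    The Fourier analysis involved reduces to one consequence of Fubini's theorem
    ([ift_convolution]). The decay of transforms is obtained from finite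
    differences ([ift_real_decay]), and injectivity by testing against powers of a
    nonnegative trigonometric polynomial with a single peak in the region of
    interest ([peak_detects]). *)

Set Implicit Arguments.
Unset Strict Implicit.
Unset Printing Implicit Defensive.

Local Open Scope classical_set_scope.
Local Open Scope ring_scope.

(** * Integration over row vectors *)

Section affine1.
Context {R : realType}.
Local Notation leb := (@lebesgue_measure R).
Variables (a b : R).
Hypothesis a_gt0 : 0 < a.

Let aff : measurableTypeR R -> measurableTypeR R := fun x => a * x + b.

Let measurable_aff : measurable_fun setT aff.
Proof. by apply: measurable_funD => //; exact: measurable_funM. Qed.

(** The push-forward of Lebesgue measure under an affine map, rescaled by the
    slope, agrees with Lebesgue measure on intervals, hence everywhere. *)
Lemma lebesgue_measure_affine (A : set (measurableTypeR R)) : measurable A ->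
  (a%:E * leb (aff @^-1` A) = leb A)%E.
Proof.
move=> mA; pose m1 : {measure set (measurableTypeR R) -> \bar R} :=
  measure_function_pushforward__canonical__measure_function_Measure
     leb measurable_aff.
pose m2 := mscale (NngNum (ltW a_gt0)) m1.
rewrite [RHS](@lebesgue_measure_unique _ m2)//= => _ [[u v]] _ <-.
rewrite /m2 /mscale/= /pushforward.
have -> : aff @^-1` `]u, v] = `](u - b) / a, (v - b) / a]%classic.
  apply/seteqP; split=> x; rewrite /aff/= !in_itv/= => /andP[h1 h2].
  - by rewrite ltr_pdivrMr// ler_pdivlMr// ltrBlDr lerBrDr [x * a]mulrC h1.
  - by move: h1 h2; rewrite ltr_pdivrMr// ler_pdivlMr// ltrBlDr lerBrDr [x * a]mulrC => -> ->.
rewrite !lebesgue_measure_itv/= !lte_fin ltr_pM2r ?invr_gt0// ltrD2r.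
case: ifP => _; last by rewrite mule0.
by rewrite -!EFinD -EFinM -mulrBl mulrCA divff ?gt_eqF// mulr1; congr EFin; ring.
Qed.

Lemma ge0_integral_affine1 (f : measurableTypeR R -> \bar R) :
  measurable_fun setT f -> (forall x, 0 <= f x)%E ->
  (a%:E * \int[leb]_x f (a * x + b)%R = \int[leb]_x f x)%E.
Proof.
move=> mf f0.
pose m1 : {measure set (measurableTypeR R) -> \bar R} :=
  measure_function_pushforward__canonical__measure_function_Measure
     leb measurable_aff.
pose m2 := mscale (NngNum (ltW a_gt0)) m1.
transitivity (\int[m2]_x f x)%E.
  rewrite ge0_integral_mscale//= /m1; congr (_ * _)%E.
  by rewrite (ge0_integral_pushforward measurable_aff)//.
by apply: eq_measure_integral => //= A mA _; exact: lebesgue_measure_affine.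
Qed.
End affine1.

Section row_integral.
Context {R : realType}.
Local Notation leb := (@lebesgue_measure R).
Local Notation mu := (@lebesgue_row R).

Lemma ge0_integral_row n (f : 'rV[R]_n.+1 -> \bar R) :
  measurable_fun setT f -> (forall x, 0 <= f x)%E ->
  (\int[mu n.+1]_x f x = \int[leb]_x \int[mu n]_y f (row_cons (x, y)))%E.
Proof.
move=> mf f0; rewrite /lebesgue_row -/(lebesgue_row n).
rewrite (ge0_integral_pushforward (@measurable_row_cons R n))//.
rewrite preimage_setT fubini_tonelli1//; last by move=> x; exact: f0.
by apply: measurableT_comp => //; exact: measurable_row_cons.
Qed.

Lemma row_cons_affine n (a : R) (b : 'rV[R]_n.+1) (x : R) (y : 'rV[R]_n) :
  a *: row_cons (x, y) + b =
  row_cons (a * x + b 0 0, a *: y + (row_uncons b).2).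
Proof.
apply/rowP => j; rewrite [LHS]mxE [X in X + _]mxE !row_consE.
by case: unliftP => [k ->|->] //=; rewrite !mxE.
Qed.

Lemma measurable_row_affine n (a : R) (b : 'rV[R]_n) :
  measurable_fun setT (fun x : 'rV[R]_n => a *: x + b).
Proof.
apply: measurable_fun_row => i; under eq_fun do rewrite !mxE.
apply: measurable_funD => //; apply: measurable_funM => //.
exact: measurable_row_coord.
Qed.

Lemma measurable_row_fix n (x : R) :
  measurable_fun setT (fun y : 'rV[R]_n => row_cons (x, y)).
Proof.
by apply: measurableT_comp; [exact: measurable_row_cons | exact: pair1_measurable].
Qed.

(** Induction on the dimension: Tonelli peels off one coordinate at a time. *)
Lemma ge0_integral_affine n (a : R) (b : 'rV[R]_n) (f : 'rV[R]_n -> \bar R) :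
  0 < a -> measurable_fun setT f -> (forall x, 0 <= f x)%E ->
  ((a ^+ n)%:E * \int[mu n]_x f (a *: x + b)%R = \int[mu n]_x f x)%E.
Proof.
move=> a0; elim: n b f => [|n IH] b f mf f0.
  rewrite expr0 mul1e; apply: eq_integral => x _; congr (f _).
  by apply/rowP => -[].
rewrite !ge0_integral_row//; last first.
  by apply: measurableT_comp => //; exact: measurable_row_affine.
have -> : (\int[leb]_x \int[mu n]_y f (a *: row_cons (x, y) + b)%R =
   \int[leb]_x \int[mu n]_y f (row_cons ((a * x + b 0 0)%R, (a *: y + (row_uncons b).2)%R)))%E.
  by apply: eq_integral => x _; apply: eq_integral => y _; rewrite row_cons_affine.
have mg : measurable_fun setT (fun x : measurableTypeR R => \int[mu n]_y f (row_cons (x, y)))%E.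
  apply: (@measurable_fun_fubini_tonelli_F _ _ _ _ _ _ (f \o @row_cons R n)) => //=.
  by apply: measurableT_comp => //; exact: measurable_row_cons.
have g0 x : (0 <= \int[mu n]_y f (row_cons (x, y)))%E by exact: integral_ge0.
have mh : measurable_fun setT (fun p : measurableTypeR R * 'rV[R]_n =>
    f (row_cons ((a * p.1 + b 0 0)%R, (a *: p.2 + (row_uncons b).2)%R))).
  apply: measurableT_comp => //.
  apply: (measurableT_comp (@measurable_row_cons R n)).
  apply: measurable_fun_pair.
    by apply: measurable_funD => //; exact: measurable_funM.
  exact: (measurableT_comp (measurable_row_affine a _) measurable_snd).
rewrite -[RHS](ge0_integral_affine1 (b 0 0) a0)// exprS EFinM -muleA; congr (_ * _)%E.
rewrite -ge0_integralZl//=.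
- apply: eq_integral => x _.
  rewrite (IH (row_uncons b).2 (fun y => f (row_cons (a * x + b 0 0, y)))) => //.
  by apply: measurableT_comp => //; exact: measurable_row_fix.
- exact: (measurable_fun_fubini_tonelli_F _ mh (fun p => f0 _)).
- by move=> x _; exact: integral_ge0.
- by rewrite lee_fin exprn_ge0// ltW.
Qed.

End row_integral.

Section row_product.
Context {R : realType}.
Local Notation leb := (@lebesgue_measure R).
Local Notation mu := (@lebesgue_row R).

Lemma measurable_row_prod n (w : 'I_n -> R -> R) :
  (forall i, measurable_fun setT (w i : measurableTypeR R -> R)) ->
  measurable_fun setT (fun x : 'rV[R]_n => \prod_i w i (x 0 i)).
Proof.
move=> mw; apply: measurable_prod => i _.
exact: (measurableT_comp (mw i) (measurable_row_coord (T:=measurableTypeR R) i)).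
Qed.

Lemma ge0_integral_row_prod n (w : 'I_n -> R -> R) :
  (forall i, measurable_fun setT (w i : measurableTypeR R -> R)) ->
  (forall i x, 0 <= w i x) ->
  (\int[mu n]_x (\prod_i w i (x 0 i))%:E = \prod_i \int[leb]_x (w i x)%:E)%E.
Proof.
elim: n w => [|n IH] w mw w0.
  rewrite big_ord0 (eq_integral (cst 1%E)) => [|x _]; last by rewrite big_ord0.
  by rewrite integral_cst//= diracT mul1e.
rewrite ge0_integral_row; last 2 first.
- by apply/measurable_EFinP; exact: measurable_row_prod.
- by move=> x; rewrite lee_fin prodr_ge0.
rewrite big_ord_recl -(IH (fun i => w (lift ord0 i)))//.
rewrite -ge0_integralZr//; last 3 first.
- by apply/measurable_EFinP; exact: mw.
- by move=> x _; rewrite lee_fin.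
- by apply: integral_ge0 => y _; rewrite lee_fin prodr_ge0.
apply: eq_integral => x _.
rewrite -ge0_integralZl//; last 3 first.
- by apply/measurable_EFinP; exact: (measurable_row_prod (fun i => mw (lift ord0 i))).
- by move=> y _; rewrite lee_fin prodr_ge0.
- by rewrite lee_fin.
apply: eq_integral => y _.
rewrite big_ord_recl row_consE unlift_none/= -EFinM; congr (_ * _)%:E.
by apply: eq_bigr => i _; rewrite row_consE liftK.
Qed.

Lemma measurable_rectangle n (A : 'I_n -> set R) :
  (forall i, measurable (A i : set (measurableTypeR R))) ->
  measurable [set x : 'rV[R]_n | forall i, A i (x 0 i)].
Proof.
move=> mA.
have -> : [set x : 'rV[R]_n | forall i, A i (x 0 i)] =
   \bigcap_(i in [set: 'I_n]) ((fun x : 'rV[R]_n => x 0 i) @^-1` A i).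
  by apply/seteqP; split=> x /= h i; [move=> _; exact: h | exact: (h i I)].
apply: fin_bigcap_measurable => // i _; rewrite -[X in measurable X]setTI.
exact: (measurable_row_coord (T:=measurableTypeR R)).
Qed.

Lemma lebesgue_row_rectangle n (A : 'I_n -> set R) :
  (forall i, measurable (A i : set (measurableTypeR R))) ->
  mu n [set x : 'rV[R]_n | forall i, A i (x 0 i)] = (\prod_i leb (A i))%E.
Proof.
move=> mA.
rewrite -[X in mu n X]setIT -integral_indic//; last exact: measurable_rectangle.
have -> : (\prod_i leb (A i) = \prod_i \int[leb]_x (\1_(A i) x)%:E)%E.
  by apply: eq_bigr => i _; rewrite integral_indic// setIT.
rewrite -ge0_integral_row_prod//; last by move=> i; exact: measurable_indic.
apply: eq_integral => x _; congr EFin.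
rewrite indicE; have [/set_mem/= h|h] := boolP (x \in _).
  by rewrite big1// => i _; rewrite indicE mem_set.
apply/esym/eqP; apply: contraNT h => /prodf_neq0 h; rewrite inE/= => i.
have := h i isT; rewrite indicE; case: (boolP (_ \in _)) => [/set_mem//|].
by rewrite eqxx.
Qed.

(** An open set is the union of the cubes with rational centre and radius
    [1 / k.+1] that it contains, and these are countably many. *)
Lemma row_open_measurable n (U : set 'rV[R]_n) : open U -> measurable U.
Proof.
move=> oU.
pose Bx (qk : 'rV[rat]_n * nat) : set 'rV[R]_n :=
  [set x | forall i, ball (ratr (qk.1 0 i) : R) (qk.2.+1%:R^-1) (x 0 i)].
have -> : U = \bigcup_(qk in [set qk | Bx qk `<=` U]) Bx qk.
  apply/seteqP; split => [x Ux|x [qk /= h /h//]].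
  have /nbhs_ballP[e /= e0 xU] := open_nbhs_nbhs (conj oU Ux).
  have [k ke] : exists k : nat, 2 * k.+1%:R^-1 < e.
    exists (Num.truncn (2 / e)); rewrite ltr_pdivrMr// mulrC -ltr_pdivrMr//.
    exact: truncnS_gt.
  have /choice[q qP] : forall i, exists q : rat, ball (ratr q : R) (k.+1%:R^-1) (x 0 i).
    move=> i.
    have /rat_in_itvoo[q] : x 0 i - k.+1%:R^-1 < x 0 i + k.+1%:R^-1.
      by rewrite ltrD2l gtrN// invr_gt0.
    rewrite in_itv/= => /andP[h1 h2]; exists q; rewrite /ball/= ltr_norml.
    by move: h1 h2; set r := k.+1%:R^-1; move=> h1 h2; apply/andP; split; lra.
  exists (\row_i q i, k); last first.
    by move=> i /=; rewrite mxE; exact: (qP i).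
  move=> y /= By; apply: xU; split=> // i j; rewrite (ord1 i).
  have := By j; rewrite mxE; have := qP j; rewrite /ball/=.
  move: (ratr _) => r h1 h2; rewrite -(subrKA r) (le_lt_trans (ler_normD _ _))//.
  by rewrite [`|x 0 j - r|]distrC; move: ke h1 h2; set s := k.+1%:R^-1; lra.
rewrite bigcup_mkcond.
have cU : countable [set: ('rV[rat]_n * nat)%type] by exact: countableP.
apply: (countable_bigcupT_measurable cU) => qk; case: ifP => // _.
apply: (measurable_rectangle (A := fun i => ball (ratr (qk.1 0 i) : R) _)) => i.
exact: measurable_ball.
Qed.

Lemma row_continuous_measurable n (f : 'rV[R]_n -> R) :
  continuous f -> measurable_fun setT f.
Proof.
move=> /continuousP cf; apply: (measurability _ (RGenOpens.measurableE R)).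
move=> _ [_ [a [b ->] <-]]; rewrite setTI; apply: row_open_measurable.
exact/cf/interval_open.
Qed.

End row_product.

(** * Complex-valued integrands *)

Section complex_modulus.
Context {R : realType}.
Local Notation normc := (@Normc.normc R).
Implicit Types z w : R[i].

Lemma Re_complexM z w :
  complex.Re (z * w) = complex.Re z * complex.Re w - complex.Im z * complex.Im w.
Proof. by case: z; case: w. Qed.

Lemma Im_complexM z w :
  complex.Im (z * w) = complex.Re z * complex.Im w + complex.Im z * complex.Re w.
Proof. by case: z; case: w. Qed.

Lemma Re_complexD z w : complex.Re (z + w) = complex.Re z + complex.Re w.
Proof. by case: z; case: w. Qed.

Lemma Im_complexD z w : complex.Im (z + w) = complex.Im z + complex.Im w.
Proof. by case: z; case: w. Qed.

Lemma complex_eq z w : complex.Re z = complex.Re w -> complex.Im z = complex.Im w ->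
  z = w.
Proof. by case: z => a b; case: w => c d /= -> ->. Qed.

Lemma normc_ge0 z : 0 <= normc z.
Proof. by case: z => a b /=; exact: sqrtr_ge0. Qed.

Lemma Re_le_normc z : `|complex.Re z| <= normc z.
Proof.
by case: z => a b /=; rewrite -sqrtr_sqr ler_sqrt ?addr_ge0 ?sqr_ge0// lerDl sqr_ge0.
Qed.

Lemma Im_le_normc z : `|complex.Im z| <= normc z.
Proof.
by case: z => a b /=; rewrite -sqrtr_sqr ler_sqrt ?addr_ge0 ?sqr_ge0// lerDr sqr_ge0.
Qed.

Lemma normc_le_ReIm z : normc z <= `|complex.Re z| + `|complex.Im z|.
Proof.
case: z => a b /=; rewrite -[leRHS]ger0_norm ?addr_ge0// -sqrtr_sqr.
rewrite ler_sqrt ?sqr_ge0// sqrrD !real_normK ?num_real// addrAC lerDl.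
by rewrite mulrn_wge0// mulr_ge0.
Qed.

Lemma normc_real (a : R) : normc a%:C%C = `|a|.
Proof. by rewrite /= expr0n/= addr0 sqrtr_sqr. Qed.

Lemma normcX z n : normc (z ^+ n) = normc z ^+ n.
Proof. by elim: n => [|n IH]; rewrite ?expr0 ?Normc.normc1// !exprS Normc.normcM IH. Qed.

Lemma normc_sum (I : Type) (s : seq I) (P : pred I) (F : I -> R[i]) :
  normc (\sum_(i <- s | P i) F i) <= \sum_(i <- s | P i) normc (F i).
Proof.
elim/big_rec2: _ => [|i y x _ h]; first by rewrite Normc.normc0.
by rewrite (le_trans (le_normcD _ _))// lerD2l.
Qed.

End complex_modulus.

Lemma integrable_indic_fin d (T : measurableType d) (R : realType)
    (mu : {measure set T -> \bar R}) (A : set T) :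
  measurable A -> (mu A < +oo)%E -> mu.-integrable setT (EFin \o \1_A).
Proof.
move=> mA fA; apply/integrableP; split.
  by apply/measurable_EFinP; exact: measurable_indic.
rewrite (eq_integral (fun x => (\1_A x)%:E)); last first.
  by move=> t _; rewrite gee0_abs// lee_fin.
by rewrite integral_indic// setIT.
Qed.

Section complex_integral.
Context {R : realType} {d : nat}.
Local Notation V := 'rV[R]_d.
Local Notation mu := (@lebesgue_row R d).
Local Notation normc := (@Normc.normc R).
Implicit Types (f g : V -> R[i]) (A : set V).

Definition box (B : R) : set V := [set x | forall i, `|x 0 i| <= B].

Lemma measurable_box B : measurable (box B).
Proof.
rewrite (_ : box B = [set x : V | forall i, (fun=> `[- B, B]%classic) i (x 0 i)]).
  exact: (measurable_rectangle (A := fun=> `[- B, B]%classic)).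
by apply/seteqP; split=> x /= h i; have := h i; rewrite in_itv/= ler_norml.
Qed.

Lemma box_fin B : (mu (box B) < +oo)%E.
Proof.
rewrite (_ : box B = [set x : V | forall i, (fun=> `[- B, B]%classic) i (x 0 i)]).
  rewrite (lebesgue_row_rectangle (A := fun=> `[- B, B]%classic))//.
  rewrite -ge0_fin_numE; last exact: prode_ge0.
  apply: prode_fin_num => i _.
  by rewrite lebesgue_measure_itv/=; case: ifP.
by apply/seteqP; split=> x /= h i; have := h i; rewrite in_itv/= ler_norml.
Qed.

Lemma box_mono B B' : B <= B' -> box B `<=` box B'.
Proof. by move=> h x /= hx i; exact: le_trans (hx i) h. Qed.

Definition volume B : R := fine (mu (box B)).

Lemma volume_ge0 B : 0 <= volume B.
Proof. by rewrite fine_ge0. Qed.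

Lemma bounded_supp_integrable A (f : V -> R) (M B : R) : measurable A ->
  measurable_fun setT f -> (forall x, `|f x| <= M) ->
  (forall x, ~ box B x -> f x = 0) -> mu.-integrable A (EFin \o f).
Proof.
move=> mA mf fM f0.
have M0 : 0 <= M by apply: le_trans (fM 0).
apply: (@integrableS _ _ _ _ setT) => //.
have mB : mu.-integrable setT (EFin \o (fun x => M * \1_(box B) x)).
  apply: (integrableZl measurableT M (f := EFin \o \1_(box B))).
  by apply: integrable_indic_fin; [exact: measurable_box|exact: box_fin].
apply: le_integrable mB => //; first exact/measurable_EFinP.
move=> x _ /=; rewrite lee_fin indicE; case: (boolP (x \in box B)) => [_|].
  by rewrite mulr1 (le_trans (fM _))// ler_norm.
by rewrite notin_setE => /f0 ->; rewrite normr0.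
Qed.

Lemma le_normr_Rintegral_box A (f : V -> R) (M B : R) : measurable A ->
  measurable_fun setT f -> (forall x, `|f x| <= M) ->
  (forall x, ~ box B x -> f x = 0) ->
  `|\int[mu]_(x in A) f x|%R <= M * volume B.
Proof.
move=> mA mf fM f0.
have M0 : 0 <= M by apply: le_trans (fM 0).
have fi := bounded_supp_integrable mA mf fM f0.
apply: (le_trans (le_normr_Rintegral mA fi)).
rewrite /volume -lee_fin /Rintegral fineK; last first.
  by apply: integrable_fin_num => //; exact: integrable_norm.
rewrite EFinM fineK; last by rewrite ge0_fin_numE// box_fin.
rewrite -[X in mu X]setIT -integral_indic//; last exact: measurable_box.
rewrite -ge0_integralZl//; last by apply/measurable_EFinP; apply: measurable_indic; exact: measurable_box.
rewrite (@le_trans _ _ (\int[mu]_x (`|f x|)%:E)%E)//.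
  apply: ge0_subset_integral => //.
  by apply/measurable_EFinP; exact: measurableT_comp.
apply: ge0_le_integral => //.
- by apply/measurable_EFinP; exact: measurableT_comp.
- by apply/measurable_EFinP; apply: measurable_funM => //; apply: measurable_indic; exact: measurable_box.
- move=> x _; rewrite -EFinM lee_fin indicE/=; case: (boolP (x \in box B)) => [_|].
    by rewrite mulr1.
  by rewrite notin_setE => /f0 ->; rewrite normr0 mulr0.
Qed.

Definition cmeasurable f : Prop :=
  measurable_fun setT (fun x => complex.Re (f x)) /\
  measurable_fun setT (fun x => complex.Im (f x)).

Definition supported_in f (B : R) : Prop := forall x, ~ box B x -> f x = 0.

(** Every integral over this class converges, and it is stable under sums,
    affine changes of variable and products with bounded functions; all complex
    integrands below belong to it. *)
Definition bounded_cs f : Prop :=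
  [/\ cmeasurable f, exists M, forall x, normc (f x) <= M & exists B, supported_in f B].

Definition cbounded f : Prop :=
  cmeasurable f /\ exists M, forall x, normc (f x) <= M.

Lemma cmeasurableD f g : cmeasurable f -> cmeasurable g ->
  cmeasurable (fun x => f x + g x).
Proof.
move=> [f1 f2] [g1 g2]; split.
- by under eq_fun do rewrite Re_complexD; exact: measurable_funD.
- by under eq_fun do rewrite Im_complexD; exact: measurable_funD.
Qed.

Lemma cmeasurableM f g : cmeasurable f -> cmeasurable g ->
  cmeasurable (fun x => f x * g x).
Proof.
move=> [f1 f2] [g1 g2]; split.
- under eq_fun do rewrite Re_complexM.
  by apply: measurable_funB; exact: measurable_funM.
- under eq_fun do rewrite Im_complexM.
  by apply: measurable_funD; exact: measurable_funM.
Qed.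

Lemma cmeasurable_cst (c : R[i]) : cmeasurable (fun=> c).
Proof. by split; exact: measurable_cst. Qed.

Lemma cmeasurable_comp f (T : V -> V) : measurable_fun setT T -> cmeasurable f ->
  cmeasurable (fun x => f (T x)).
Proof. by move=> mT [f1 f2]; split; [exact: measurableT_comp f1 mT|exact: measurableT_comp f2 mT]. Qed.

Lemma cbounded_cst (c : R[i]) : cbounded (fun=> c).
Proof. by split; [exact: cmeasurable_cst|exists (normc c)]. Qed.

Lemma cboundedD f g : cbounded f -> cbounded g -> cbounded (fun x => f x + g x).
Proof.
move=> [mf [M fM]] [mg [M' gM]]; split; first exact: cmeasurableD.
by exists (M + M') => x; rewrite (le_trans (le_normcD _ _))// lerD.
Qed.

Lemma cboundedM f g : cbounded f -> cbounded g -> cbounded (fun x => f x * g x).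
Proof.
move=> [mf [M fM]] [mg [M' gM]]; split; first exact: cmeasurableM.
by exists (M * M') => x; rewrite Normc.normcM ler_pM ?normc_ge0.
Qed.

Lemma bounded_csM f g : bounded_cs f -> cbounded g -> bounded_cs (fun x => f x * g x).
Proof.
move=> [mf [M fM] [B fB]] [mg [M' gM]]; split; first exact: cmeasurableM.
- by exists (M * M') => x; rewrite Normc.normcM ler_pM ?normc_ge0.
- by exists B => x /fB ->; rewrite mul0r.
Qed.

Lemma bounded_csZ (c : R[i]) f : bounded_cs f -> bounded_cs (fun x => c * f x).
Proof.
move=> hf; under eq_fun do rewrite mulrC.
exact: (bounded_csM hf (cbounded_cst c)).
Qed.

Lemma bounded_csD f g : bounded_cs f -> bounded_cs g -> bounded_cs (fun x => f x + g x).
Proof.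
move=> [mf [M fM] [B fB]] [mg [M' gM] [B' gB]]; split; first exact: cmeasurableD.
- by exists (M + M') => x; rewrite (le_trans (le_normcD _ _))// lerD.
- exists (Num.max B B') => x h; rewrite fB ?gB ?addr0//; apply: contra_not h;
    by apply: box_mono; rewrite le_max lexx ?orbT.
Qed.

Lemma bounded_csN f : bounded_cs f -> bounded_cs (fun x => - f x).
Proof. by move=> /(bounded_csZ (-1)); under eq_fun do rewrite mulN1r. Qed.

Lemma bounded_cs0 : bounded_cs (fun=> 0).
Proof.
split; first exact: cmeasurable_cst.
- by exists 0 => x; rewrite Normc.normc0.
- by exists 0.
Qed.

Lemma bounded_cs_sum (I : Type) (s : seq I) (F : I -> V -> R[i]) :
  (forall i, bounded_cs (F i)) -> bounded_cs (fun x => \sum_(i <- s) F i x).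
Proof.
move=> hF; elim: s => [|i s IH].
  by under eq_fun do rewrite big_nil; exact: bounded_cs0.
by under eq_fun do rewrite big_cons; exact: bounded_csD.
Qed.

Lemma bounded_cs_integrable A f : measurable A -> bounded_cs f ->
  mu.-integrable A (EFin \o (fun x => complex.Re (f x))) /\
  mu.-integrable A (EFin \o (fun x => complex.Im (f x))).
Proof.
move=> mA [[m1 m2] [M fM] [B fB]]; split.
- apply: (@bounded_supp_integrable _ _ M B) => // x.
    exact: le_trans (Re_le_normc _) (fM x).
  by move=> /fB ->.
- apply: (@bounded_supp_integrable _ _ M B) => // x.
    exact: le_trans (Im_le_normc _) (fM x).
  by move=> /fB ->.
Qed.

Lemma cintegralD A f g : measurable A -> bounded_cs f -> bounded_cs g ->
  cintegral A (fun x => f x + g x) = cintegral A f + cintegral A g.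
Proof.
move=> mA /(bounded_cs_integrable mA)[f1 f2] /(bounded_cs_integrable mA)[g1 g2].
rewrite /cintegral; apply: complex_eq.
- rewrite Re_complexD/= -RintegralD//.
  by apply: eq_Rintegral => x _; rewrite Re_complexD.
- rewrite Im_complexD/= -RintegralD//.
  by apply: eq_Rintegral => x _; rewrite Im_complexD.
Qed.

Lemma cintegralZ A (c : R[i]) f : measurable A -> bounded_cs f ->
  cintegral A (fun x => c * f x) = c * cintegral A f.
Proof.
move=> mA /(bounded_cs_integrable mA)[f1 f2].
have Zi (k : R) (g : V -> R) : mu.-integrable A (EFin \o g) ->
    mu.-integrable A (EFin \o (fun x => k * g x)).
  by move=> /(integrableZl mA k); under eq_fun do rewrite -EFinM.
rewrite /cintegral; apply: complex_eq.
- rewrite Re_complexM/= -!RintegralZl// -RintegralB//; [|exact: Zi..].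
  by apply: eq_Rintegral => x _; rewrite Re_complexM.
- rewrite Im_complexM/= -!RintegralZl// -RintegralD//; [|exact: Zi..].
  by apply: eq_Rintegral => x _; rewrite Im_complexM.
Qed.

Lemma cintegral0 A : cintegral A (fun=> 0) = 0 :> R[i].
Proof. by rewrite /cintegral/= /Rintegral !integral0. Qed.

Lemma cintegral_sum A (I : Type) (s : seq I) (F : I -> V -> R[i]) : measurable A ->
  (forall i, bounded_cs (F i)) ->
  cintegral A (fun x => \sum_(i <- s) F i x) = \sum_(i <- s) cintegral A (F i).
Proof.
move=> mA hF; elim: s => [|i s IH].
  by under eq_fun do rewrite big_nil; rewrite big_nil cintegral0.
under eq_fun do rewrite big_cons; rewrite big_cons cintegralD ?IH//.
exact: bounded_cs_sum.
Qed.

(** The factor 2 comes from bounding real and imaginary parts separately. *)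
Lemma normc_cintegral_le A f (M B : R) : measurable A -> cmeasurable f ->
  (forall x, normc (f x) <= M) -> supported_in f B ->
  normc (cintegral A f) <= 2 * M * volume B.
Proof.
move=> mA [m1 m2] fM fB; apply: (le_trans (normc_le_ReIm _)).
rewrite -mulrA mulr2n mulrDl mul1r /=; apply: lerD.
- apply: le_normr_Rintegral_box => // x; last by move=> /fB ->.
  exact: le_trans (Re_le_normc _) (fM x).
- apply: le_normr_Rintegral_box => // x; last by move=> /fB ->.
  exact: le_trans (Im_le_normc _) (fM x).
Qed.

Lemma bounded_cs_affine (a : R) (b : V) f : 0 < a -> bounded_cs f ->
  bounded_cs (fun x => f (a *: x + b)).
Proof.
move=> a0 [mf [M fM] [B fB]]; split.
- by apply: cmeasurable_comp => //; exact: measurable_row_affine.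
- by exists M.
- exists ((B + \sum_i `|b 0 i|) / a) => x h; apply: fB; apply: contra_not h => /= h i.
  rewrite ler_pdivlMr// -[X in _ * X <= _](gtr0_norm a0) -normrM.
  have := h i; rewrite !mxE => hi.
  rewrite mulrC -[a * _](addrK (b 0 i)) (le_trans (ler_normB _ _))// lerD//.
  by rewrite (bigD1 i)//= lerDl sumr_ge0.
Qed.

Lemma Rintegral_affine (a : R) (b : V) (f : V -> R) : 0 < a ->
  mu.-integrable setT (EFin \o f) ->
  mu.-integrable setT (EFin \o (fun x => f (a *: x + b))) ->
  a ^+ d * \int[mu]_x f (a *: x + b) = \int[mu]_x f x.
Proof.
move=> a0 fi fi'; have mf := measurable_int _ fi.
rewrite /Rintegral; apply: EFin_inj.
rewrite EFinM !fineK; [|exact: integrable_fin_num..].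
pose fT x := f (a *: x + b).
rewrite [X in (_ * X)%E](integralE _ _ (EFin \o fT)) [RHS](integralE _ _ (EFin \o f)).
have fin : (\int[mu]_x (EFin \o fT)^\+ x)%E \is a fin_num.
  exact: (integrable_pos_fin_num measurableT fi').
rewrite muleBr; [|by []|exact: fin_num_adde_defr].
have mfp : measurable_fun setT ((EFin \o f)^\+)%E by exact: measurable_funepos.
have mfn : measurable_fun setT ((EFin \o f)^\-)%E by exact: measurable_funeneg.
congr (_ - _)%E.
- rewrite -(ge0_integral_affine b a0 mfp (funepos_ge0 (EFin \o f))).
  by congr (_ * _)%E; apply: eq_integral => x _; rewrite !funeposE.
- rewrite -(ge0_integral_affine b a0 mfn (funeneg_ge0 (EFin \o f))).
  by congr (_ * _)%E; apply: eq_integral => x _; rewrite !funenegE.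
Qed.

Lemma cintegral_affine (a : R) (b : V) f : 0 < a -> bounded_cs f ->
  (a ^+ d)%:C%C * cintegral setT (fun x => f (a *: x + b)) = cintegral setT f.
Proof.
move=> a0 hf; have [f1 f2] := bounded_cs_integrable measurableT hf.
have [g1 g2] := bounded_cs_integrable measurableT (bounded_cs_affine b a0 hf).
apply: complex_eq.
- rewrite Re_complexM/= mul0r subr0.
  exact: (Rintegral_affine (f := fun x => complex.Re (f x)) a0 f1 g1).
- rewrite Im_complexM/= mul0r addr0.
  exact: (Rintegral_affine (f := fun x => complex.Im (f x)) a0 f2 g2).
Qed.

End complex_integral.

(** * The inverse Fourier integral *)

Lemma lipschitz_of_derive {R : realType} (f : R -> R) (df : R -> R) (M : R) :
  (forall x : R, is_derive x 1 f (df x)) -> (forall x, `|df x| <= M) ->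
  forall a b, `|f b - f a| <= M * `|b - a|.
Proof.
move=> fd dM.
have main a b : a < b -> `|f b - f a| <= M * `|b - a|.
  move=> ab; have cf : {within `[a, b], continuous f}.
    apply: derivable_within_continuous => x _.
    by have [] := fd x.
  have [c _ ->] := MVT ab (fun x _ => fd x) cf.
  by rewrite normrM ler_wpM2r.
move=> a b; have [ab|ba|->] := ltgtP a b; first exact: main.
- by rewrite distrC [in leRHS]distrC; exact: main.
- by rewrite !subrr normr0 mulr0.
Qed.

Section characters.
Context {R : realType} {d : nat}.
Local Notation V := 'rV[R]_d.
Local Notation normc := (@Normc.normc R).
Implicit Types (x y xi : V).

Lemma dotC x y : dot x y = dot y x.
Proof. by apply: eq_bigr => j _; rewrite mulrC. Qed.

Lemma dotDl x y xi : dot (x + y) xi = dot x xi + dot y xi.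
Proof. by rewrite /dot -big_split/=; apply: eq_bigr => j _; rewrite mxE mulrDl. Qed.

Lemma dotZl (a : R) x xi : dot (a *: x) xi = a * dot x xi.
Proof. by rewrite /dot mulr_sumr; apply: eq_bigr => j _; rewrite mxE mulrA. Qed.

Lemma dotZr (a : R) x xi : dot x (a *: xi) = a * dot x xi.
Proof. by rewrite dotC dotZl dotC. Qed.

Lemma dotNl x xi : dot (- x) xi = - dot x xi.
Proof. by rewrite -scaleN1r dotZl mulN1r. Qed.

Definition l1norm x : R := \sum_j `|x 0 j|.

Lemma l1norm_ge0 x : 0 <= l1norm x.
Proof. exact: sumr_ge0. Qed.

Lemma dot_le_box (B : R) x xi : box B xi -> `|dot x xi| <= B * l1norm x.
Proof.
move=> hB; rewrite /l1norm mulr_sumr (le_trans (ler_norm_sum _ _ _))//.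
by apply: ler_sum => j _; rewrite normrM mulrC ler_wpM2r// hB.
Qed.

Lemma characterC x xi : character x xi = character xi x.
Proof. by rewrite /character dotC. Qed.

Lemma characterD x y xi : character (x + y) xi = character x xi * character y xi.
Proof.
rewrite /character dotDl mulrDr cosD sinD; by apply: complex_eq => /=; ring.
Qed.

Lemma character0 xi : character 0 xi = 1.
Proof.
rewrite /character (_ : dot 0 xi = 0) ?mulr0 ?cos0 ?sin0//.
by rewrite /dot big1// => j _; rewrite mxE mul0r.
Qed.

Lemma characterZ (a : R) x xi : character (a *: x) xi = character x (a *: xi).
Proof. by rewrite /character dotZl dotZr. Qed.

Lemma characterNC x xi : character (- x) xi = character x (- xi).
Proof. by rewrite -scaleN1r characterZ scaleN1r. Qed.

Lemma normc_character x xi : normc (character x xi) = 1.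
Proof. by rewrite /= cos2Dsin2 sqrtr1. Qed.

Lemma normc_character_sub1 x xi :
  normc (character x xi - 1) <= 4 * pi * `|dot x xi|.
Proof.
have h1 (t : R) : `|cos t - 1| <= `|t|.
  have dM (u : R) : `|- sin u| <= 1 by rewrite normrN ler_norml sin_geN1 sin_le1.
  have := lipschitz_of_derive (fun u => is_derive_cos u) dM 0 t.
  by rewrite cos0 subr0 mul1r.
have h2 (t : R) : `|sin t| <= `|t|.
  have dM (u : R) : `|cos u| <= 1 by rewrite ler_norml cos_geN1 cos_le1.
  have := lipschitz_of_derive (fun u => is_derive_sin u) dM 0 t.
  by rewrite sin0 !subr0 mul1r.
apply: (le_trans (normc_le_ReIm _)); rewrite /= oppr0 addr0.
have -> : 4 * pi * `|dot x xi| = `|2 * pi * dot x xi| + `|2 * pi * dot x xi|.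
  by rewrite !normrM (ger0_norm (pi_ge0 R)) ger0_norm//; ring.
exact: lerD.
Qed.

Lemma measurable_dot x : measurable_fun setT (dot x).
Proof.
apply: measurable_sum => j; apply: measurable_funM => //.
exact: measurable_row_coord.
Qed.

Lemma cmeasurable_character x : cmeasurable (character x).
Proof.
have m : measurable_fun setT (fun xi => 2 * pi * dot x xi).
  by apply: measurable_funM => //; exact: measurable_dot.
split => /=.
- exact: (measurableT_comp (continuous_measurable_fun (@continuous_cos R)) m).
- exact: (measurableT_comp (continuous_measurable_fun (@continuous_sin R)) m).
Qed.

Lemma cbounded_character x : cbounded (character x).
Proof.
by split; [exact: cmeasurable_character|exists 1 => xi; rewrite normc_character].
Qed.

End characters.

Section fourier_integral.
Context {R : realType} {d : nat}.
Local Notation V := 'rV[R]_d.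
Local Notation mu := (@lebesgue_row R d).
Local Notation normc := (@Normc.normc R).
Implicit Types (m u f : V -> R[i]) (x y xi Z : V).

(** The inverse Fourier transform; the Fourier transform itself is its
    composition with the reflection [x |-> - x]. *)
Definition ift m Z : R[i] := cintegral setT (fun xi => m xi * character Z xi).

Lemma bounded_cs_ift m Z : bounded_cs m -> bounded_cs (fun xi => m xi * character Z xi).
Proof. by move=> hm; apply: bounded_csM => //; exact: cbounded_character. Qed.

Lemma ift_bounded m : bounded_cs m -> exists2 C, 0 <= C & forall Z, normc (ift m Z) <= C.
Proof.
move=> hm; have [_ [M fM] [B fB]] := hm.
have M0 : 0 <= M by exact: le_trans (normc_ge0 _) (fM 0).
exists (2 * M * @volume R d B) => [|Z]; first by rewrite mulr_ge0 ?mulr_ge0 ?volume_ge0.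
have [mf _ _] := bounded_cs_ift Z hm.
apply: normc_cintegral_le => // [x|x /fB ->]; last by rewrite mul0r.
by rewrite Normc.normcM normc_character mulr1.
Qed.

(** A character is Lipschitz in the position variable, uniformly over the bounded
    support of [m]. *)
Lemma ift_lipschitz m : bounded_cs m -> exists2 C, 0 <= C &
  forall Z Z', normc (ift m Z - ift m Z') <= C * l1norm (Z - Z').
Proof.
move=> hm; have [_ [M fM] [B fB]] := hm.
have M0 : 0 <= M by exact: le_trans (normc_ge0 _) (fM 0).
exists (2 * (M * (4 * pi * `|B|)) * @volume R d B) => [|Z Z'].
  by rewrite mulr_ge0 ?volume_ge0// !mulr_ge0// pi_ge0.
have h1 := bounded_cs_ift Z hm; have h2 := bounded_cs_ift Z' hm.
rewrite /ift -[- cintegral _ _]mulN1r -cintegralZ// -cintegralD//; last exact: bounded_csZ.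
have [mf _ _] := bounded_csD h1 (bounded_csZ (-1) h2).
rewrite (_ : _ * l1norm _ =
  2 * (M * (4 * pi * (`|B| * l1norm (Z - Z')))) * @volume R d B); last by ring.
apply: normc_cintegral_le => // [x|x /fB ->]; last by rewrite !mul0r mulr0 addr0.
have -> : m x * character Z x + -1 * (m x * character Z' x) =
    m x * character Z' x * (character (Z - Z') x - 1).
  have -> : character Z x = character (Z - Z') x * character Z' x.
    by rewrite -characterD subrK.
  by ring.
rewrite !Normc.normcM normc_character mulr1 -mulrA.
have [hx|hx] := pselect (box B x); last first.
  by rewrite fB// Normc.normc0 mul0r mulr_ge0// !mulr_ge0// ?pi_ge0// l1norm_ge0.
apply: ler_pM => //; rewrite ?normc_ge0//.
apply: (le_trans (normc_character_sub1 _ _)).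
rewrite -!mulrA; do 2 apply: ler_wpM2l => //; first exact: pi_ge0.
rewrite (le_trans (dot_le_box _ hx))// ler_wpM2r ?l1norm_ge0//.
exact: ler_norm.
Qed.

Lemma l1norm_lipschitz_continuous (f : V -> R) (C : R) :
  (forall x y, `|f x - f y| <= C * l1norm (x - y)) -> continuous f.
Proof.
move=> fC x; apply/(@cvgrPdist_lt _ _ _ (nbhs x)); move=> e e0.
pose C' := `|C| * d%:R + 1.
have C'0 : 0 < C' by rewrite ltr_wpDl// mulr_ge0.
apply/nbhs_ballP; exists (e / C') => /=; first by rewrite divr_gt0.
move=> y [_ xy]; rewrite (le_lt_trans (fC _ _))//.
rewrite (@le_lt_trans _ _ (`|C| * (d%:R * (e / C'))))//.
  rewrite (@le_trans _ _ (`|C| * l1norm (x - y)))//.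
    by rewrite ler_wpM2r ?l1norm_ge0// ler_norm.
  apply: ler_wpM2l => //; rewrite /l1norm.
  rewrite (_ : d%:R * (e / C') = \sum_(j < d) (e / C')).
    by apply: ler_sum => j _; rewrite !mxE; have := xy 0 j; rewrite /ball/= => /ltW.
  by rewrite sumr_const card_ord mulr_natl.
rewrite !mulrA ltr_pdivrMr// mulrC ltr_pM2l//.
by rewrite /C' ltrDl.
Qed.

Lemma clipschitz_continuous f (C : R) :
  (forall x y, normc (f x - f y) <= C * l1norm (x - y)) ->
  continuous (fun x => complex.Re (f x)) /\ continuous (fun x => complex.Im (f x)).
Proof.
move=> fC; split; apply: (@l1norm_lipschitz_continuous _ C) => x y; apply: le_trans (fC x y).
- by rewrite (le_trans _ (Re_le_normc _))//; case: (f x); case: (f y).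
- by rewrite (le_trans _ (Im_le_normc _))//; case: (f x); case: (f y).
Qed.

Lemma cbounded_ift m : bounded_cs m -> cbounded (ift m).
Proof.
move=> hm; split; last by have [C _ h] := ift_bounded hm; exists C.
have [C _ /clipschitz_continuous[cr ci]] := ift_lipschitz hm.
by split; exact: row_continuous_measurable.
Qed.

Lemma bounded_cs_ift_sub u m (t : R) Z : bounded_cs u -> bounded_cs m ->
  bounded_cs (fun y => u y * ift m (Z - t *: y)).
Proof.
move=> hu hm; apply: (bounded_csM hu); have [mi [K hK]] := cbounded_ift hm.
split; last by exists K.
have -> : (fun y => ift m (Z - t *: y)) = (fun y => ift m ((- t) *: y + Z)).
  by apply/funext => y; rewrite scaleNr addrC.
exact: (cmeasurable_comp (measurable_row_affine (- t) Z) mi).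
Qed.

Lemma bounded_cs_ift_opp u m (t : R) : bounded_cs u -> bounded_cs m ->
  bounded_cs (fun y => u y * ift m (- (t *: y))).
Proof.
move=> hu hm; have := bounded_cs_ift_sub t 0 hu hm.
by congr bounded_cs; apply/funext => y; rewrite sub0r.
Qed.

Lemma bounded_cs_ift_translate u m Z : bounded_cs u -> bounded_cs m ->
  bounded_cs (fun y => u y * ift m (Z - y)).
Proof.
move=> hu hm; have := bounded_cs_ift_sub 1 Z hu hm.
by congr bounded_cs; apply/funext => y; rewrite scale1r.
Qed.

Lemma iftD m m' Z : bounded_cs m -> bounded_cs m' ->
  ift (fun xi => m xi + m' xi) Z = ift m Z + ift m' Z.
Proof.
move=> h h'; rewrite /ift -cintegralD//; try exact: bounded_cs_ift.
by congr cintegral; apply/funext => xi; rewrite mulrDl.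
Qed.

Lemma iftZ (c : R[i]) m Z : bounded_cs m -> ift (fun xi => c * m xi) Z = c * ift m Z.
Proof.
move=> h; rewrite /ift -cintegralZ//; last exact: bounded_cs_ift.
by congr cintegral; apply/funext => xi; rewrite mulrA.
Qed.

Lemma ift_scale (a : R) m Z : 0 < a -> bounded_cs m ->
  (a ^+ d)%:C%C * ift (fun xi => m (a *: xi)) Z = ift m (a^-1 *: Z).
Proof.
move=> a0 hm; rewrite /ift -[RHS](cintegral_affine 0 a0); last exact: bounded_cs_ift.
congr (_ * cintegral _ _); apply/funext => xi.
by rewrite addr0 characterZ scalerA mulVf ?gt_eqF// scale1r.
Qed.

Lemma fourier_ift f x xi : fourier (fun z => f z * character x z) xi = ift f (x - xi).
Proof.
rewrite /fourier /ift; congr cintegral; apply/funext => z.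
by rewrite -mulrA characterD [character (- xi) z]characterC characterNC characterC -characterNC characterC.
Qed.

(** The distributional Fourier transform of [f], tested against the symbol times a
    character, is [f] tested against an inverse Fourier integral: a piece of [f] is
    a convolution, and no inversion formula is involved. *)
Lemma lp_pieceE phi k f x : lp_piece phi k (regular_distr f) x =
  cintegral setT (fun y => f y * ift (dyadic phi k) (x - y)).
Proof.
rewrite /lp_piece /inv_fourier_compact /mul_distr /fourier_distr /regular_distr.
by congr cintegral; apply/funext => y; rewrite fourier_ift.
Qed.

End fourier_integral.

(** * Convolution with an inverse Fourier integral *)

Section fubini.
Context {R : realType} {d : nat}.
Local Notation V := 'rV[R]_d.
Local Notation mu := (@lebesgue_row R d).
Local Notation normc := (@Normc.normc R).

Lemma Rintegral_swap (h : V * V -> R) (M B : R) :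
  measurable_fun setT h -> (forall z, `|h z| <= M) ->
  (forall x y, ~ (box B x /\ box B y) -> h (x, y) = 0) ->
  \int[mu]_x \int[mu]_y h (x, y) = \int[mu]_y \int[mu]_x h (x, y).
Proof.
move=> mh hM h0.
have M0 : 0 <= M by exact: le_trans (hM (0, 0)).
have mbox : measurable (@box R d B `*` @box R d B).
  by apply: measurableX; exact: measurable_box.
have hi : (mu \x mu)%E.-integrable setT (EFin \o h).
  have : (mu \x mu)%E.-integrable setT (EFin \o (fun z => M * \1_(@box R d B `*` @box R d B) z)).
    apply: (integrableZl measurableT M (f := EFin \o \1_(@box R d B `*` @box R d B))).
    apply: integrable_indic_fin => //.
    suff : ((mu \x mu)%E (@box R d B `*` @box R d B) < +oo)%E by [].
    rewrite product_measure1E; [|exact: measurable_box..].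
    by rewrite lte_mul_pinfty// ?ge0_fin_numE//; exact: box_fin.
  move=> /le_integrable; apply => //; first exact/measurable_EFinP.
  move=> [x y] _ /=; rewrite lee_fin indicE.
  have [hxy|hxy] := pselect (box B x /\ box B y).
    by rewrite mem_set// mulr1 (le_trans (hM _))// ler_norm.
  by rewrite h0// normr0.
have sec1 x : mu.-integrable setT (fun y => (h (x, y))%:E).
  apply: (@bounded_supp_integrable _ _ _ (fun y => h (x, y)) M B) => //.
    exact: (measurableT_comp mh (pair1_measurable x)).
  by move=> y hy; apply: h0 => -[].
have sec2 y : mu.-integrable setT (fun x => (h (x, y))%:E).
  apply: (@bounded_supp_integrable _ _ _ (fun x => h (x, y)) M B) => //.
    exact: (measurableT_comp mh (pair2_measurable y)).
  by move=> x hx; apply: h0 => -[].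
rewrite /Rintegral; congr fine.
have -> : (\int[mu]_x (fine (\int[mu]_y (h (x, y))%:E))%:E =
    \int[mu]_x \int[mu]_y (h (x, y))%:E)%E.
  by apply: eq_integral => x _; rewrite fineK//; exact: integrable_fin_num.
have -> : (\int[mu]_y (fine (\int[mu]_x (h (x, y))%:E))%:E =
    \int[mu]_y \int[mu]_x (h (x, y))%:E)%E.
  by apply: eq_integral => y _; rewrite fineK//; exact: integrable_fin_num.
exact: (Fubini (f := EFin \o h)).
Qed.

Lemma cintegral_swap (h : V * V -> R[i]) (M B : R) :
  measurable_fun setT (fun z => complex.Re (h z)) ->
  measurable_fun setT (fun z => complex.Im (h z)) ->
  (forall z, normc (h z) <= M) ->
  (forall x y, ~ (box B x /\ box B y) -> h (x, y) = 0) ->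
  cintegral setT (fun x => cintegral setT (fun y => h (x, y))) =
  cintegral setT (fun y => cintegral setT (fun x => h (x, y))).
Proof.
move=> m1 m2 hM h0; rewrite /cintegral; apply: complex_eq => /=.
- apply: (Rintegral_swap (h := fun z => complex.Re (h z)) (M := M) (B := B)) => // [z|x y /h0 ->//].
  exact: le_trans (Re_le_normc _) (hM z).
- apply: (Rintegral_swap (h := fun z => complex.Im (h z)) (M := M) (B := B)) => // [z|x y /h0 ->//].
  exact: le_trans (Im_le_normc _) (hM z).
Qed.

(** By Fubini the factor of the character that depends on [y] can be integrated
    against [u] first: on the frequency side, correlation with the dilated [u]
    becomes multiplication. *)
Lemma ift_convolution (u m : V -> R[i]) (t : R) (X : V) :
  bounded_cs u -> bounded_cs m ->
  cintegral setT (fun y => u y * ift m (X - t *: y)) =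
  ift (fun xi => m xi * ift u (- (t *: xi))) X.
Proof.
move=> hu hm; have [[mu1 mu2] [Mu uM] [Bu uB]] := hu.
have [[mm1 mm2] [Mm mM] [Bm mB]] := hm.
pose h (z : V * V) := u z.1 * (m z.2 * character (X - t *: z.1) z.2).
have hE : cintegral setT (fun y => u y * ift m (X - t *: y)) =
    cintegral setT (fun y => cintegral setT (fun xi => h (y, xi))).
  congr cintegral; apply/funext => y; rewrite /ift -cintegralZ//.
  exact: bounded_cs_ift.
have hE' : ift (fun xi => m xi * ift u (- (t *: xi))) X =
    cintegral setT (fun xi => cintegral setT (fun y => h (y, xi))).
  rewrite [LHS]/ift; congr cintegral; apply/funext => xi.
  rewrite mulrAC /ift -cintegralZ//; last exact: bounded_cs_ift.
  congr cintegral; apply/funext => y; rewrite /h/= characterD.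
  have -> : character (- (t *: y)) xi = character (- (t *: xi)) y.
    by rewrite characterNC characterZ scalerN characterC.
  by ring.
have mdot : measurable_fun setT (fun z : V * V => 2 * pi * dot (X - t *: z.1) z.2).
  apply: measurable_funM => //; apply: measurable_sum => j.
  apply: measurable_funM; last first.
    exact: (measurableT_comp (measurable_row_coord j) measurable_snd).
  under eq_fun do rewrite !mxE.
  apply: measurable_funD => //; apply: measurable_funN; apply: measurable_funM => //.
  exact: (measurableT_comp (measurable_row_coord j) measurable_fst).
have mc : measurable_fun setT (fun z : V * V => cos (2 * pi * dot (X - t *: z.1) z.2)).
  exact: (measurableT_comp (continuous_measurable_fun (@continuous_cos R)) mdot).
have ms : measurable_fun setT (fun z : V * V => sin (2 * pi * dot (X - t *: z.1) z.2)).
  exact: (measurableT_comp (continuous_measurable_fun (@continuous_sin R)) mdot).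
have u1 : measurable_fun setT (fun z : V * V => complex.Re (u z.1)).
  exact: (measurableT_comp mu1 measurable_fst).
have u2 : measurable_fun setT (fun z : V * V => complex.Im (u z.1)).
  exact: (measurableT_comp mu2 measurable_fst).
have m1 : measurable_fun setT (fun z : V * V => complex.Re (m z.2)).
  exact: (measurableT_comp mm1 measurable_snd).
have m2 : measurable_fun setT (fun z : V * V => complex.Im (m z.2)).
  exact: (measurableT_comp mm2 measurable_snd).
rewrite hE hE'; apply: (@cintegral_swap h (Mu * Mm) (Num.max Bu Bm)).
- rewrite /h; under eq_fun do rewrite !Re_complexM !Im_complexM /=.
  by apply: measurable_funB; apply: measurable_funM => //;
    [apply: measurable_funB|apply: measurable_funD]; exact: measurable_funM.
- rewrite /h; under eq_fun do rewrite !Im_complexM !Re_complexM /=.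
  by apply: measurable_funD; apply: measurable_funM => //;
    [apply: measurable_funD|apply: measurable_funB]; exact: measurable_funM.
- move=> z; rewrite !Normc.normcM normc_character mulr1.
  by rewrite ler_pM ?normc_ge0.
- move=> y xi hb; rewrite /h/=.
  have [hy|hy] := pselect (box Bu y); last by rewrite uB// mul0r.
  rewrite mB ?mul0r ?mulr0// => hxi; apply: hb; split;
    [move: hy|move: hxi]; apply: box_mono; by rewrite le_max lexx ?orbT.
Qed.

End fubini.

(** * Closure properties of smooth functions *)

Section smooth_functions.
Context {R : realType} {d : nat}.
Local Notation V := 'rV[R]_d.
Local Notation e_ i := (delta_mx 0 i : 'rV[R]_d).
Implicit Types (g h : V -> R) (s : seq 'I_d).

Lemma is_derive_line g (y v : V) (t l : R) : is_derive (t *: v + y) v g l ->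
  is_derive t (1 : R) (fun r : R => g (r *: v + y)) l.
Proof.
move=> [dg gl].
have E : (fun h : R => h^-1 *: (((fun r : R => g (r *: v + y)) \o shift t) (h *: 1) - g (t *: v + y)))
   = (fun h : R => h^-1 *: ((g \o shift (t *: v + y)) (h *: v) - g (t *: v + y))).
  by apply/funext => h /=; rewrite [h *: 1]mulr1 scalerDl addrA.
apply: DeriveDef; first by rewrite /derivable E.
by rewrite /derive E.
Qed.

Lemma is_derive_affine g (a : R) (b x v : V) (l : R) :
  is_derive (a *: x + b) v g l -> is_derive x v (fun z => g (a *: z + b)) (l * a).
Proof.
move=> dg.
have d0 : is_derive ((a *: 0 : R) *: v + (a *: x + b)) v g l.
  by rewrite scaler0 scale0r add0r.
have d1 := is_derive_line d0.
have d2 : is_derive (0 : R) (1 : R) (fun t : R => a *: t) a.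
  by have := is_deriveZ a (is_derive_id (0 : R) (1 : R)); rewrite [_ *: 1]mulr1.
have [d3 d3l] := is_derive1_comp d1 d2.
have E : (fun h : R => h^-1 *: (((fun z => g (a *: z + b)) \o shift x) (h *: v) - g (a *: x + b)))
   = (fun h : R => h^-1 *: ((((fun r : R => g (r *: v + (a *: x + b))) \o (fun t : R => a *: t)) \o shift 0) (h *: 1) - ((fun r : R => g (r *: v + (a *: x + b))) \o (fun t : R => a *: t)) 0)).
  apply/funext => h /=; rewrite [h *: 1]mulr1 addr0 scaler0 scale0r add0r.
  congr (_ *: (g _ - _)); rewrite -[(a *: h) *: v]/((a * h) *: v).
  by rewrite scalerDr scalerA addrA.
apply: DeriveDef; first by rewrite /derivable E.
by rewrite /derive E.
Qed.

(** Regularity up to a finite order, on which the closure properties are proved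
    by induction. *)
Definition smooth_upto n g : Prop := forall s, (size s <= n)%N ->
  forall x, {for x, continuous (partial s g)} /\
    forall i, derivable (partial s g) x (e_ i).

Lemma smoothP g : smooth g <-> forall n, smooth_upto n g.
Proof. by split=> [h n s _ x|h s]; [exact: h|exact: (h (size s))]. Qed.

Lemma partial_cat s s' g : partial (s ++ s') g = partial s (partial s' g).
Proof. by rewrite /partial foldr_cat. Qed.

Lemma smooth_partial s g : smooth g -> smooth (partial s g).
Proof. by move=> gs s' x; rewrite -partial_cat; exact: gs. Qed.

Lemma smooth_uptoW n g : smooth_upto n.+1 g -> smooth_upto n g.
Proof. by move=> h s sn; apply: h; rewrite leqW. Qed.

Lemma smooth_uptoS n g : smooth_upto n.+1 g ->
  forall i, smooth_upto n ('D_(e_ i) g).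
Proof.
move=> h i s sn x; have -> : partial s ('D_(e_ i) g) = partial (s ++ [:: i]) g.
  by rewrite partial_cat.
by apply: h; rewrite size_cat addn1.
Qed.

Lemma smooth_uptoS_of n g : (forall x, {for x, continuous g}) ->
  (forall x i, derivable g x (e_ i)) ->
  (forall i, smooth_upto n ('D_(e_ i) g)) -> smooth_upto n.+1 g.
Proof.
move=> h1 h2 h3 s; elim/last_ind: s => [_ x|s i _]; first by split=> [|i]; [exact: h1|exact: h2].
by rewrite size_rcons ltnS -cats1 partial_cat => sn; exact: (h3 i s sn).
Qed.

Lemma smooth_upto_cont n g : smooth_upto n g -> forall x, {for x, continuous g}.
Proof. by move=> h x; have [] := h [::] isT x. Qed.

Lemma smooth_upto_derivable n g : smooth_upto n g -> forall x i, derivable g x (e_ i).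
Proof. by move=> h x; have [] := h [::] isT x. Qed.

Lemma smooth_uptoD n g h : smooth_upto n g -> smooth_upto n h ->
  smooth_upto n (g + h) /\
  forall s, (size s <= n)%N -> partial s (g + h) = partial s g + partial s h.
Proof.
elim: n g h => [|n IH] g h sg sh.
  split; last by case.
  case=> // _ x; split => /=.
    by apply: continuousD; [exact: smooth_upto_cont sg x|exact: smooth_upto_cont sh x].
  by move=> i; apply: derivableD; [exact: smooth_upto_derivable sg x i|exact: smooth_upto_derivable sh x i].
have dgh i : 'D_(e_ i) (g + h) = 'D_(e_ i) g + 'D_(e_ i) h.
  apply/funext => x; rewrite deriveD//; [exact: smooth_upto_derivable sg x i|exact: smooth_upto_derivable sh x i].
split.
  apply: smooth_uptoS_of => [x|x i|i].
  - by apply: continuousD; [exact: smooth_upto_cont sg x|exact: smooth_upto_cont sh x].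
  - by apply: derivableD; [exact: smooth_upto_derivable sg x i|exact: smooth_upto_derivable sh x i].
  - by rewrite dgh; apply IH; exact: smooth_uptoS.
elim/last_ind => // s i _; rewrite size_rcons ltnS -cats1 !partial_cat/= => sn.
by rewrite dgh (IH _ _ (smooth_uptoS sg i) (smooth_uptoS sh i)).2.
Qed.

Lemma smooth_uptoM n g h : smooth_upto n g -> smooth_upto n h ->
  smooth_upto n (g * h).
Proof.
elim: n g h => [|n IH] g h sg sh.
  case=> // _ x; split => /=.
    by apply: continuousM; [exact: smooth_upto_cont sg x|exact: smooth_upto_cont sh x].
  by move=> i; apply: derivableM; [exact: smooth_upto_derivable sg x i|exact: smooth_upto_derivable sh x i].
apply: smooth_uptoS_of => [x|x i|i].
- by apply: continuousM; [exact: smooth_upto_cont sg x|exact: smooth_upto_cont sh x].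
- by apply: derivableM; [exact: smooth_upto_derivable sg x i|exact: smooth_upto_derivable sh x i].
- have -> : 'D_(e_ i) (g * h) = g * 'D_(e_ i) h + h * 'D_(e_ i) g.
    by apply/funext => x; rewrite deriveM//; [exact: smooth_upto_derivable sg x i|exact: smooth_upto_derivable sh x i].
  by apply smooth_uptoD; apply: IH => //; (exact: smooth_uptoS || exact: smooth_uptoW).
Qed.

Lemma smoothD g h : smooth g -> smooth h -> smooth (g + h).
Proof.
move=> /smoothP sg /smoothP sh; apply/smoothP => n.
exact: (smooth_uptoD (sg n) (sh n)).1.
Qed.

Lemma partialD s g h : smooth g -> smooth h ->
  partial s (g + h) = partial s g + partial s h.
Proof.
move=> /smoothP sg /smoothP sh.
exact: (smooth_uptoD (sg (size s)) (sh (size s))).2.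
Qed.

Lemma smoothM g h : smooth g -> smooth h -> smooth (g * h).
Proof.
by move=> /smoothP sg /smoothP sh; apply/smoothP => n; exact: smooth_uptoM.
Qed.

Lemma smooth_cst (c : R) : smooth (cst c : V -> R).
Proof.
apply/smoothP => n; elim: n c => [|n IH] c.
  by case=> // _ x; split => [|i]; [exact: cst_continuous|exact: derivable_cst].
apply: smooth_uptoS_of => [x|x i|i]; [exact: cst_continuous|exact: derivable_cst|].
have -> : 'D_(e_ i) (cst c : V -> R) = cst 0.
  by apply/funext => x; rewrite derive_cst.
exact: IH.
Qed.

Lemma smoothZ (c : R) g : smooth g -> smooth (fun x => c * g x).
Proof. by move=> sg; exact: (smoothM (smooth_cst c) sg). Qed.

Lemma smooth_sum (I : Type) (r : seq I) (F : I -> V -> R) :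
  (forall i, smooth (F i)) -> smooth (fun x => \sum_(i <- r) F i x).
Proof.
move=> hF; elim: r => [|i r IH].
  by under eq_fun do rewrite big_nil; exact: smooth_cst.
by under eq_fun do rewrite big_cons; exact: smoothD.
Qed.

Lemma partial_affine s g (a : R) (b : V) : smooth g ->
  partial s (fun x => g (a *: x + b)) =
  (fun x => a ^+ size s * partial s g (a *: x + b)).
Proof.
move=> sg; elim: s => [|i s IH]; first by apply/funext => x; rewrite /= expr0 mul1r.
rewrite [LHS]/= IH; apply/funext => x.
have := is_derive_affine (derivableP ((sg s (a *: x + b)).2 i)).
move=> /(is_deriveZ (a ^+ size s)) /@derive_val ->.
by rewrite /= exprS -[_ *: _]/(_ * _); ring.
Qed.

Lemma smooth_affine g (a : R) (b : V) : smooth g -> smooth (fun x => g (a *: x + b)).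
Proof.
move=> sg s x; rewrite partial_affine//.
have [c dr] := sg s (a *: x + b); split.
  apply: continuousM; first exact: cst_continuous.
  have ca : {for x, continuous (fun z : V => a *: z + b)}.
    apply: (@continuousD _ _ _ (fun z : V => a *: z) (cst b) x).
      exact: scaler_continuous.
    exact: cst_continuous.
  exact: (@continuous_comp _ _ _ (fun z : V => a *: z + b) (partial s g) x ca c).
move=> i; have := is_derive_affine (derivableP (dr i)).
by move=> /(is_deriveZ (a ^+ size s)) /@ex_derive.
Qed.

Lemma smooth_continuous g : smooth g -> continuous g.
Proof. by move=> sg x; have [] := sg [::] x. Qed.

End smooth_functions.

(** * Compact support and decay of the transform *)

Section compact_support.
Context {R : realType} {d : nat}.
Local Notation V := 'rV[R]_d.
Local Notation e_ i := (delta_mx 0 i : 'rV[R]_d).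
Local Notation normc := (@Normc.normc R).
Implicit Types (g h u : V -> R) (s : seq 'I_d).

Definition vanishes_off u (B : R) : Prop := forall x, ~ box B x -> u x = 0.

Lemma open_setC_box (B : R) : open (~` (@box R d B)).
Proof.
rewrite openE => x /existsNP[i /negP]; rewrite -ltNge => Bx.
rewrite /interior; apply/nbhs_ballP; exists (`|x 0 i| - B) => /=; first by rewrite subr_gt0.
move=> y [_ xy] /(_ i); apply/negP; rewrite -ltNge.
have := xy 0 i; rewrite /ball/= => h.
have : `|x 0 i| <= `|x 0 i - y 0 i| + `|y 0 i| by rewrite -{1}(subrK (y 0 i) (x 0 i)) ler_normD.
lra.
Qed.

(** The complement of the box is open, so a derivative there only sees zeros. *)
Lemma vanishes_off_partial u B s : vanishes_off u B -> vanishes_off (partial s u) B.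
Proof.
move=> u0; elim: s => [//|i s IH] x hx /=.
rewrite -[RHS](@derive_cst _ V R 0 x (e_ i)).
have nx : nbhs x (~` (@box R d B)) by apply: open_nbhs_nbhs; split; [exact: open_setC_box|].
by apply: near_eq_derive; near=> y; apply: IH; near: y.
Unshelve. all: by end_near. Qed.

Lemma compact_box (B : R) : compact (@box R d B).
Proof.
rewrite (_ : box B = [set v : V | forall i, (fun=> `[- B, B]%classic) i (v ord0 i)]).
  by apply: (@rV_compact _ _ (fun=> `[- B, B]%classic)) => _; exact: segment_compact.
by apply/seteqP; split=> x /= h i; have := h i; rewrite in_itv/= ler_norml.
Qed.

Lemma vanishes_off_bounded u B : continuous u -> vanishes_off u B ->
  exists2 M, 0 <= M & forall x, `|u x| <= M.
Proof.
move=> cu u0.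
have : bounded_set (u @` box B).
  apply: compact_bounded; apply: continuous_compact; last exact: compact_box.
  exact: continuous_subspaceT.
move=> [M0 [_ hM]]; exists (`|M0| + 1) => [|x]; first by rewrite addr_ge0.
have [hx|/u0 ->] := pselect (box B x); last by rewrite normr0 addr_ge0.
apply: (hM (`|M0| + 1)); last by exists x.
by rewrite (le_lt_trans (ler_norm _))// ltrDl.
Qed.

Lemma enorm_ge (x : V) i : `|x 0 i| <= enorm x.
Proof.
rewrite /enorm -sqrtr_sqr ler_sqrt; last by apply: sumr_ge0 => j _; rewrite -expr2 sqr_ge0.
rewrite /dot (bigD1 i)//= expr2 lerDl; apply: sumr_ge0 => j _.
by rewrite -expr2 sqr_ge0.
Qed.

Lemma enorm_le_box (B : R) (x : V) : box B x -> enorm x <= d%:R * `|B|.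
Proof.
move=> hx; rewrite /enorm -[leRHS]ger0_norm ?mulr_ge0// -sqrtr_sqr ler_sqrt ?sqr_ge0//.
rewrite (@le_trans _ _ (\sum_(j < d) `|B| ^+ 2))//.
  rewrite /dot; apply: ler_sum => j _; rewrite -expr2 -real_normK ?num_real//.
  by rewrite lerXn2r ?nnegrE// (le_trans (hx j))// ler_norm.
rewrite sumr_const card_ord -[leLHS]mulr_natl [leRHS]exprMn.
apply: ler_wpM2r; first exact: sqr_ge0.
by rewrite -natrX ler_nat; case: (d) => // n; rewrite leq_pmulr.
Qed.

Lemma schwartz_vanishes_off u B : smooth u -> vanishes_off u B -> schwartz_real u.
Proof.
move=> su u0; split=> // s m.
have [M M0 hM] := vanishes_off_bounded (smooth_continuous (smooth_partial s su)) (vanishes_off_partial s u0).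
exists ((d%:R * `|B|) ^+ m * M) => x.
have [hx|/(vanishes_off_partial s u0) ->] := pselect (box B x); last first.
  by rewrite normr0 mulr0 mulr_ge0// exprn_ge0// mulr_ge0.
apply: ler_pM => //; first by rewrite exprn_ge0// sqrtr_ge0.
by rewrite lerXn2r ?nnegrE ?sqrtr_ge0 ?mulr_ge0//; exact: enorm_le_box.
Qed.

Lemma bounded_cs_real u B : continuous u -> vanishes_off u B ->
  bounded_cs (fun x => (u x)%:C%C).
Proof.
move=> cu u0; have [M _ hM] := vanishes_off_bounded cu u0; split.
- by split => /=; [exact: row_continuous_measurable|exact: measurable_cst].
- by exists M => x; rewrite normc_real.
- by exists B => x /u0 ->.
Qed.

(** Iterated differences replace integration by parts: they act on the transform
    by multiplication, and smoothness bounds them by powers of the step. *)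
Definition diff_step (t : R) (j : 'I_d) u : V -> R := fun y => u (y + t *: e_ j) - u y.

Lemma diff_stepE t j u : diff_step t j u =
  (fun y => u (1 *: y + t *: e_ j)) + (fun y => (-1) * u y).
Proof. by apply/funext => y; rewrite /diff_step fctE scale1r mulN1r. Qed.

Lemma smooth_diff_step t j u : smooth u -> smooth (diff_step t j u).
Proof.
by move=> su; rewrite diff_stepE; apply: smoothD; [exact: smooth_affine|exact: smoothZ].
Qed.

Lemma partialZ s (c : R) u : smooth u ->
  partial s (fun y => c * u y) = (fun y => c * partial s u y).
Proof.
move=> su; elim: s => [//|i s IH]; rewrite [LHS]/= IH; apply/funext => y.
exact: (deriveZ c ((su s y).2 i)).
Qed.

Lemma partial_diff_step s t j u : smooth u ->
  partial s (diff_step t j u) = diff_step t j (partial s u).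
Proof.
move=> su; rewrite diff_stepE partialD; [|exact: smooth_affine|exact: smoothZ].
rewrite partialZ// partial_affine//; apply/funext => y.
by rewrite fctE expr1n mul1r scale1r mulN1r.
Qed.

Lemma diff_step_bound t j u M : smooth u ->
  (forall y, `|partial [:: j] u y| <= M) -> forall y, `|diff_step t j u y| <= `|t| * M.
Proof.
move=> su hM y.
have dl (r : R) : is_derive r (1 : R) (fun r => u (r *: e_ j + y)) (partial [:: j] u (r *: e_ j + y)).
  by apply: is_derive_line; apply: derivableP; have [_] := su [::] (r *: e_ j + y).
have := lipschitz_of_derive dl (fun r => hM _) 0 t.
by rewrite scale0r add0r subr0 [M * _]mulrC [_ + y]addrC.
Qed.

Lemma iter_diff_step_bound n t j u M : smooth u ->
  (forall y, `|partial (nseq n j) u y| <= M) ->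
  forall y, `|iter n (diff_step t j) u y| <= `|t| ^+ n * M.
Proof.
elim: n u M => [|n IH] u M su hM y; first by rewrite expr0 mul1r; exact: hM.
rewrite iterSr exprSr -mulrA; apply: IH; first exact: smooth_diff_step.
move=> z; rewrite partial_diff_step//.
by apply: diff_step_bound => // ; exact: smooth_partial.
Qed.

Lemma vanishes_off_diff_step t j u B : vanishes_off u B ->
  vanishes_off (diff_step t j u) (B + `|t|).
Proof.
move=> u0 y hy; rewrite /diff_step !u0 ?subrr//; apply: contra_not hy.
  by apply: box_mono; rewrite lerDl.
move=> h i; have := h i; rewrite !mxE eqxx/= => hi.
rewrite -[y 0 i](addrK (t * (i == j)%:R)) (le_trans (ler_normB _ _))// lerD//.
by rewrite normrM ler_piMr//; case: (i == j); rewrite ?normr1 ?normr0.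
Qed.

Lemma smooth_iter_diff_step n t j u : smooth u -> smooth (iter n (diff_step t j) u).
Proof. by move=> su; elim: n => //= n IH; exact: smooth_diff_step. Qed.

Lemma vanishes_off_iter_diff_step n t j u B : vanishes_off u B ->
  vanishes_off (iter n (diff_step t j) u) (B + `|t| * n%:R).
Proof.
move=> u0; elim: n => [|n IH]; first by rewrite mulr0 addr0.
rewrite iterS -natr1 mulrDr mulr1 addrA; exact: vanishes_off_diff_step.
Qed.

Lemma ift_diff_step t j u B Z : smooth u -> vanishes_off u B ->
  ift (fun x => (diff_step t j u x)%:C%C) Z =
  (character (- (t *: e_ j)) Z - 1) * ift (fun x => (u x)%:C%C) Z.
Proof.
move=> su u0; have cu := smooth_continuous su.
have hu := bounded_cs_real cu u0.
have hs : bounded_cs (fun x => (u (1 *: x + t *: e_ j))%:C%C).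
  exact: (bounded_cs_affine (t *: e_ j) ltr01 hu).
have -> : (fun x => (diff_step t j u x)%:C%C) =
    (fun x => (u (1 *: x + t *: e_ j))%:C%C + (-1) * (u x)%:C%C) :> (V -> R[i]).
  by apply/funext => x; rewrite /diff_step scale1r mulN1r rmorphB.
rewrite iftD//; last exact: bounded_csZ.
rewrite iftZ// mulrBl mulN1r mul1r; congr (_ - _).
have hb : bounded_cs (fun x => character (- (t *: e_ j)) Z * ((u x)%:C%C * character Z x)).
  by apply: bounded_csZ; exact: bounded_cs_ift.
rewrite {2}/ift -cintegralZ//; last exact: bounded_cs_ift.
rewrite -(cintegral_affine (t *: e_ j) ltr01 hb) expr1n mul1r.
congr cintegral; apply/funext => x.
rewrite [in RHS]mulrCA; congr (_ * _).
rewrite [character Z (1 *: x + _)]characterC characterD scale1r [character x Z]characterC.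
by rewrite mulrCA -characterD addNr character0 mulr1.
Qed.

(** For the step [1 / (2 Z_j)] a difference multiplies the transform at [Z] by
    [-2], while [n] of them make the function as small as the [n]-th power of the
    step. *)
Lemma ift_real_decay u B n (j : 'I_d) : smooth u -> vanishes_off u B ->
  exists2 C, 0 <= C & forall Z : V, `|Z 0 j| ^+ n * normc (ift (fun x => (u x)%:C%C) Z) <= C.
Proof.
move=> su u0; have hu := bounded_cs_real (smooth_continuous su) u0.
have [C0 C00 hC0] := ift_bounded hu.
have [M M0 hM] := vanishes_off_bounded
  (smooth_continuous (smooth_partial (nseq n j) su)) (vanishes_off_partial (nseq n j) u0).
exists (C0 + 2 * M * @volume R d (B + n%:R)).
  by rewrite addr_ge0// mulr_ge0 ?mulr_ge0// volume_ge0.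
move=> Z; have [Z1|Z1] := lerP `|Z 0 j| 1.
  rewrite (@le_trans _ _ C0)//; last by rewrite lerDl mulr_ge0 ?mulr_ge0// volume_ge0.
  by rewrite -[leRHS]mul1r ler_pM ?normc_ge0 ?exprn_ge0// exprn_ile1.
rewrite (@le_trans _ _ (2 * M * @volume R d (B + n%:R)))//; last by rewrite lerDr.
(* the step for which translation multiplies the character of frequency Z by -1 *)
pose t := (2 * Z 0 j)^-1.
have Z0 : Z 0 j != 0 by rewrite -normr_gt0 (lt_trans ltr01).
have tE : `|t| = (2 * `|Z 0 j|)^-1 by rewrite /t normfV normrM ger0_norm.
have t1 : `|t| <= 1 by rewrite tE invf_le1 ?mulr_gt0 ?normr_gt0//; lra.
have c1 : character (- (t *: e_ j)) Z = -1.
  have -> : character (- (t *: e_ j)) Z = (cos (- pi) +i* sin (- pi))%C.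
    rewrite /character dotNl dotZl (_ : dot (e_ j) Z = Z 0 j); last first.
      rewrite /dot (bigD1 j)//= mxE !eqxx mul1r big1 ?addr0// => i ij.
      by rewrite mxE eqxx (negbTE ij) mul0r.
    by congr (cos _ +i* sin _)%C; rewrite /t; field.
  by rewrite cosN sinN cospi sinpi; apply: complex_eq; rewrite //= oppr0.
have iterE k : ift (fun x => (iter k (diff_step t j) u x)%:C%C) Z =
    (-2) ^+ k * ift (fun x => (u x)%:C%C) Z.
  elim: k => [|k IH]; first by rewrite expr0 mul1r.
  rewrite iterS (@ift_diff_step t j _ _ Z (@smooth_iter_diff_step k t j u su)
    (@vanishes_off_iter_diff_step k t j u B u0)) IH c1 exprS.
  by rewrite -mulrA; congr (_ * _); rewrite -opprD.
have := normc_cintegral_le (f := fun x => (iter n (diff_step t j) u x)%:C%C * character Z x)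
  (A := setT) (M := `|t| ^+ n * M) (B := B + n%:R) measurableT.
rewrite -/(ift _ Z) iterE Normc.normcM normcX => H.
have n2 : normc (- 2 : R[i]) = 2.
  by rewrite normcN (_ : 2 = 2%:C%C) ?normc_real ?ger0_norm// rmorph_nat.
rewrite n2 in H.
have {}H : 2 ^+ n * normc (ift (fun x => (u x)%:C%C) Z) <=
    2 * (`|t| ^+ n * M) * @volume R d (B + n%:R).
  apply: H => [|x|x hx].
  - have hb := bounded_cs_real (smooth_continuous (@smooth_iter_diff_step n t j u su))
      (@vanishes_off_iter_diff_step n t j u B u0).
    by have [] := bounded_cs_ift Z hb.
  - by rewrite Normc.normcM normc_character mulr1 normc_real; exact: iter_diff_step_bound.
  - rewrite (@vanishes_off_iter_diff_step n t j u B u0) ?mul0r//.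
    apply: contra_not hx; apply: box_mono; rewrite lerD2l.
    by rewrite -[leRHS]mul1r ler_wpM2r.
rewrite -(ler_pM2l (_ : 0 < `|t| ^+ n * 2 ^+ n)); last first.
  by rewrite mulr_gt0 ?exprn_gt0// tE invr_gt0 mulr_gt0 ?normr_gt0.
have tZ : `|t| ^+ n * `|Z 0 j| ^+ n * 2 ^+ n = 1.
  rewrite -!exprMn tE (_ : _ * 2 = 1) ?expr1n//.
  by rewrite mulrAC -mulrA mulVf// mulf_neq0// normr_eq0.
have -> : `|t| ^+ n * 2 ^+ n * (`|Z 0 j| ^+ n * normc (ift (fun x => (u x)%:C%C) Z)) =
   normc (ift (fun x => (u x)%:C%C) Z).
  by rewrite -[RHS]mul1r -[X in _ = X * _]tZ; ring.
have -> : `|t| ^+ n * 2 ^+ n * (2 * M * @volume R d (B + n%:R)) =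
  2 ^+ n * (2 * (`|t| ^+ n * M) * @volume R d (B + n%:R)) by ring.
set X := normc _ in H *.
have X0 : 0 <= X by exact: normc_ge0.
have n1 : 1 <= 2 ^+ n :> R by rewrite exprn_ege1// ler1n.
rewrite (@le_trans _ _ (2 ^+ n * X))//; first by rewrite ler_peMl.
rewrite (le_trans H)// ler_peMl// (le_trans _ H)// mulr_ge0// (le_trans _ n1)//.
Qed.

End compact_support.

(** * Frequency profiles and correlations *)

Section cutoff_symbols.
Context {R : realType} {d : nat}.
Local Notation V := 'rV[R]_d.
Local Notation normc := (@Normc.normc R).
Variable phi : V -> R[i].
Hypothesis phi_cutoff : cutoff phi.

Lemma cutoff_supported : supported_in phi 2.
Proof.
have [_ _ p0] := phi_cutoff; move=> x /existsNP[i /negP]; rewrite -ltNge => hx.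
by apply: p0; rewrite (le_trans (ltW hx))// enorm_ge.
Qed.

Lemma cutoff_Re : smooth (fun x => complex.Re (phi x)) /\
  vanishes_off (fun x => complex.Re (phi x)) 2.
Proof.
have [[[s1 _] _] _ _] := phi_cutoff.
by split=> // x /cutoff_supported ->.
Qed.

Lemma cutoff_Im : smooth (fun x => complex.Im (phi x)) /\
  vanishes_off (fun x => complex.Im (phi x)) 2.
Proof.
have [[_ [s1 _]] _ _] := phi_cutoff.
by split=> // x /cutoff_supported ->.
Qed.

Lemma cutoff_decomp :
  phi = (fun x => (complex.Re (phi x))%:C%C + (0 +i* 1)%C * (complex.Im (phi x))%:C%C).
Proof.
by apply/funext => x; apply: complex_eq;
  rewrite ?Re_complexD ?Im_complexD ?Re_complexM ?Im_complexM /=; ring.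
Qed.

Lemma cutoff_bounded_cs : bounded_cs phi.
Proof.
have [s1 v1] := cutoff_Re; have [s2 v2] := cutoff_Im.
rewrite cutoff_decomp; apply: bounded_csD.
  exact: bounded_cs_real (smooth_continuous s1) v1.
by apply: bounded_csZ; exact: bounded_cs_real (smooth_continuous s2) v2.
Qed.

Lemma cutoff_decay n (j : 'I_d) :
  exists2 C, 0 <= C & forall Z : V, `|Z 0 j| ^+ n * normc (ift phi Z) <= C.
Proof.
have [s1 v1] := cutoff_Re; have [s2 v2] := cutoff_Im.
have [C1 C10 h1] := ift_real_decay n j s1 v1.
have [C2 C20 h2] := ift_real_decay n j s2 v2.
have b1 := bounded_cs_real (smooth_continuous s1) v1.
have b2 := bounded_cs_real (smooth_continuous s2) v2.
exists (C1 + C2) => [|Z]; first exact: addr_ge0.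
rewrite cutoff_decomp iftD//; last exact: bounded_csZ.
rewrite iftZ// (le_trans (ler_wpM2l _ (le_normcD _ _))) ?exprn_ge0//.
rewrite mulrDr Normc.normcM (_ : normc (0 +i* 1)%C = 1) ?mul1r ?lerD//.
by rewrite /= expr0n add0r expr1n sqrtr1.
Qed.

(** The frequency profiles of the resolution of unity: the [k]-th piece has
    symbol [symbol k] dilated by [2 ^ k]. *)
Definition symbol (k : nat) : V -> R[i] :=
  if k is _.+1 then fun xi => phi xi - phi (2 *: xi) else phi.

Lemma dyadic_symbol k : dyadic phi k = (fun xi => symbol k (2 ^- k *: xi)).
Proof.
apply/funext => xi; case: k => [|k] /=; first by rewrite expr0 invr1 scale1r.
by rewrite scalerA exprS invfM mulrA divff// mul1r.
Qed.

Lemma bounded_cs_scale (a : R) (f : V -> R[i]) : 0 < a -> bounded_cs f ->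
  bounded_cs (fun x => f (a *: x)).
Proof.
by move=> a0 /(bounded_cs_affine 0 a0); under eq_fun do rewrite addr0.
Qed.

Lemma bounded_cs_symbol k : bounded_cs (symbol k).
Proof.
have h := cutoff_bounded_cs; case: k => [//|k].
apply: bounded_csD => //; apply: bounded_csN.
exact: bounded_cs_scale.
Qed.

Lemma ift_dyadic k Z :
  ift (dyadic phi k) Z = (2 ^+ k ^+ d)%:C%C * ift (symbol k) (2 ^+ k *: Z).
Proof.
have a0 : 0 < 2 ^- k :> R by rewrite invr_gt0 exprn_gt0.
rewrite dyadic_symbol -[X in X *: Z]invrK -(ift_scale Z a0 (bounded_cs_symbol k)).
by rewrite mulrA -rmorphM/= -exprMn divff ?expf_neq0// expr1n mul1r.
Qed.

Lemma symbol_decay k n (j : 'I_d) :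
  exists2 C, 0 <= C & forall Z : V, `|Z 0 j| ^+ n * normc (ift (symbol k) Z) <= C.
Proof.
have [C C0 hC] := cutoff_decay n j; case: k => [|k]; first by exists C.
have h := cutoff_bounded_cs.
have b2 : bounded_cs (fun xi => phi (2 *: xi)) by exact: bounded_cs_scale.
exists (C + 2 ^+ n * C) => [|Z]; first by rewrite addr_ge0// mulr_ge0// exprn_ge0.
rewrite /symbol iftD//; last exact: bounded_csN.
rewrite (le_trans (ler_wpM2l _ (le_normcD _ _))) ?exprn_ge0//.
rewrite mulrDr lerD//.
have -> : ift (fun xi => - phi (2 *: xi)) Z = - (((2 ^+ d)^-1)%:C%C * ift phi (2^-1 *: Z)).
  rewrite -(ift_scale Z (ltr0Sn R 1) h) mulrA -rmorphM/= mulVf ?expf_neq0// mul1r.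
  by rewrite -mulN1r -iftZ//; congr ift; apply/funext => xi; rewrite mulN1r.
rewrite normcN Normc.normcM normc_real [`|2 ^- d|]ger0_norm ?invr_ge0 ?exprn_ge0//.
have := hC (2^-1 *: Z); rewrite mxE normrM [`|2^-1|]ger0_norm//.
set g := normc _ => h1; have g0 : 0 <= g by exact: normc_ge0.
have -> : `|Z 0 j| ^+ n = 2 ^+ n * (2^-1 * `|Z 0 j|) ^+ n.
  by rewrite -exprMn mulrA divff// mul1r.
rewrite -mulrA ler_wpM2l ?exprn_ge0// (le_trans _ h1)//.
rewrite ler_wpM2l ?exprn_ge0 ?mulr_ge0// ler_piMl//.
by rewrite invf_le1 ?exprn_gt0// exprn_ege1// ler1n.
Qed.

Lemma symbolS_eq0 k xi : enorm xi <= 2^-1 -> symbol k.+1 xi = 0.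
Proof.
have [_ p1 _] := phi_cutoff; move=> h /=.
rewrite !p1 ?subrr//; last by rewrite (le_trans h)// invf_le1// ler1n.
have -> : enorm (2 *: xi) = 2 * enorm xi.
  by rewrite /enorm dotZl dotZr mulrA -expr2 sqrtrM ?sqr_ge0// sqrtr_sqr ger0_norm.
by rewrite mulrC -ler_pdivlMr// mul1r.
Qed.

(** The profiles of positive index vanish near the origin; the coordinate found
    here is the one along which the decay of a transform gets used. *)
Lemma symbolS_coord k xi : symbol k.+1 xi != 0 ->
  exists j : 'I_d, (2 * d%:R)^-1 <= `|xi 0 j|.
Proof.
move=> h; apply: contrapT => /forallNP hj; move/eqP: h; apply.
apply: symbolS_eq0.
have hb : box ((2 * d%:R)^-1) xi.
  by move=> j; have /negP := hj j; rewrite -ltNge => /ltW.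
rewrite (le_trans (enorm_le_box hb))// ger0_norm ?invr_ge0 ?mulr_ge0//.
rewrite invfM mulrCA; case: (d) => [|n]; first by rewrite mul0r mulr0 invr_ge0.
by rewrite divff ?mulr1// pnatr_eq0.
Qed.

End cutoff_symbols.

Lemma exprD_le {R : realType} (a b : R) n : 0 <= a -> 0 <= b -> (a + b) ^+ n <= 2 ^+ n * (a ^+ n + b ^+ n).
Proof.
wlog ab : a b / a <= b => [hw a0 b0|a0 b0].
  have [ab|/ltW ba] := leP a b; first exact: hw.
  by rewrite addrC [a ^+ n + _]addrC; exact: hw.
rewrite (@le_trans _ _ (2 ^+ n * b ^+ n))//; last first.
  by rewrite ler_wpM2l ?exprn_ge0// lerDr exprn_ge0.
by rewrite -exprMn lerXn2r ?nnegrE ?addr_ge0 ?mulr_ge0//; lra.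
Qed.

Section correlation.
Context {R : realType} {d : nat}.
Local Notation V := 'rV[R]_d.
Local Notation normc := (@Normc.normc R).
Variable phi : V -> R[i].
Hypothesis phi_cutoff : cutoff phi.
Variables (F : V -> R) (r : R).
Hypothesis F_smooth : smooth F.
Hypothesis F_supp : vanishes_off F r.
Hypothesis F_mean0 : ift (fun x => (F x)%:C%C) 0 = 0.

Let Fc x : R[i] := (F x)%:C%C.
Let Fc_cs : bounded_cs Fc := bounded_cs_real (smooth_continuous F_smooth) F_supp.

(** Up to normalisation and rescaling, the [k]-th piece of the profile [F]
    concentrated at scale [2 ^- l], where [t = 2 ^ k / 2 ^ l]. *)
Definition corr (m : V -> R[i]) (t : R) (X : V) : R[i] :=
  cintegral setT (fun y => Fc y * ift m (X - t *: y)).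

(** Low output frequencies see only the vanishing mean of [F]. *)
Lemma corr_small (m : V -> R[i]) : bounded_cs m ->
  exists2 C, 0 <= C & forall t X, 0 <= t -> normc (corr m t X) <= C * t.
Proof.
move=> hm; have [CF CF0 lip] := ift_lipschitz Fc_cs.
have [_ [M mM] [B mB]] := hm.
have M0 : 0 <= M by exact: le_trans (normc_ge0 _) (mM 0).
exists (2 * (M * (CF * (d%:R * `|B|))) * @volume R d B) => [|t X t0].
  by rewrite mulr_ge0 ?volume_ge0// !mulr_ge0.
rewrite /corr ift_convolution// (_ : _ * t =
  2 * (M * (CF * (t * (d%:R * `|B|)))) * @volume R d B); last by ring.
have hc := bounded_cs_ift_opp t hm Fc_cs.
have [mc _ _] := bounded_cs_ift X hc.
apply: normc_cintegral_le => // [xi|xi /mB ->]; last by rewrite !mul0r.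
rewrite !Normc.normcM normc_character mulr1.
have [hx|hx] := pselect (box B xi); last first.
  by rewrite mB// Normc.normc0 mul0r !mulr_ge0.
apply: ler_pM; rewrite ?normc_ge0//.
rewrite -[ift Fc _]subr0 -[X in _ - X]F_mean0 (le_trans (lip _ _))//.
apply: ler_wpM2l => //; rewrite subr0 /l1norm.
have -> : t * (d%:R * `|B|) = \sum_(j < d) t * `|B|.
  by rewrite sumr_const card_ord -mulr_natl; ring.
apply: ler_sum => j _; rewrite !mxE normrN normrM (ger0_norm t0).
by rewrite ler_wpM2l// (le_trans (hx j))// ler_norm.
Qed.

(** High output frequencies see the smoothness of [F]. *)
Lemma corr_large M k :
  exists2 C, 0 <= C & forall t X, 0 < t -> t ^+ M * normc (corr (symbol phi k.+1) t X) <= C.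
Proof.
have hm := bounded_cs_symbol phi_cutoff k.+1.
have /choice[CF hCF] : forall j, exists C, 0 <= C /\
    forall Z : V, `|Z 0 j| ^+ M * normc (ift Fc Z) <= C.
  by move=> j; have [C C0 h] := ift_real_decay M j F_smooth F_supp; exists C.
have [_ [K mK] [B mB]] := hm.
have K0 : 0 <= K by exact: le_trans (normc_ge0 _) (mK 0).
pose S := \sum_j (2 * d%:R) ^+ M * CF j.
have S0 : 0 <= S.
  by apply: sumr_ge0 => j _; rewrite mulr_ge0 ?exprn_ge0 ?mulr_ge0//; have [] := hCF j.
exists (2 * (K * S) * @volume R d B) => [|t X t0].
  by rewrite mulr_ge0 ?volume_ge0// !mulr_ge0.
rewrite /corr ift_convolution//.
have hc := bounded_cs_ift_opp t hm Fc_cs.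
have tM : t ^+ M = normc (t ^+ M)%:C%C.
  by rewrite normc_real ger0_norm// exprn_ge0// ltW.
rewrite tM -Normc.normcM -iftZ//.
have [mc _ _] := bounded_cs_ift X (bounded_csZ (t ^+ M)%:C%C hc).
apply: normc_cintegral_le => // [xi|xi /mB ->]; last by rewrite mul0r mulr0 mul0r.
rewrite !Normc.normcM normc_character mulr1 -tM mulrCA.
have [->|/symbolS_coord -/(_ phi_cutoff)[j hj]] := eqVneq (symbol phi k.+1 xi) 0.
  by rewrite Normc.normc0 mul0r !mulr_ge0.
apply: ler_pM; rewrite ?normc_ge0 ?mulr_ge0 ?exprn_ge0 ?(ltW t0) ?normc_ge0//.
rewrite (@le_trans _ _ ((2 * d%:R) ^+ M * CF j))//; last first.
  rewrite /S (bigD1 j)//= lerDl sumr_ge0// => i _.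
  by rewrite mulr_ge0 ?exprn_ge0 ?mulr_ge0//; have [] := hCF i.
have d0 : 0 < d%:R :> R by rewrite ltr0n (leq_trans _ (ltn_ord j)).
have /(ler_wpM2l _) := (hCF j).2 (- (t *: xi)) => /(_ ((2 * d%:R) ^+ M)) H.
have {}H := H (exprn_ge0 _ (mulr_ge0 (ler0n _ _) (ler0n _ _))).
apply: le_trans H; rewrite mulrA ler_wpM2r ?normc_ge0// -exprMn lerXn2r ?nnegrE ?(ltW t0) ?mulr_ge0//.
rewrite !mxE normrN normrM (gtr0_norm t0) mulrCA ler_peMr ?(ltW t0)//.
by rewrite -ler_pdivrMl ?mulr1// mulr_gt0.
Qed.

(** [F] lives in a box and the transform of the symbol decays rapidly, so the
    correlation is concentrated on a box of size comparable to [1 + t]. *)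
Lemma corr_decay k n (j : 'I_d) :
  exists2 C, 0 <= C & forall t (X : V), 0 <= t ->
    `|X 0 j| ^+ n * normc (corr (symbol phi k) t X) <= C * (1 + t) ^+ n.
Proof.
have hm := bounded_cs_symbol phi_cutoff k.
have [Cn Cn0 hCn] := symbol_decay phi_cutoff k n j.
have [C0 C00 hC0] := ift_bounded hm.
have [M M0 hM] := vanishes_off_bounded (smooth_continuous F_smooth) F_supp.
have [K [K0 KE]] : exists K, 0 <= K /\ K = 2 ^+ n * (Cn + `|r| ^+ n * C0).
  eexists; split; last by [].
  by rewrite mulr_ge0 ?exprn_ge0// addr_ge0// mulr_ge0// exprn_ge0.
exists (2 * (M * K) * @volume R d r) => [|t X t0].
  by rewrite mulr_ge0 ?volume_ge0// !mulr_ge0.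
have XM : `|X 0 j| ^+ n = normc (`|X 0 j| ^+ n)%:C%C.
  by rewrite normc_real [RHS]ger0_norm// exprn_ge0.
have hc := bounded_cs_ift_sub t X Fc_cs hm.
rewrite XM -Normc.normcM /corr -cintegralZ//.
rewrite (_ : _ * (1 + t) ^+ n = 2 * (M * (K * (1 + t) ^+ n)) * @volume R d r); last by ring.
have [mc _ _] := bounded_csZ (`|X 0 j| ^+ n)%:C%C hc.
apply: normc_cintegral_le => // [y|y hy]; last by rewrite /Fc F_supp// mul0r mulr0.
have [hy|hy] := pselect (box r y); last first.
  rewrite /Fc F_supp// mul0r mulr0 Normc.normc0 !mulr_ge0// exprn_ge0// addr_ge0//.
rewrite !Normc.normcM -XM mulrCA; apply: ler_pM; rewrite ?normc_ge0//.
- by rewrite mulr_ge0 ?exprn_ge0 ?normc_ge0.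
- by rewrite normc_real.
set Z := X - t *: y; set g := normc _.
have g0 : 0 <= g by exact: normc_ge0.
have XZ : `|X 0 j| <= `|Z 0 j| + t * `|r|.
  have -> : X 0 j = Z 0 j + t * y 0 j by rewrite !mxE subrK.
  rewrite (le_trans (ler_normD _ _))// lerD2l normrM (ger0_norm t0) ler_wpM2l//.
  by rewrite (le_trans (hy j))// ler_norm.
rewrite (@le_trans _ _ ((2 ^+ n * (`|Z 0 j| ^+ n + (t * `|r|) ^+ n)) * g))//.
  rewrite ler_wpM2r// (le_trans _ (exprD_le _ _ _)) ?mulr_ge0//.
  by rewrite lerXn2r ?nnegrE// addr_ge0// mulr_ge0.
rewrite KE -!mulrA ler_wpM2l ?exprn_ge0// mulrDl mulrDl lerD//.
  rewrite (le_trans (hCn Z))// ler_peMr// exprn_ege1// lerDl//.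
rewrite (_ : (t * `|r|) ^+ n * g = `|r| ^+ n * (g * t ^+ n)); last first.
  by rewrite exprMn; ring.
rewrite -mulrA ler_wpM2l ?exprn_ge0//.
apply: ler_pM; rewrite ?exprn_ge0 ?hC0//.
by rewrite lerXn2r ?nnegrE ?addr_ge0// lerDr.
Qed.

(** The reciprocal is integrable and factors over the coordinates. *)
Definition weight (X : V) : R := \prod_j (1 + X 0 j ^+ 2).

Lemma weight_ge1 X : 1 <= weight X.
Proof.
rewrite /weight; elim/big_ind: _ => // [x y x1 y1|j _].
  by rewrite -[leLHS]mulr1 ler_pM.
by rewrite lerDl sqr_ge0.
Qed.

(** The coordinate of largest modulus dominates every factor. *)
Lemma weight_le X n : (0 < d)%N ->
  exists j : 'I_d, weight X ^+ n <= 2 ^+ (d * n) * (1 + `|X 0 j| ^+ (2 * (d * n))).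
Proof.
move=> d0; pose i0 := Ordinal d0.
have [j _ hj] := arg_maxP (fun i => `|X 0 i|) (isT : xpredT i0).
exists j; rewrite (@le_trans _ _ ((1 + X 0 j ^+ 2) ^+ (d * n)))//.
  rewrite exprM lerXn2r ?nnegrE ?exprn_ge0 ?addr_ge0 ?sqr_ge0//.
    exact: le_trans (weight_ge1 X).
  rewrite /weight -[X in _ ^+ X]card_ord -prodr_const; apply: ler_prod => i _.
  rewrite addr_ge0 ?sqr_ge0//= lerD2l -real_normK ?num_real//.
  by rewrite -[leRHS]real_normK ?num_real// lerXn2r ?nnegrE//; exact: hj.
rewrite (le_trans (exprD_le _ _ _)) ?sqr_ge0// expr1n ler_wpM2l ?exprn_ge0//.
by rewrite lerD2l [leRHS]exprM real_normK ?num_real.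
Qed.

Lemma corr_weight k n : (0 < d)%N -> exists2 C, 0 <= C & forall t X, 0 <= t ->
  weight X ^+ n * normc (corr (symbol phi k) t X) <= C * (1 + t) ^+ (2 * (d * n)).
Proof.
move=> d0; pose N := (2 * (d * n))%N.
have /choice[CF hCF] : forall j, exists C, 0 <= C /\ forall t (X : V), 0 <= t ->
    `|X 0 j| ^+ N * normc (corr (symbol phi k) t X) <= C * (1 + t) ^+ N.
  by move=> j; have [C C0 h] := corr_decay k N j; exists C.
have [C1 C10 hC1] := corr_decay k 0 (Ordinal d0).
exists (2 ^+ (d * n) * (C1 + \sum_j CF j)) => [|t X t0].
  rewrite mulr_ge0 ?exprn_ge0// addr_ge0// sumr_ge0// => j _.
  by have [] := hCF j.
have [j hj] := weight_le X n d0; set g := normc _.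
have g0 : 0 <= g by exact: normc_ge0.
rewrite (le_trans (ler_wpM2r g0 hj))// -!mulrA ler_wpM2l ?exprn_ge0//.
rewrite mulrDl mul1r mulrDl lerD//.
  have := hC1 t X t0; rewrite !expr0 mul1r mulr1 => h.
  by rewrite (le_trans h)// ler_peMr// exprn_ege1// lerDl.
rewrite (le_trans ((hCF j).2 t X t0))// ler_wpM2r ?exprn_ge0 ?addr_ge0//.
rewrite (bigD1 j)//= lerDl sumr_ge0// => i _.
by have [] := hCF i.
Qed.

(** Almost orthogonality. One factor of the square is bounded through the distance
    between the scales, by the zero mean of [F] if [k <= l] and by its smoothness
    if [l < k]; the other factor is bounded through the weight. The latter bound
    grows polynomially in [t], which one more power of smoothness absorbs. *)
Lemma corr_main n : (0 < d)%N -> exists2 C, 0 <= C & forall k l X,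
  normc (corr (symbol phi k) (2 ^+ k / 2 ^+ l) X) ^+ 2 * weight X ^+ n <=
  C * 2^-1 ^+ ((k - l) + (l - k)).
Proof.
move=> d0; pose N := (2 * (d * n))%N.
have h0 := bounded_cs_symbol phi_cutoff 0; have h1 := bounded_cs_symbol phi_cutoff 1.
have [A0 A00 hA0] := corr_small h0.
have [A1 A10 hA1] := corr_small h1.
have [W0 W00 hW0] := corr_weight 0 n d0.
have [W1 W10 hW1] := corr_weight 1 n d0.
have [L L0 hL] := corr_large N.+1 0.
pose C := (A0 + A1 + L) * (W0 + W1) * 2 ^+ N.
exists C => [|k l X]; first by rewrite !mulr_ge0 ?addr_ge0 ?exprn_ge0.
(* there are only two different symbols, so the constants are uniform in k *)
have -> : normc (corr (symbol phi k) (2 ^+ k / 2 ^+ l) X) =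
    normc (corr (symbol phi (k != 0)%N) (2 ^+ k / 2 ^+ l) X) by case: k.
set t := 2 ^+ k / 2 ^+ l; set g := normc _; set w := weight X ^+ n.
have g0 : 0 <= g by exact: normc_ge0.
have t0 : 0 < t by rewrite divr_gt0 ?exprn_gt0.
have w0 : 0 <= w by rewrite exprn_ge0// (le_trans _ (weight_ge1 X)).
have hw : w * g <= (W0 + W1) * (1 + t) ^+ N.
  rewrite mulrDl /g; case: (k != 0)%N => /=.
    rewrite (le_trans (hW1 t X (ltW t0)))// lerDr mulr_ge0// exprn_ge0// addr_ge0//.
    exact: ltW.
  rewrite (le_trans (hW0 t X (ltW t0)))// lerDl mulr_ge0// exprn_ge0// addr_ge0//.
  exact: ltW.
have -> : g ^+ 2 * w = g * (w * g) by ring.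
have [kl|lk] := leqP k l.
  have t1 : t <= 1 by rewrite ler_pdivrMr ?exprn_gt0// mul1r ler_eXn2l ?ltr1n.
  have hg : g <= (A0 + A1 + L) * t.
    rewrite (@le_trans _ _ ((A0 + A1) * t))//; last first.
      by rewrite ler_wpM2r ?(ltW t0)// lerDl.
    rewrite mulrDl /g; case: (k != 0)%N => /=.
      by rewrite (le_trans (hA1 t X (ltW t0)))// lerDr mulr_ge0// ltW.
    by rewrite (le_trans (hA0 t X (ltW t0)))// lerDl mulr_ge0// ltW.
  have -> : 2^-1 ^+ (k - l + (l - k)) = t.
    by rewrite (eqP kl) add0n /t -[in RHS](subnK kl) exprD invfM mulrCA divff
      ?expf_neq0// mulr1 exprVn.
  rewrite /C (_ : _ * t = (A0 + A1 + L) * t * ((W0 + W1) * 2 ^+ N)); last by ring.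
  apply: ler_pM; rewrite ?mulr_ge0//.
  rewrite (le_trans hw)// ler_wpM2l ?addr_ge0// lerXn2r ?nnegrE ?addr_ge0 ?(ltW t0)//.
  lra.
have kn : (k != 0)%N by rewrite -lt0n (leq_ltn_trans _ lk).
have t1 : 1 <= t by rewrite ler_pdivlMr ?exprn_gt0// mul1r ler_eXn2l ?ltr1n// ltnW.
have hg : t ^+ N.+1 * g <= L by rewrite /g kn; exact: hL.
have -> : 2^-1 ^+ (k - l + (l - k)) = t^-1.
  by rewrite [(l - k)%N](eqP (ltnW lk)) addn0 /t -[in RHS](subnK (ltnW lk)) exprD -mulrA divff
    ?expf_neq0// mulr1 exprVn.
rewrite ler_pdivlMr// -(ler_pM2l (exprn_gt0 N t0)).
rewrite (_ : t ^+ N * (g * (w * g) * t) = (t ^+ N.+1 * g) * (w * g)); last first.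
  by rewrite exprS; ring.
rewrite (_ : t ^+ N * C = (A0 + A1 + L) * ((W0 + W1) * (2 * t) ^+ N)); last first.
  by rewrite [(2 * t) ^+ N]exprMn /C; ring.
apply: ler_pM; [|exact: mulr_ge0| |].
  by rewrite mulr_ge0// exprn_ge0// ltW.
  by rewrite (le_trans hg)// lerDr addr_ge0.
rewrite (le_trans hw)// ler_wpM2l ?addr_ge0// lerXn2r ?nnegrE ?addr_ge0 ?mulr_ge0 ?(ltW t0)//.
lra.
Qed.

(** The normalisation keeps the integral independent of the scale; with it the
    atoms of all scales have comparable Besov norms at smoothness [d / p - d]. *)
Definition atom (l : nat) (z : V) : V -> R :=
  fun x => 2 ^+ l ^+ d * F (2 ^+ l *: x + - (2 ^+ l *: z)).

Lemma lp_piece_atom k l z x :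
  lp_piece phi k (regular_distr (fun y => (atom l z y)%:C%C)) x =
  (2 ^+ k ^+ d)%:C%C * corr (symbol phi k) (2 ^+ k / 2 ^+ l) (2 ^+ k *: (x - z)).
Proof.
have l0 : 0 < 2 ^+ l :> R by rewrite exprn_gt0.
have hm := bounded_cs_symbol phi_cutoff k.
pose h v := Fc v * ((2 ^+ k ^+ d)%:C%C *
  ift (symbol phi k) (2 ^+ k *: (x - z) - (2 ^+ k / 2 ^+ l) *: v)).
have hE v : h v = (2 ^+ k ^+ d)%:C%C * (Fc v *
  ift (symbol phi k) (2 ^+ k *: (x - z) - (2 ^+ k / 2 ^+ l) *: v)).
  by rewrite /h mulrCA.
have hc := bounded_cs_ift_sub (2 ^+ k / 2 ^+ l) (2 ^+ k *: (x - z)) Fc_cs hm.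
have hh : bounded_cs h by rewrite (funext hE); exact: bounded_csZ.
rewrite lp_pieceE /corr -cintegralZ// -(funext hE).
have hha := bounded_cs_affine (- (2 ^+ l *: z)) l0 hh.
rewrite -[RHS](cintegral_affine (- (2 ^+ l *: z)) l0 hh).
rewrite -[RHS](cintegralZ _ measurableT hha).
congr cintegral; apply/funext => y; rewrite /h ift_dyadic// /atom rmorphM/= -!mulrA.
do 3 congr (_ * _); congr ift.
rewrite -(scalerBr (2 ^+ l) y z) scalerA divfK ?expf_neq0// -scalerBr.
by congr (_ *: _); rewrite opprB addrA subrK.
Qed.

End correlation.

(** * Powers and geometric sums *)

Section powers.
Context {R : realType}.
Implicit Types (a b p : R).

Lemma powR_subadditive a b p : 0 <= a -> 0 <= b -> 0 < p -> p <= 1 ->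
  (a + b) `^ p <= a `^ p + b `^ p.
Proof.
move=> a0 b0 p0 p1.
have [ab|] := ltrP 0 (a + b); last first.
  move=> ab; have -> : a + b = 0 by apply/eqP; rewrite eq_le ab addr_ge0.
  by rewrite powR0 ?gt_eqF// addr_ge0// powR_ge0.
(* compare each fraction of the sum with its p-th power *)
have frac c : 0 <= c -> c <= a + b -> c / (a + b) * (a + b) `^ p <= c `^ p.
  move=> c0 cab; have [->|cn0] := eqVneq c 0.
    by rewrite mul0r mul0r powR_ge0.
  have cp : 0 < c by rewrite lt_neqAle eq_sym cn0.
  have -> : c `^ p = (c / (a + b)) `^ p * (a + b) `^ p.
    by rewrite -powRM ?divr_ge0 ?(ltW ab)// divfK// gt_eqF.
  rewrite ler_wpM2r ?powR_ge0// ger1_powR//.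
  by rewrite divr_gt0//= ler_pdivrMr// mul1r.
have ha : a / (a + b) * (a + b) `^ p <= a `^ p by apply: frac => //; rewrite lerDl.
have hb : b / (a + b) * (a + b) `^ p <= b `^ p by apply: frac => //; rewrite lerDr.
apply: le_trans (lerD ha hb).
by rewrite -mulrDl -mulrDl divff ?mul1r// gt_eqF.
Qed.

Lemma powR_sum_le (I : Type) (s : seq I) (F : I -> R) p : (forall i, 0 <= F i) ->
  0 < p -> p <= 1 -> (\sum_(i <- s) F i) `^ p <= \sum_(i <- s) F i `^ p.
Proof.
move=> F0 p0 p1; elim: s => [|i s IH]; first by rewrite !big_nil powR0// gt_eqF.
rewrite !big_cons (le_trans (powR_subadditive _ _ p0 p1)) ?lerD2l//.
exact: sumr_ge0.
Qed.

Lemma powR_exprn (x y : R) n : 0 <= x -> (x `^ y) ^+ n = (x ^+ n) `^ y.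
Proof. by move=> x0; rewrite -(powR_mulrn n (powR_ge0 x y)) -(powR_mulrn n x0) powRAC. Qed.

Lemma geometric_two_sided (r : R) n l : 0 <= r -> r < 1 ->
  \sum_(k < n) r ^+ ((k - l) + (l - k)) <= 2 / (1 - r).
Proof.
move=> r0 r1; have r1' : 0 < 1 - r by rewrite subr_gt0.
rewrite ler_pdivlMr//.
suff: (\sum_(k < n) r ^+ ((k - l) + (l - k))) * (1 - r) <= 2 - r ^+ l.+1.
  by move=> /le_trans; apply; rewrite gerBl exprn_ge0.
elim: l n => [|l IH] n.
  have -> : (\sum_(k < n) r ^+ (k - 0 + (0 - k))) = \sum_(k < n) r ^+ k.
    by apply: eq_bigr => k _; rewrite subn0 sub0n addn0.
  have -> : (\sum_(k < n) r ^+ k) * (1 - r) = 1 - r ^+ n.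
    by rewrite -[RHS]opprB subrX1 -mulNr opprB mulrC.
  by rewrite expr1; have := exprn_ge0 n r0; lra.
case: n => [|n].
  rewrite big_ord0 mul0r subr_ge0 (@le_trans _ _ 1) ?ler1n//.
  by apply: exprn_ile1 => //; exact: ltW.
rewrite big_ord_recl sub0n add0n subn0 mulrDl.
have -> : \sum_(i < n) r ^+ (lift ord0 i - l.+1 + (l.+1 - lift ord0 i)) =
   \sum_(k < n) r ^+ (k - l + (l - k)).
  by apply: eq_bigr => k _; rewrite lift0 !subSS.
by have := IH n; rewrite !exprS; lra.
Qed.

End powers.

(** * Measurability of the pieces and integrability of the weight *)

Section measurable_modulus.
Context {R : realType} {d : nat}.
Local Notation V := 'rV[R]_d.
Local Notation mu := (@lebesgue_row R d).
Local Notation normc := (@Normc.normc R).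

Lemma measurable_normc (f : V -> R[i]) : cmeasurable f ->
  measurable_fun setT (fun x => normc (f x)).
Proof.
move=> [m1 m2].
have -> : (fun x => normc (f x)) =
    (fun x => Num.sqrt (complex.Re (f x) ^+ 2 + complex.Im (f x) ^+ 2)).
  by apply/funext => x; case: (f x).
apply: (measurableT_comp (continuous_measurable_fun (@sqrt_continuous R))).
by apply: measurable_funD; exact: measurable_funX.
Qed.

Lemma lp_piece_ift (phi : V -> R[i]) k (f : V -> R[i]) :
  cutoff phi -> bounded_cs f ->
  lp_piece phi k (regular_distr f) =
    ift (fun xi => dyadic phi k xi * ift f (- xi)) /\
  bounded_cs (fun xi => dyadic phi k xi * ift f (- xi)).
Proof.
move=> hphi hf.
have hd : bounded_cs (dyadic phi k).
  rewrite dyadic_symbol; apply: bounded_cs_scale; first by rewrite invr_gt0 exprn_gt0.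
  exact: bounded_cs_symbol.
split.
  apply/funext => x; rewrite lp_pieceE.
  have -> : (fun xi => dyadic phi k xi * ift f (- xi)) =
      (fun xi => dyadic phi k xi * ift f (- (1 *: xi))).
    by apply/funext => xi; rewrite scale1r.
  apply: etrans (ift_convolution 1 x hf hd); congr (cintegral _ _).
  by apply/funext => y; rewrite scale1r.
have := bounded_cs_ift_opp 1 hd hf.
by congr bounded_cs; apply/funext => xi; rewrite scale1r.
Qed.

Lemma measurable_weightV : measurable_fun setT (fun X : V => (weight X)^-1).
Proof.
have -> : (fun X : V => (weight X)^-1) = (fun X => \prod_j (1 + X 0 j ^+ 2)^-1).
  by apply/funext => X; rewrite /weight prodfV.
apply: (measurable_row_prod (w := fun=> fun x => (1 + x ^+ 2)^-1)) => i.
exact: (continuous_measurable_fun (@continuous_oneDsqrV R)).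
Qed.

Lemma integral_weightV_fin : (\int[mu]_X ((weight X)^-1)%:E < +oo)%E.
Proof.
have -> : (\int[mu]_X ((weight X)^-1)%:E = \int[mu]_X (\prod_(j < d) (1 + X 0 j ^+ 2)^-1)%:E)%E.
  by apply: eq_integral => X _; rewrite /weight prodfV.
rewrite (ge0_integral_row_prod (w := fun=> fun x => (1 + x ^+ 2)^-1)); last 2 first.
- by move=> i; exact: (continuous_measurable_fun (@continuous_oneDsqrV R)).
- by move=> i x; rewrite invr_ge0 addr_ge0 ?sqr_ge0.
rewrite -ge0_fin_numE; last first.
  by apply: prode_ge0 => i _; apply: integral_ge0 => x _; rewrite lee_fin invr_ge0 addr_ge0 ?sqr_ge0.
apply: prode_fin_num => i _.
have -> : (\int[lebesgue_measure]_x ((1 + x ^+ 2)^-1)%:E =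
   2%:E * \int[lebesgue_measure]_(x in [set x : R | (0 <= x)%R]) ((1 + x ^+ 2)^-1)%:E)%E.
  apply: ge0_symfun_integralT; last by move=> x /=; rewrite sqrrN.
    by move=> x; rewrite invr_ge0 addr_ge0 ?sqr_ge0.
  exact: (@continuous_oneDsqrV R).
have -> : [set x : R | 0 <= x] = `[0, +oo[%classic.
  by apply/seteqP; split=> x /=; rewrite in_itv/= andbT.
by rewrite (@integral0y_oneDsqr R).
Qed.

End measurable_modulus.

(** * Upper bound for sums of atoms *)

Definition atom_sum {R : realType} {d : nat} (F : 'rV[R]_d -> R) L (l0 : nat)
    (z : nat -> 'rV[R]_d) (x : 'rV[R]_d) : R :=
  \sum_(i < L) atom F (l0 + i) (z i) x.

Section atoms_upper_bound.
Context {R : realType} {d : nat}.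
Local Notation V := 'rV[R]_d.
Local Notation mu := (@lebesgue_row R d).
Local Notation normc := (@Normc.normc R).
Variable phi : V -> R[i].
Hypothesis phi_cutoff : cutoff phi.
Variables (F : V -> R) (B : R).
Hypothesis F_smooth : smooth F.
Hypothesis F_supp : vanishes_off F B.
Hypothesis F_mean0 : ift (fun x => (F x)%:C%C) 0 = 0.
Variable p : R.
Hypotheses (p_gt0 : 0 < p) (p_le1 : p <= 1).
Hypothesis d_gt0 : (0 < d)%N.

Let rho : R := 2^-1 `^ (p / 2).

Let rho_ge0 : 0 <= rho. Proof. exact: powR_ge0. Qed.

Let rho_lt1 : rho < 1.
Proof.
have e : 1 `^ (p / 2) = 1 :> R by rewrite powR1.
rewrite /rho -[X in _ < X]e.
apply: gt0_ltr_powR; rewrite ?divr_gt0 ?nnegrE//.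
by rewrite invf_lt1// ltr1n.
Qed.

(** The decay of [corr_main] survives the power [p / 2] as an integrable bound in
    space and a geometric one in the distance between scales. *)
Lemma corr_powR : exists2 C, 0 <= C & forall k l X,
  normc (corr F (symbol phi k) (2 ^+ k / 2 ^+ l) X) `^ p <=
  C * rho ^+ ((k - l) + (l - k)) * (weight X)^-1.
Proof.
(* large enough for the weight to the power n * (p / 2) to dominate the weight *)
pose n := (Num.truncn (2 / p)).+1.
have pn : 1 <= n%:R * (p / 2).
  rewrite -ler_pdivrMr ?divr_gt0// mul1r invf_div; apply/ltW; exact: truncnS_gt.
have [C C0 hC] := corr_main phi_cutoff F_smooth F_supp F_mean0 n d_gt0.
exists (C `^ (p / 2)) => [|k l X]; first exact: powR_ge0.
set g := normc _; have g0 : 0 <= g by exact: normc_ge0.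
have W1 := weight_ge1 X; have W0 : 0 < weight X by exact: lt_le_trans W1.
have {}hC := hC k l X.
rewrite ler_pdivlMr//.
have -> : g `^ p = (g ^+ 2) `^ (p / 2).
  by rewrite -powR_mulrn// -powRrM mulrCA divff ?mulr1.
rewrite (@le_trans _ _ ((g ^+ 2 * weight X ^+ n) `^ (p / 2)))//.
  rewrite [leRHS]powRM ?sqr_ge0 ?exprn_ge0 ?(ltW W0)// ler_wpM2l ?powR_ge0//.
  rewrite -powR_mulrn ?(ltW W0)// -powRrM -[leLHS]powRr1 ?(ltW W0)//.
  exact: ler_powR.
have -> : C `^ (p / 2) * rho ^+ (k - l + (l - k)) =
   (C * 2^-1 ^+ (k - l + (l - k))) `^ (p / 2).
  rewrite powRM ?exprn_ge0//; congr (_ * _).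
  by apply: powR_exprn; rewrite invr_ge0.
apply: ge0_ler_powR => //; rewrite ?nnegrE ?divr_ge0 ?(ltW p_gt0)//.
  by rewrite mulr_ge0 ?exprn_ge0 ?(ltW W0).
by rewrite mulr_ge0 ?exprn_ge0.
Qed.

Lemma atom_smooth l z : smooth (atom F l z).
Proof. by apply: smoothZ; exact: smooth_affine. Qed.

Lemma atom_bounded_cs l z : bounded_cs (fun x => (atom F l z x)%:C%C).
Proof.
have l0 : 0 < 2 ^+ l :> R by rewrite exprn_gt0.
have h := bounded_cs_affine (- (2 ^+ l *: z)) l0 (bounded_cs_real (smooth_continuous F_smooth) F_supp).
have := bounded_csZ (2 ^+ l ^+ d)%:C%C h.
by congr bounded_cs; apply/funext => x; rewrite /atom rmorphM.
Qed.

Lemma atom_sumE L l0 z : (fun x => (atom_sum F L l0 z x)%:C%C) =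
  (fun x => \sum_(i < L) (atom F (l0 + i) (z i) x)%:C%C) :> (V -> R[i]).
Proof. by apply/funext => x; rewrite /atom_sum rmorph_sum. Qed.

Lemma atom_sum_bounded_cs L l0 z : bounded_cs (fun x => (atom_sum F L l0 z x)%:C%C).
Proof. by rewrite atom_sumE; apply: bounded_cs_sum => i; exact: atom_bounded_cs. Qed.

Lemma lp_piece_sum (I : Type) (s : seq I) (f : I -> V -> R[i]) k x :
  (forall i, bounded_cs (f i)) ->
  lp_piece phi k (regular_distr (fun y => \sum_(i <- s) f i y)) x =
  \sum_(i <- s) lp_piece phi k (regular_distr (f i)) x.
Proof.
move=> hf; rewrite lp_pieceE.
have hd : bounded_cs (dyadic phi k).
  rewrite dyadic_symbol; apply: bounded_cs_scale; first by rewrite invr_gt0 exprn_gt0.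
  exact: bounded_cs_symbol.
have hc i : bounded_cs (fun y => f i y * ift (dyadic phi k) (x - y)).
  exact: bounded_cs_ift_translate.
have -> : (fun y => (\sum_(i <- s) f i y) * ift (dyadic phi k) (x - y)) =
    (fun y => \sum_(i <- s) f i y * ift (dyadic phi k) (x - y)).
  by apply/funext => y; rewrite mulr_suml.
rewrite (cintegral_sum s measurableT hc); apply: eq_bigr => i _.
exact/esym/lp_pieceE.
Qed.

Lemma integral_weightV_affine (a : R) (b : V) : 0 < a ->
  (\int[mu]_x ((weight (a *: x + b))^-1)%:E =
   ((a ^+ d)^-1 * fine (\int[mu]_X ((weight X)^-1)%:E))%:E)%E.
Proof.
move=> a0.
have W0 x : (0 <= ((weight (x : V))^-1)%:E)%E.
  by rewrite lee_fin invr_ge0 (le_trans _ (weight_ge1 x)).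
have mW : measurable_fun setT (fun X : V => ((weight X)^-1)%:E).
  by apply/measurable_EFinP; exact: measurable_weightV.
rewrite EFinM fineK; last by rewrite ge0_fin_numE ?integral_weightV_fin//; exact: integral_ge0.
rewrite -(ge0_integral_affine b a0 mW W0) muleA -EFinM mulVf ?mul1e//.
by rewrite expf_neq0// gt_eqF.
Qed.

(** Since [p <= 1], the [p]-th power of the modulus is subadditive, which reduces
    the estimate to single atoms. The integral of the [p]-th power of the [k]-th
    piece of an atom carries the factor [2 ^ (k d (p - 1))], and the smoothness
    [s = d / p - d] is the one whose factor [2 ^ (k s)] cancels its [p]-th root. *)
Lemma atoms_piece_bound (s : R) : s = d%:R / p - d%:R ->
  exists2 C, 0 <= C & forall L l0 z k,
  ((2 `^ (k%:R * s))%:E * 'N[mu]_(p%:E)[(fun x =>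
     (normc (lp_piece phi k (regular_distr (fun y => (atom_sum F L l0 z y)%:C%C)) x))%:E)] <=
   ((C * \sum_(i < L) rho ^+ ((k - (l0 + i)) + ((l0 + i) - k))) `^ p^-1)%:E)%E.
Proof.
move=> sE.
have [C C0 hC] := corr_powR.
pose W := fine (\int[mu]_X ((weight X)^-1)%:E)%E.
have W0 : 0 <= W.
  by rewrite fine_ge0//; apply: integral_ge0 => x _; rewrite lee_fin invr_ge0 (le_trans _ (weight_ge1 x)).
exists (C * W) => [|L l0 z k]; first exact: mulr_ge0.
set f := (X in regular_distr X).
have fcs : bounded_cs f by exact: atom_sum_bounded_cs.
pose K : R := 2 ^+ k ^+ d.
have K0 : 0 < K by rewrite !exprn_gt0.
pose h i x := K `^ p * (C * rho ^+ ((k - (l0 + i)) + ((l0 + i) - k))) *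
  (weight (2 ^+ k *: x + - (2 ^+ k *: z i)))^-1.
have h0 i x : 0 <= h i x.
  rewrite /h !mulr_ge0 ?powR_ge0 ?exprn_ge0// invr_ge0.
  exact: le_trans (weight_ge1 _).
have gh x : normc (lp_piece phi k (regular_distr f) x) `^ p <= \sum_(i < L) h i x.
  rewrite /f atom_sumE lp_piece_sum; last by move=> i; exact: atom_bounded_cs.
  apply: (@le_trans _ _ ((\sum_(i < L) normc (lp_piece phi k (regular_distr
      (fun y => (atom F (l0 + i) (z i) y)%:C%C)) x)) `^ p)).
    apply: ge0_ler_powR; rewrite ?nnegrE ?normc_ge0 ?(ltW p_gt0)//.
      by apply: sumr_ge0 => i _; exact: normc_ge0.
    exact: normc_sum.
  apply: (le_trans (powR_sum_le _ _ p_gt0 p_le1)) => [i|]; first exact: normc_ge0.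
  apply: ler_sum => i _; rewrite (lp_piece_atom phi_cutoff F_smooth F_supp).
  rewrite Normc.normcM normc_real (gtr0_norm K0) powRM ?normc_ge0 ?(ltW K0)//.
  rewrite /h -mulrA ler_wpM2l ?powR_ge0// -scalerBr; exact: hC.
have mh i : measurable_fun setT (h i).
  apply: measurable_funM => //.
  by apply: (measurableT_comp measurable_weightV); exact: measurable_row_affine.
have mg : measurable_fun setT (fun x => normc (lp_piece phi k (regular_distr f) x) `^ p).
  apply: (measurableT_comp (measurable_powR p)); apply: measurable_normc.
  have [-> hb] := lp_piece_ift k phi_cutoff fcs.
  by have [] := cbounded_ift hb.
have intb : (\int[mu]_x (normc (lp_piece phi k (regular_distr f) x) `^ p)%:E <=
    (K `^ p * K^-1 * (C * W * \sum_(i < L) rho ^+ ((k - (l0 + i)) + ((l0 + i) - k))))%:E)%E.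
  apply: (@le_trans _ _ (\int[mu]_x (\sum_(i < L) h i x)%:E)%E).
    apply: ge0_le_integral => //.
    - by move=> x _; rewrite lee_fin powR_ge0.
    - exact/measurable_EFinP.
    - by apply/measurable_EFinP; apply: measurable_sum => i.
    - by move=> x _; rewrite lee_fin.
  under eq_integral do rewrite -sumEFin.
  rewrite ge0_integral_sum//; last 2 first.
  - by move=> i; exact/measurable_EFinP.
  - by move=> i x _; rewrite lee_fin.
  rewrite !mulr_sumr -sumEFin; apply: lee_sum => i _.
  have k0 : 0 < 2 ^+ k :> R by rewrite exprn_gt0.
  rewrite /h; under eq_integral do rewrite EFinM.
  rewrite ge0_integralZl//; last 3 first.
  - by apply/measurable_EFinP; apply: (measurableT_comp measurable_weightV); exact: measurable_row_affine.
  - by move=> x _; rewrite lee_fin invr_ge0; exact: le_trans (weight_ge1 _).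
  - by rewrite lee_fin !mulr_ge0 ?powR_ge0 ?exprn_ge0.
  rewrite integral_weightV_affine// -EFinM lee_fin -/K -/W.
  by rewrite le_eqVlt; apply/orP; left; apply/eqP; ring.
rewrite unlock.
have -> : (\int[mu]_x (`|(normc (lp_piece phi k (regular_distr f) x))%:E| `^ p) =
   \int[mu]_x (normc (lp_piece phi k (regular_distr f) x) `^ p)%:E)%E.
  by apply: eq_integral => x _; rewrite /= ger0_norm ?normc_ge0.
set I := (\int[mu]_x _)%E in intb *.
have I0 : (0 <= I)%E by apply: integral_ge0 => x _; rewrite lee_fin powR_ge0.
set S := \sum_(i < L) _ in intb *.
have S0 : 0 <= S by apply: sumr_ge0 => i _; rewrite exprn_ge0.
apply: (@le_trans _ _ ((2 `^ (k%:R * s))%:E * ((K `^ p * K^-1 * (C * W * S)) `^ p^-1)%:E)%E).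
  rewrite lee_wpmul2l ?lee_fin ?powR_ge0// -poweR_EFin.
  apply: gt0_ler_poweR; rewrite ?invr_ge0 ?(ltW p_gt0)// ?in_itv/= ?I0 ?leey//.
  by rewrite lee_fin !mulr_ge0 ?powR_ge0 ?invr_ge0 ?(ltW K0).
rewrite -EFinM lee_fin.
have KE : K = 2 `^ (k%:R * d%:R) by rewrite /K powRrM !powR_mulrn// exprn_ge0.
have e1 : 2 `^ (k%:R * s) = (K `^ p * K^-1) `^ (- p^-1) :> R.
  have -> : K `^ p * K^-1 = 2 `^ (k%:R * d%:R * p - k%:R * d%:R).
    by rewrite powRB ?KE ?powRrM// implybE orbC pnatr_eq0.
  rewrite -powRrM; congr (_ `^ _); rewrite sE; field.
  exact: lt0r_neq0.
have KK0 : 0 < K `^ p * K^-1 by rewrite mulr_gt0 ?powR_gt0 ?invr_gt0.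
rewrite [X in _ * X <= _]powRM ?(ltW KK0) ?mulr_ge0// mulrA e1 -powRD; last first.
  by rewrite (gt_eqF KK0) implybT.
by rewrite addNr powRr0 mul1r.
Qed.

Let K : R := 2 / (1 - rho).
Let K_ge0 : 0 <= K.
Proof. by rewrite divr_ge0// subr_ge0 ltW. Qed.

Let S L l0 k : R := \sum_(i < L) rho ^+ ((k - (l0 + i)) + ((l0 + i) - k)).

Let S_ge0 L l0 k : 0 <= S L l0 k.
Proof. by apply: sumr_ge0 => i _; rewrite exprn_ge0. Qed.

Let S_le L l0 k : S L l0 k <= K.
Proof.
apply: le_trans (geometric_two_sided (l0 + L) k rho_ge0 rho_lt1).
rewrite big_split_ord/= (_ : S L l0 k = \sum_(i < L) rho ^+ ((l0 + i) - k + (k - (l0 + i)))).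
  by rewrite lerDr; apply: sumr_ge0 => i _; rewrite exprn_ge0.
by apply: eq_bigr => i _; rewrite addnC.
Qed.

Let sum_S_le L l0 n : \sum_(k < n) S L l0 k <= L%:R * K.
Proof.
rewrite /S exchange_big/= (_ : L%:R * K = \sum_(i < L) K).
  by apply: ler_sum => i _; exact: geometric_two_sided.
by rewrite sumr_const card_ord mulr_natl.
Qed.

(** Each atom lives at its own frequency up to geometric tails. Hence the [p]-th
    powers of the weighted norms of the pieces are bounded, and their sum is at
    most a multiple of the number [L] of atoms. For [q > p] the sum of the [q]-th
    powers is then of order [L] as well, so that the norm grows at most like
    [L ^ (1 / q)]; for [q = +oo] it stays bounded. *)
Lemma atoms_besov_upper (s : R) (q : \bar R) : s = d%:R / p - d%:R -> (p%:E < q)%E ->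
  exists C e, [/\ 0 <= C, e < p^-1 & forall L l0 z,
  (besov_norm phi s p q (regular_distr (fun y => (atom_sum F L l0 z y)%:C%C)) <=
   (C * L%:R `^ e)%:E)%E].
Proof.
move=> sE pq.
have [C C0 hC] := atoms_piece_bound sE.
have ip0 : 0 <= p^-1 by rewrite invr_ge0 ltW.
have CS L l0 k : 0 <= C * S L l0 k by rewrite mulr_ge0.
have CK : 0 <= C * K by rewrite mulr_ge0.
have CSK L l0 k : C * S L l0 k <= C * K by rewrite ler_wpM2l.
pose a L l0 z k := ((2 `^ (k%:R * s))%:E * 'N[mu]_(p%:E)[(fun x =>
     (normc (lp_piece phi k (regular_distr (fun y => (atom_sum F L l0 z y)%:C%C)) x))%:E)])%E.
have a0 L l0 z k : (0 <= a L l0 z k)%E.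
  by rewrite mule_ge0 ?lee_fin ?powR_ge0// Lnorm_ge0.
have ha L l0 z k : (a L l0 z k <= ((C * S L l0 k) `^ p^-1)%:E)%E by exact: hC.
case: q pq => [q||//]; last first.
  move=> _; exists ((C * K) `^ p^-1), 0; split; rewrite ?powR_ge0 ?invr_gt0//.
  move=> L l0 z; rewrite powRr0 mulr1.
  change ('N[counting]_+oo[a L l0 z] <= ((C * K) `^ p^-1)%:E)%E.
  rewrite unlock.
  case: ifP => _; last by rewrite lee_fin powR_ge0.
  apply/ess_supP; apply/nearW => k /=.
  rewrite gee0_abs; last exact: (a0 L l0 z k).
  apply: (le_trans (ha L l0 z k)); rewrite lee_fin.
  by apply: ge0_ler_powR; rewrite ?nnegrE ?CS ?CK ?CSK.
rewrite lte_fin => pq; have q0 : 0 < q by exact: lt_trans pq.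
pose D := (C * K) `^ (q / p - 1) * C * K.
have D0 : 0 <= D.
  by apply: mulr_ge0 => //; apply: mulr_ge0 => //; exact: powR_ge0.
exists (D `^ q^-1), q^-1; split; first exact: powR_ge0.
  by rewrite ltf_pV2.
move=> L l0 z; rewrite -powRM//.
rewrite /besov_norm (Lnorm_counting _ q0) -poweR_EFin.
have t0 k : (0 <= `|a L l0 z k| `^ q)%E by exact: poweR_ge0.
apply: gt0_ler_poweR; rewrite ?invr_ge0 ?(ltW q0)// ?in_itv/= ?leey ?andbT.
- by apply: nneseries_ge0 => k _ _; exact: t0.
- by rewrite lee_fin mulr_ge0.
have tk k : (`|a L l0 z k| `^ q <= ((C * K) `^ (q / p - 1) * C * S L l0 k)%:E)%E.
  rewrite gee0_abs//; apply: (@le_trans _ _ ((((C * S L l0 k) `^ p^-1)%:E) `^ q)%E).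
    by apply: gt0_ler_poweR; rewrite ?(ltW q0)// ?in_itv/= ?leey ?andbT ?lee_fin ?powR_ge0.
  rewrite poweR_EFin lee_fin -powRrM [p^-1 * q]mulrC.
  have qp : 1 < q / p by rewrite ltr_pdivlMr// mul1r.
  rewrite -(mulr_powRB1 (CS L l0 k) (lt_trans ltr01 qp)) mulrC -mulrA ler_wpM2r ?CS//.
  by apply: ge0_ler_powR; rewrite ?nnegrE ?CS ?CK ?CSK// subr_ge0 ltW.
apply: lime_le; first by apply: is_cvg_nneseries => k _ _; exact: t0.
apply/nearW => n.
apply: (@le_trans _ _ (\sum_(0 <= k < n) ((C * K) `^ (q / p - 1) * C * S L l0 k)%:E)%E).
  by apply: lee_sum => k _; exact: tk.
rewrite sumEFin lee_fin -mulr_sumr /D -[leRHS]mulrA ler_wpM2l ?mulr_ge0 ?powR_ge0//.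
by rewrite big_mkord mulrC.
Qed.

End atoms_upper_bound.

(** * Lower bound by the zeroth piece *)

Section besov_norm_lower.
Context {R : realType} {d : nat}.
Local Notation V := 'rV[R]_d.
Local Notation mu := (@lebesgue_row R d).
Local Notation normc := (@Normc.normc R).

Lemma besov_norm_ge_piece0 (phi : V -> R[i]) (s p : R) (q : \bar R) (u : distr) :
  0 < p -> (p%:E < q)%E ->
  ('N[mu]_(p%:E)[(fun x => (normc (lp_piece phi 0 u x))%:E)] <= besov_norm phi s p q u)%E.
Proof.
move=> p_gt0; pose a (k : nat) := ((2 `^ (k%:R * s))%:E * 'N[mu]_(p%:E)[(fun x =>
     (normc (lp_piece phi k u x))%:E)])%E.
have a0 k : (0 <= a k)%E by rewrite mule_ge0 ?lee_fin ?powR_ge0// Lnorm_ge0.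
have -> : 'N[mu]_(p%:E)[(fun x => (normc (lp_piece phi 0 u x))%:E)]%E = a 0%N.
  by rewrite /a mul0r powRr0 mul1e.
case: q => [q||//].
  rewrite lte_fin => pq; have q0 : 0 < q by exact: lt_trans pq.
  rewrite /besov_norm (Lnorm_counting _ q0).
  have t0 k : (0 <= `|a k| `^ q)%E by exact: poweR_ge0.
  have e : a 0%N = ((`|a 0%N| `^ q) `^ q^-1)%E.
    by rewrite gee0_abs// -poweRrM divff ?gt_eqF// poweRe1.
  rewrite [leLHS]e; apply: gt0_ler_poweR; rewrite ?invr_ge0 ?(ltW q0)// ?in_itv/= ?leey ?andbT ?t0//.
    by apply: nneseries_ge0 => k _ _; exact: t0.
  have := @nneseries_lim_ge R (fun k => `|a k| `^ q)%E xpredT 0%N 1%N (fun k _ _ => t0 k).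
  by rewrite big_nat1.
move=> _; change (a 0%N <= 'N[counting]_+oo[a])%E.
move: (a) a0 => b b0; rewrite unlock ifT; last first.
  suff : (0 < @counting nat R setT)%E by [].
  by rewrite /counting asboolF//; exact: infinite_nat.
have [A [mA A0 hA]] := @ess_sup_ge _ _ R counting (abse \o b).
apply: contrapT => /negP h.
have sA : [set 0%N] `<=` A.
  move=> _ ->; apply: hA => /= h'; apply: (negP h); apply: le_trans h'.
  by rewrite /= gee0_abs.
have : (counting [set 0%N] <= counting A :> \bar R)%E by apply: le_measure; rewrite ?inE.
rewrite A0; suff -> : @counting nat R [set 0%N] = 1%E by rewrite lee_fin ler10.
by rewrite /counting asboolT// fset_set1 finmap.cardfs1.
Qed.

End besov_norm_lower.

(** * The profile *)

Section bump.
Context {R : realType} {d : nat}.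
Local Notation V := 'rV[R]_d.
Local Notation mu := (@lebesgue_row R d).
Variable phi : V -> R[i].
Hypothesis phi_cutoff : cutoff phi.

(** Squaring gives a nonnegative function without leaving the smooth ones. *)
Definition bump (x : V) : R := complex.Re (phi x) * complex.Re (phi x).

Lemma bump_smooth : smooth bump.
Proof. by have [s1 _] := cutoff_Re phi_cutoff; exact: (smoothM s1 s1). Qed.

Lemma bump_supp : vanishes_off bump 2.
Proof. by have [_ v1] := cutoff_Re phi_cutoff; move=> x /v1 h; rewrite /bump h mul0r. Qed.

Lemma bump_cs : bounded_cs (fun x => (bump x)%:C%C).
Proof. exact: bounded_cs_real (smooth_continuous bump_smooth) bump_supp. Qed.

Definition bump_mass : R := \int[mu]_x bump x.

Lemma cintegral_bump : cintegral setT (fun x => (bump x)%:C%C) = bump_mass%:C%C.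
Proof. by apply: complex_eq => //=; rewrite /Rintegral integral0. Qed.

Lemma bump_mass_gt0 : 0 < bump_mass.
Proof.
pose r : R := (d.+1%:R)^-1.
have r0 : 0 < r by rewrite invr_gt0.
have [bi _] := bounded_cs_integrable measurableT bump_cs.
have hb x : box r x -> bump x = 1.
  move=> hx; have [_ p1 _] := phi_cutoff; rewrite /bump p1 ?mulr1//.
  rewrite (le_trans (enorm_le_box hx))// gtr0_norm// ler_pdivrMr// mul1r ler_nat.
  exact: leqnSn.
have rv : 0 < @volume R d r.
  rewrite /volume (_ : box r = [set x : V | forall i, (fun=> `[- r, r]%classic) i (x 0 i)]).
    rewrite (lebesgue_row_rectangle (A := fun=> `[- r, r]%classic))//.
    rewrite (eq_bigr (fun=> (r + r)%:E)) => [|i _].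
      by rewrite prodEFin/= prodr_gt0// => i _; rewrite addr_gt0.
    by rewrite lebesgue_measure_itv/= lte_fin gtrN// -EFinD opprK.
  by apply/seteqP; split=> x /= h i; have := h i; rewrite in_itv/= ler_norml.
apply: lt_le_trans rv _.
have mb : measurable (@box R d r) by exact: measurable_box.
rewrite /bump_mass -lee_fin /volume /Rintegral.
rewrite [leRHS]fineK; last exact: (integrable_fin_num measurableT bi).
rewrite fineK; last by rewrite ge0_fin_numE//; exact: box_fin.
rewrite -[X in (mu X <= _)%E]setIT -integral_indic//.
apply: ge0_le_integral => //.
- by apply/measurable_EFinP; exact: measurable_indic.
- exact: (measurable_int _ bi).
- move=> x _; rewrite lee_fin indicE; case: (boolP (x \in _)) => [/set_mem/hb ->//|_].
  by rewrite /bump -expr2 sqr_ge0.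
Qed.

(** The bump lives in a box of radius 2, which translation by 3 in every coordinate
    moves into the open positive orthant. *)
Definition centre : V := const_mx 3.

Definition pos_half (y : V) : R := bump (1 *: y + - centre).
Definition neg_half (y : V) : R := bump (1 *: y + centre).
(** The two halves cancel in the mean, but they lie in opposite orthants and so in
    different dyadic cubes. *)
Definition profile (y : V) : R := pos_half y + (-1) * neg_half y.

Lemma pos_half_coord y j : pos_half y != 0 -> 1 <= y 0 j <= 5.
Proof.
move=> h; have : box 2 (1 *: y + - centre) by apply: contrapT => /bump_supp/eqP; apply/negP.
by move=> /(_ j); rewrite scale1r !mxE ler_norml; lra.
Qed.

Lemma neg_half_coord y j : neg_half y != 0 -> -5 <= y 0 j <= -1.
Proof.
move=> h; have : box 2 (1 *: y + centre) by apply: contrapT => /bump_supp/eqP; apply/negP.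
by move=> /(_ j); rewrite scale1r !mxE ler_norml; lra.
Qed.

Lemma pos_half_smooth : smooth pos_half.
Proof. exact: (smooth_affine 1 (- centre) bump_smooth). Qed.

Lemma neg_half_smooth : smooth neg_half.
Proof. exact: (smooth_affine 1 centre bump_smooth). Qed.

Lemma pos_half_supp : vanishes_off pos_half 5.
Proof.
move=> y hy; apply: contrapT => /eqP h; apply: hy => j.
by have := pos_half_coord j h; rewrite ler_norml; lra.
Qed.

Lemma neg_half_supp : vanishes_off neg_half 5.
Proof.
move=> y hy; apply: contrapT => /eqP h; apply: hy => j.
by have := neg_half_coord j h; rewrite ler_norml; lra.
Qed.

Lemma profile_smooth : smooth profile.
Proof. exact: (smoothD pos_half_smooth (smoothZ (-1) neg_half_smooth)). Qed.

Lemma profile_supp : vanishes_off profile 5.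
Proof. by move=> y hy; rewrite /profile pos_half_supp// neg_half_supp// mulr0 addr0. Qed.

Lemma cintegral_pos_half : cintegral setT (fun x => (pos_half x)%:C%C) = bump_mass%:C%C.
Proof.
by rewrite -cintegral_bump -(cintegral_affine (- centre) ltr01 bump_cs) expr1n mul1r.
Qed.

Lemma cintegral_neg_half : cintegral setT (fun x => (neg_half x)%:C%C) = bump_mass%:C%C.
Proof.
by rewrite -cintegral_bump -(cintegral_affine centre ltr01 bump_cs) expr1n mul1r.
Qed.

Lemma pos_half_cs : bounded_cs (fun x => (pos_half x)%:C%C).
Proof. exact: bounded_cs_real (smooth_continuous pos_half_smooth) pos_half_supp. Qed.

Lemma neg_half_cs : bounded_cs (fun x => (neg_half x)%:C%C).
Proof. exact: bounded_cs_real (smooth_continuous neg_half_smooth) neg_half_supp. Qed.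

Lemma profile_mean0 : ift (fun x => (profile x)%:C%C) 0 = 0.
Proof.
rewrite /ift (_ : (fun xi => _) = (fun x => (pos_half x)%:C%C + (-1) * (neg_half x)%:C%C)).
  rewrite cintegralD//; [|exact: pos_half_cs|apply: bounded_csZ; exact: neg_half_cs].
  rewrite cintegralZ//; last exact: neg_half_cs.
  by rewrite cintegral_pos_half cintegral_neg_half mulN1r subrr.
apply/funext => x; rewrite character0 mulr1 /profile.
by apply: complex_eq; rewrite ?Re_complexD ?Im_complexD ?Re_complexM ?Im_complexM /=; ring.
Qed.

End bump.

(** * Dyadic averages *)

Section averaging_lemmas.
Context {R : realType} {d : nat}.
Local Notation V := 'rV[R]_d.
Local Notation mu := (@lebesgue_row R d).
Variable N : nat.
Implicit Types (m n : 'rV[int]_d) (x : V).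

Lemma two_expN_gt0 : 0 < 2 ^+ N :> R. Proof. by rewrite exprn_gt0. Qed.

Lemma dyadic_cubeP m x : dyadic_cube N m x <->
  forall j, (m 0 j)%:~R <= 2 ^+ N * x 0 j < (m 0 j)%:~R + 1.
Proof.
have N0 := two_expN_gt0; split=> [[t /= ht <-] j|h].
  rewrite !mxE mulrA divff ?gt_eqF// mul1r; have := ht j; lra.
exists (2 ^+ N *: x - map_mx intr m); last first.
  by rewrite addrC subrK scalerA mulVf ?gt_eqF// scale1r.
by move=> j /=; have := h j; rewrite !mxE; lra.
Qed.

Lemma measurable_dyadic_cube m : measurable (dyadic_cube N m : set V).
Proof.
have N0 := two_expN_gt0.
pose A (j : 'I_d) := `[(m 0 j)%:~R / 2 ^+ N, ((m 0 j)%:~R + 1) / 2 ^+ N[%classic : set R.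
rewrite (_ : dyadic_cube N m = [set x : V | forall j, A j (x 0 j)]).
  by apply: measurable_rectangle => j; exact: measurable_itv.
apply/seteqP; split=> x /=; rewrite dyadic_cubeP => h j; have := h j;
  by rewrite /A /= in_itv/= ler_pdivrMr// ltr_pdivlMr// [_ * 2 ^+ N]mulrC.
Qed.

Definition cube_index x : 'rV[int]_d := \row_j Num.floor (2 ^+ N * x 0 j).

Lemma cube_indexP m x : dyadic_cube N m x <-> m = cube_index x.
Proof.
rewrite dyadic_cubeP; split=> [h|-> j].
  apply/rowP => j; rewrite mxE; apply/esym/eqP; rewrite floor_eq.
  by have := h j; rewrite intrD1.
by rewrite mxE -intrD1; exact: floor_itv.
Qed.

Lemma averagingE (f : V -> R[i]) x :
  averaging N f x = (2 ^+ (N * d))%:C%C * cintegral (dyadic_cube N (cube_index x)) f.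
Proof.
rewrite /averaging -(fsbig_widen [set cube_index x] setT)//; last first.
  move=> m [_ /= hm]; rewrite indicE memNset ?mul0r ?rmorph0 ?mul0r//.
  by move=> /cube_indexP.
rewrite fsbig_set1 indicE mem_set ?mul1r//; exact/cube_indexP.
Qed.

Lemma averaging_sum (I : Type) (s : seq I) (f : I -> V -> R[i]) x :
  (forall i, bounded_cs (f i)) ->
  averaging N (fun y => \sum_(i <- s) f i y) x = \sum_(i <- s) averaging N (f i) x.
Proof.
move=> hf; rewrite averagingE (cintegral_sum s (measurable_dyadic_cube _) hf) mulr_sumr.
by apply: eq_bigr => i _; rewrite averagingE.
Qed.

Lemma cintegral_supp (A : set V) (f : V -> R[i]) :
  (forall x, f x != 0 -> A x) -> cintegral A f = cintegral setT f.
Proof.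
move=> hA; rewrite /cintegral; apply: complex_eq => /=.
- rewrite Rintegral_mkcond; apply: eq_Rintegral => x _; rewrite /patch.
  case: (boolP (x \in A)) => // /negP hx.
  have [->//|/hA h] := eqVneq (f x) 0; by exfalso; apply: hx; rewrite inE.
- rewrite Rintegral_mkcond; apply: eq_Rintegral => x _; rewrite /patch.
  case: (boolP (x \in A)) => // /negP hx.
  have [->//|/hA h] := eqVneq (f x) 0; by exfalso; apply: hx; rewrite inE.
Qed.

Lemma cintegral_disj (A : set V) (f : V -> R[i]) :
  (forall x, A x -> f x = 0) -> cintegral A f = 0.
Proof.
move=> hA; rewrite /cintegral; apply: complex_eq => /=.
- rewrite (@eq_Rintegral _ _ _ _ _ (fun=> 0)) ?/Rintegral ?integral0//.
  by move=> x; rewrite inE => /hA ->.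
- rewrite (@eq_Rintegral _ _ _ _ _ (fun=> 0)) ?/Rintegral ?integral0//.
  by move=> x; rewrite inE => /hA ->.
Qed.

Lemma averaging_in_cube (f : V -> R[i]) m x : (forall y, f y != 0 -> dyadic_cube N m y) ->
  averaging N f x = (2 ^+ (N * d))%:C%C * (\1_(dyadic_cube N m) x)%:C%C * cintegral setT f.
Proof.
move=> hf; rewrite averagingE -mulrA; congr (_ * _); rewrite indicE.
have [hx|hx] := pselect (dyadic_cube N m x).
  rewrite mem_set// mul1r -((cube_indexP m x).1 hx); exact: cintegral_supp.
rewrite memNset// mul0r; apply: cintegral_disj => y hy.
have [//|/hf hy'] := eqVneq (f y) 0.
exfalso; apply: hx; apply/cube_indexP.
by rewrite ((cube_indexP _ _).1 hy') -((cube_indexP _ _).1 hy).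
Qed.

End averaging_lemmas.

(** * Peak kernels *)

Section peak_kernels.
Context {R : realType} {d : nat}.
Local Notation V := 'rV[R]_d.
Local Notation mu := (@lebesgue_row R d).
Local Notation normc := (@Normc.normc R).

Definition cube_around (x : V) (r : R) : set V := [set y | forall j, `|y 0 j - x 0 j| <= r].

Lemma cube_aroundE (x : V) (r : R) :
  cube_around x r = [set y : V | forall j, (fun j => `[x 0 j - r, x 0 j + r]%classic) j (y 0 j)].
Proof.
by apply/seteqP; split=> y /= h j; have := h j; rewrite in_itv/= ler_distl.
Qed.

Lemma measurable_cube_around x r : measurable (cube_around x r).
Proof.
rewrite cube_aroundE.
exact: (measurable_rectangle (A := fun j => `[x 0 j - r, x 0 j + r]%classic)).
Qed.

Lemma cube_around_volume x r : 0 < r -> mu (cube_around x r) = ((2 * r) ^+ d)%:E.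
Proof.
move=> r0; rewrite cube_aroundE.
rewrite (lebesgue_row_rectangle (A := fun j => `[x 0 j - r, x 0 j + r]%classic))//.
rewrite (eq_bigr (fun=> (2 * r)%:E)) => [|i _].
  by rewrite prodEFin/= prodr_const card_ord.
rewrite lebesgue_measure_itv/= lte_fin ifT; last by lra.
by rewrite -EFinB; congr EFin; lra.
Qed.

Lemma nbhs_cube_around (x : V) (P : set V) : nbhs x P ->
  exists2 r, 0 < r & cube_around x r `<=` P.
Proof.
move=> /nbhs_ballP[e /= e0 h]; exists (e / 2); first by rewrite divr_gt0.
move=> y hy; apply: h; split=> // i j; rewrite (ord1 i) /ball/= distrC.
by rewrite (le_lt_trans (hy j))// ltr_pdivrMr// ltr_pMr// ltr1n.
Qed.

Lemma geometric_separation (a b A C : R) : 0 <= a -> a < b -> 0 < A ->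
  exists n, C * a ^+ n < A * b ^+ n.
Proof.
move=> a0 ab A0; have b0 : 0 < b by exact: le_lt_trans ab.
have ab1 : `|a / b| < 1 by rewrite ger0_norm ?divr_ge0 ?(ltW b0)// ltr_pdivrMr// mul1r.
have := cvg_geometric C ab1.
move=> /cvgrPdist_lt /(_ A A0)[n _ /(_ n (leqnn n))] /=.
rewrite sub0r normrN => h; exists n.
have -> : C * a ^+ n = C * (a / b) ^+ n * b ^+ n.
  by rewrite expr_div_n -mulrA divfK// expf_neq0// gt_eqF.
by rewrite ltr_pM2r ?exprn_gt0// (le_lt_trans (ler_norm _)).
Qed.

(** Near the peak, where [h] is positive, the powers of the kernel decay slower
    than those of some [c > b]; where [h] is negative they are at most [b ^ n].
    The positive part wins for large [n]. *)
Lemma peak_detects (h k : V -> R) (B b : R) (x : V) :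
  continuous h -> vanishes_off h B -> continuous k -> (forall y, 0 <= k y <= 1) ->
  0 < h x -> k x = 1 -> 0 <= b -> b < 1 -> (forall y, h y < 0 -> k y <= b) ->
  exists n, 0 < \int[mu]_y (h y * k y ^+ n).
Proof.
move=> ch h0 ck k01 hx kx b0 b1 hb.
have [M M0 hM] := vanishes_off_bounded ch h0.
pose del := h x / 2; have del0 : 0 < del by rewrite divr_gt0.
pose c := (1 + b) / 2; have bc : b < c by rewrite /c; lra.
have c1 : c < 1 by rewrite /c; lra.
have nh : nbhs x [set y | del <= h y].
  have /cvgrPdist_lt/(_ del del0) := ch x.
  by apply: filterS => y /=; rewrite ltr_norml /del; lra.
have nk : nbhs x [set y | c <= k y].
  have c1' : 0 < 1 - c by rewrite subr_gt0.
  have /cvgrPdist_lt/(_ _ c1') := ck x.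
  by apply: filterS => y /=; rewrite kx ltr_norml; lra.
have [r r0 hr] := nbhs_cube_around (filterI nh nk).
have mQ := measurable_cube_around x r.
have mB : measurable (@box R d B) by exact: measurable_box.
have vQ := cube_around_volume x r0.
have A0 : 0 < del * (2 * r) ^+ d by rewrite mulr_gt0// exprn_gt0// mulr_gt0.
have [n hn] := geometric_separation (M * @volume R d B) b0 bc A0.
exists n.
pose lo y := del * c ^+ n * \1_(cube_around x r) y - M * b ^+ n * \1_(@box R d B) y.
have indi (A : set V) (a : R) : measurable A -> (mu A < +oo)%E ->
    mu.-integrable setT (EFin \o (fun y => a * \1_A y)).
  move=> mA fA; apply: (integrableZl measurableT a (f := EFin \o \1_A)).
  exact: integrable_indic_fin.
have intind (A : set V) (a : R) : measurable A -> (mu A < +oo)%E ->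
    \int[mu]_y (a * \1_A y) = a * fine (mu A).
  move=> mA fA; rewrite RintegralZl//; last first.
    by have := indi A 1 mA fA; congr (mu.-integrable _ _); apply/funext => y /=; rewrite mul1r.
  by rewrite /Rintegral integral_indic// setIT.
have iQ := indi _ (del * c ^+ n) mQ; rewrite vQ ltry in iQ.
have iB := indi _ (M * b ^+ n) mB (box_fin B).
have ilo : \int[mu]_y lo y = del * c ^+ n * (2 * r) ^+ d - M * b ^+ n * @volume R d B.
  rewrite /lo RintegralB//; last exact: iQ.
  rewrite !intind ?vQ ?ltry//; exact: box_fin.
have lo_gt0 : 0 < \int[mu]_y lo y by rewrite ilo subr_gt0; move: hn; lra.
apply: (lt_le_trans lo_gt0).
apply: le_Rintegral => //.
- by have := integrableB measurableT (iQ isT) iB.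
- apply: (@bounded_supp_integrable _ _ _ (fun y => h y * k y ^+ n) M B) => //.
  + apply: measurable_funM; first exact: row_continuous_measurable.
    by apply: measurable_funX; exact: row_continuous_measurable.
  + move=> y; rewrite normrM -[leRHS]mulr1 ler_pM// ger0_norm ?exprn_ge0//.
      by apply: exprn_ile1; have /andP[] := k01 y.
    by have /andP[] := k01 y.
  + by move=> y /h0 ->; rewrite mul0r.
move=> y _; rewrite /lo !indicE.
have /andP[k0 k1] := k01 y; have kn : 0 <= k y ^+ n by rewrite exprn_ge0.
have Mb : 0 <= M * b ^+ n by rewrite mulr_ge0// exprn_ge0.
case: (boolP (y \in cube_around x r)) => [/set_mem/hr[/= hy ky]|_].
  rewrite mulr1 (@le_trans _ _ (del * c ^+ n))//.
    by rewrite gerBl mulr_ge0//; case: (_ \in _).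
  apply: ler_pM => //; first exact: ltW.
    by rewrite exprn_ge0// (le_trans b0)// ltW.
  by rewrite lerXn2r ?nnegrE// (le_trans b0)// ltW.
rewrite mulr0 sub0r; have [hy|hy] := ltP (h y) 0; last first.
  rewrite (@le_trans _ _ 0)//; last exact: mulr_ge0.
  by rewrite oppr_le0 mulr_ge0//; case: (_ \in _).
have -> : y \in @box R d B.
  by rewrite inE; apply: contrapT => /h0 h'; rewrite h' ltxx in hy.
rewrite mulr1 lerNl -mulNr; apply: ler_pM => //.
- by rewrite oppr_ge0 ltW.
- by rewrite -(ltr0_norm hy).
- by rewrite lerXn2r ?nnegrE// hb.
Qed.

Section trigonometric_peak.
Variables (T : R) (x0 : V).
Hypothesis T_gt0 : 0 < T.

Let arg (j : 'I_d) (y : V) : R := 2 * pi * ((y 0 j - x0 0 j) / T).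

Definition peak_factor j y : R := (1 + cos (arg j y)) / 2.

(** A trigonometric polynomial of period [T] in every coordinate, so that integrals
    against it are combinations of integrals against characters. *)
Definition peak y : R := \prod_j peak_factor j y.

Lemma peak_factor01 j y : 0 <= peak_factor j y <= 1.
Proof. by rewrite /peak_factor; have := cos_geN1 (arg j y); have := cos_le1 (arg j y); lra. Qed.

Lemma peak01 y : 0 <= peak y <= 1.
Proof.
rewrite /peak; apply/andP; split.
  by apply: prodr_ge0 => j _; have /andP[] := peak_factor01 j y.
by apply: prodr_ile1 => j _; exact: peak_factor01.
Qed.

Lemma peak_x0 : peak x0 = 1.
Proof.
rewrite /peak big1// => j _; rewrite /peak_factor /arg subrr mul0r mulr0 cos0.
by rewrite divff.
Qed.

Lemma continuous_peak_factor j : continuous (peak_factor j).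
Proof.
have c0 : continuous (fun y : V => y 0 j) by exact: coord_continuous.
have ca : continuous (arg j).
  move=> y; apply: (@continuousM _ _ (cst (2 * pi)) (fun y : V => (y 0 j - x0 0 j) / T)).
    exact: cst_continuous.
  apply: (@continuousM _ _ (fun y : V => y 0 j - x0 0 j) (cst T^-1)).
    by apply: continuousB; [exact: c0|exact: cst_continuous].
  exact: cst_continuous.
move=> y; apply: (@continuousM _ _ (fun y : V => 1 + cos (arg j y)) (cst 2^-1)); last first.
  exact: cst_continuous.
apply: continuousD; first exact: cst_continuous.
exact: (@continuous_comp _ _ _ (arg j) cos y (ca y) (@continuous_cos R _)).
Qed.

Lemma continuous_peak : continuous peak.
Proof.
suff c (s : seq 'I_d) : continuous (fun y => \prod_(j <- s) peak_factor j y) by exact: c.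
elim: s => [|j s IH].
  by under eq_fun do rewrite big_nil; move=> y; exact: cst_continuous.
under eq_fun do rewrite big_cons; move=> y.
by apply: continuousM; [exact: continuous_peak_factor|exact: IH].
Qed.

Lemma peak_far (r : R) (y : V) : 0 < r -> 2 * r <= T -> (forall j, 2 * `|y 0 j - x0 0 j| <= T) ->
  ~ cube_around x0 r y -> peak y <= (1 + cos (2 * pi * (r / T))) / 2.
Proof.
move=> r0 rT yT /existsNP[j /negP]; rewrite -ltNge => hj.
rewrite /peak (bigD1 j)//= (@le_trans _ _ (peak_factor j y))//.
  rewrite ler_piMr//; first by have /andP[] := peak_factor01 j y.
  by apply: prodr_ile1 => i _; exact: peak_factor01.
rewrite /peak_factor; suff : cos (arg j y) <= cos (2 * pi * (r / T)) by lra.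
have pi0 := pi_gt0 R.
have -> : cos (arg j y) = cos (2 * pi * (`|y 0 j - x0 0 j| / T)).
  rewrite -cos_norm /arg !normrM ger0_norm// ger0_norm ?(ltW pi0)//.
  by rewrite [`|T^-1|]gtr0_norm// invr_gt0.
have bd s : 0 <= s -> 2 * s <= T -> 2 * pi * (s / T) \in `[0, pi].
  move=> s0 sT; rewrite in_itv/=; apply/andP; split.
    by rewrite !mulr_ge0 ?invr_ge0 ?(ltW pi0) ?(ltW T_gt0).
  rewrite (_ : 2 * pi * (s / T) = pi * (2 * s / T)); last by ring.
  by rewrite ler_piMr ?(ltW pi0)// ler_pdivrMr// mul1r.
apply/ltW; rewrite ltr_cos; [|exact: bd (ltW r0) rT|exact: bd].
by rewrite ltr_pM2l ?mulr_gt0// ltr_pM2r ?invr_gt0.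
Qed.

End trigonometric_peak.

End peak_kernels.

(** * Injectivity of the inverse Fourier integral *)

Section ift_injectivity.
Context {R : realType} {d : nat}.
Local Notation V := 'rV[R]_d.
Local Notation mu := (@lebesgue_row R d).
Local Notation normc := (@Normc.normc R).
Variable m : V -> R[i].
Hypothesis m_cs : bounded_cs m.

(** Multiplication by a character translates the transform, so these functions are
    stable under multiplication by trigonometric polynomials. *)
Definition ift_null (u : V -> R[i]) : Prop :=
  cbounded u /\ forall X, ift (fun xi => m xi * u xi) X = 0.

Lemma ift_null_character u Y : ift_null u -> ift_null (fun xi => u xi * character Y xi).
Proof.
move=> [cu h]; split; first by apply: cboundedM => //; exact: cbounded_character.
move=> X; rewrite -[RHS](h (X + Y)) /ift; congr (cintegral _ _).
by apply/funext => xi; rewrite characterD; ring.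
Qed.

Lemma ift_nullZ (c : R[i]) u : ift_null u -> ift_null (fun xi => c * u xi).
Proof.
move=> [cu h]; split; first by apply: cboundedM => //; exact: cbounded_cst.
move=> X; rewrite (_ : (fun xi => _) = (fun xi => c * (m xi * u xi))).
  by rewrite iftZ ?h ?mulr0//; exact: bounded_csM.
by apply/funext => xi; rewrite mulrCA.
Qed.

Lemma ift_nullD u v : ift_null u -> ift_null v -> ift_null (fun xi => u xi + v xi).
Proof.
move=> [cu h] [cv h']; split; first exact: cboundedD.
move=> X; rewrite (_ : (fun xi => _) = (fun xi => m xi * u xi + m xi * v xi)).
  by rewrite iftD ?h ?h' ?addr0//; exact: bounded_csM.
by apply/funext => xi; rewrite mulrDr.
Qed.

Lemma peak_factor_character (T : R) (x0 : V) j xi :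
  (peak_factor T x0 j xi)%:C%C = (2^-1)%:C%C +
   (4^-1 %:C%C * character (- (T^-1 *: delta_mx 0 j)) x0 * character (T^-1 *: delta_mx 0 j) xi +
    4^-1 %:C%C * character (T^-1 *: delta_mx 0 j) x0 * character (- (T^-1 *: delta_mx 0 j)) xi).
Proof.
have dotE y : dot (T^-1 *: delta_mx 0 j) y = y 0 j / T.
  rewrite dotZl mulrC; congr (_ * _); rewrite /dot (bigD1 j)//= mxE !eqxx mul1r.
  by rewrite big1 ?addr0// => i ij; rewrite mxE eqxx (negbTE ij) mul0r.
rewrite /character !dotNl !dotE /peak_factor mulrBl mulrBr cosB.
set a := 2 * pi * (xi 0 j / T); set b := 2 * pi * (x0 0 j / T).
rewrite ![2 * pi * - _]mulrN -/a -/b !cosN !sinN.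
by apply: complex_eq; rewrite ?Re_complexD ?Im_complexD ?Re_complexM ?Im_complexM /=; field.
Qed.

Lemma ift_null_peak_factor T x0 j u : ift_null u ->
  ift_null (fun xi => (peak_factor T x0 j xi)%:C%C * u xi).
Proof.
move=> hu; pose Y : V := T^-1 *: delta_mx 0 j.
have h1 := ift_nullZ (4^-1 %:C%C * character (- Y) x0) (ift_null_character Y hu).
have h2 := ift_nullZ (4^-1 %:C%C * character Y x0) (ift_null_character (- Y) hu).
have := ift_nullD (ift_nullZ (2^-1)%:C%C hu) (ift_nullD h1 h2).
congr ift_null; apply/funext => xi; rewrite peak_factor_character -/Y.
by ring.
Qed.

Lemma ift_null_peakX T x0 n : ift_null (fun=> 1) ->
  ift_null (fun xi => (peak T x0 xi ^+ n)%:C%C).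
Proof.
move=> h1.
have step u : ift_null u -> ift_null (fun xi => (peak T x0 xi)%:C%C * u xi).
  move=> hu; rewrite /peak.
  suff c (s : seq 'I_d) : ift_null (fun xi => (\prod_(j <- s) peak_factor T x0 j xi)%:C%C * u xi).
    exact: c.
  elim: s => [|j s IH].
    by under eq_fun do rewrite big_nil mul1r.
  under eq_fun do rewrite big_cons rmorphM/= -mulrA.
  exact: ift_null_peak_factor.
elim: n => [|n IH]; first by under eq_fun do rewrite expr0.
under eq_fun do rewrite exprS rmorphM/=.
exact: step.
Qed.

(** All integrals of [m] against powers of a peak kernel vanish, these being
    trigonometric polynomials; were the real part of [m] positive at [x0], the
    kernels peaked there would detect it. *)
Lemma ift_eq0_Re_le0 x0 : continuous (fun x => complex.Re (m x)) ->
  (forall X, ift m X = 0) -> complex.Re (m x0) <= 0.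
Proof.
move=> cm hm; have [_ _ [B mB]] := m_cs.
have h1 : ift_null (fun=> 1).
  by split=> [|X]; [exact: cbounded_cst|under eq_fun do rewrite mulr1].
rewrite leNgt; apply/negP => hx.
pose h x := complex.Re (m x).
have h0 : vanishes_off h B by move=> x /mB; rewrite /h => ->.
pose H := `|B| + l1norm x0.
have H0 : 0 <= H by rewrite addr_ge0// l1norm_ge0.
(* in each coordinate the points of the support of m are within H of x0, so that
   only one peak of the kernel of period T meets the support *)
pose T := 2 * H + 2; have T0 : 0 < T by rewrite /T; lra.
have np : nbhs x0 [set y | 0 < h y].
  have /cvgrPdist_lt/(_ _ hx) := cm x0.
  by apply: filterS => y /=; rewrite -/(h _) ltr_norml /h; lra.
have [r' r'0 hr'] := nbhs_cube_around np.
pose r := Num.min r' 1.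
have r0 : 0 < r by rewrite lt_min r'0 ltr01.
have r1 : r <= 1 by rewrite ge_min lexx orbT.
have hr : cube_around x0 r `<=` [set y | 0 < h y].
  by move=> y hy; apply: hr' => j; rewrite (le_trans (hy j))// ge_min lexx.
have rT : 2 * r <= T by rewrite /T; lra.
pose b := (1 + cos (2 * pi * (r / T))) / 2.
have b0 : 0 <= b by rewrite /b; have := cos_geN1 (2 * pi * (r / T)); lra.
have b1 : b < 1.
  have pi0 := pi_gt0 R.
  have a0 : 0 < 2 * pi * (r / T) by rewrite !mulr_gt0// invr_gt0.
  have api : 2 * pi * (r / T) <= pi.
    rewrite (_ : 2 * pi * (r / T) = pi * (2 * r / T)); last by ring.
    by rewrite ler_piMr ?(ltW pi0)// ler_pdivrMr// mul1r.
  have : cos (2 * pi * (r / T)) < cos 0.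
    by rewrite ltr_cos// in_itv/= ?lexx ?(ltW a0) ?(ltW pi0).
  by rewrite cos0 /b; lra.
have hb y : h y < 0 -> peak T x0 y <= b.
  move=> hy.
  have yB : box B y by apply: contrapT => /h0 h'; rewrite h' ltxx in hy.
  apply: peak_far => // [j|/hr/= h']; last by have := lt_trans h' hy; rewrite ltxx.
  have x0j : `|x0 0 j| <= l1norm x0.
    by rewrite /l1norm (bigD1 j)//= lerDl sumr_ge0.
  have yj : `|y 0 j| <= `|B| by rewrite (le_trans (yB j))// ler_norm.
  have := ler_normB (y 0 j) (x0 0 j); rewrite /T /H; lra.
have [n] := peak_detects cm h0 (@continuous_peak _ _ T x0) (peak01 T x0) hx
  (peak_x0 T x0) b0 b1 hb.
suff -> : \int[mu]_y (h y * peak T x0 y ^+ n) = 0 by rewrite ltxx.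
have [_ /(_ 0)] := ift_null_peakX T x0 n h1.
move=> /(congr1 (@complex.Re R)) /= <-.
apply: eq_Rintegral => y _.
by rewrite character0 mulr1 Re_complexM/= mulr0 subr0.
Qed.

End ift_injectivity.

(** The previous bound for [m] multiplied by [1], [-1], ['i] and [- 'i]. *)
Lemma ift_injective {R : realType} {d : nat} (m : 'rV[R]_d -> R[i]) x0 :
  bounded_cs m -> continuous (fun x => complex.Re (m x)) ->
  continuous (fun x => complex.Im (m x)) -> m x0 != 0 -> exists X, ift m X != 0.
Proof.
move=> hm cr ci; apply: contra_neqP => /forallNP h.
have {}h X : ift m X = 0 by apply/eqP; apply/negPn/negP; exact: h.
have hz c X : ift (fun x => c * m x) X = 0 by rewrite iftZ// h mulr0.
have le0 := ift_eq0_Re_le0.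
have r1 := le0 _ _ m hm x0 cr h.
have r2 : complex.Re (-1 * m x0) <= 0.
  apply: (le0 _ _ (fun x => -1 * m x)) => //; first exact: bounded_csZ.
  under eq_fun do rewrite Re_complexM /= oppr0 mul0r subr0 mulN1r.
  by move=> x; apply: continuousN; exact: cr.
have r3 : complex.Re ((0 +i* 1)%C * m x0) <= 0.
  apply: (le0 _ _ (fun x => (0 +i* 1)%C * m x)) => //; first exact: bounded_csZ.
  under eq_fun do rewrite Re_complexM /= mul0r mul1r sub0r.
  by move=> x; apply: continuousN; exact: ci.
have r4 : complex.Re ((0 -i* 1)%C * m x0) <= 0.
  apply: (le0 _ _ (fun x => (0 -i* 1)%C * m x)) => //; first exact: bounded_csZ.
  under eq_fun do rewrite Re_complexM /= mul0r mulN1r sub0r opprK.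
  exact: ci.
move: r2 r3 r4; rewrite !Re_complexM /= => r2 r3 r4.
by apply: complex_eq => /=; apply/eqP; rewrite eq_le; apply/andP; split; lra.
Qed.

(** * The averaged profile *)

Section step_function.
Context {R : realType} {d : nat}.
Local Notation V := 'rV[R]_d.
Local Notation mu := (@lebesgue_row R d).
Local Notation normc := (@Normc.normc R).
Variable phi : V -> R[i].
Hypothesis phi_cutoff : cutoff phi.
Variable N : nat.

Let N_gt0 : 0 < 2 ^+ N :> R := @two_expN_gt0 R N.

(** What averaging leaves of a narrow profile centred at the origin: opposite
    constants on the two dyadic cubes meeting the origin diagonally. *)
Definition step (x : V) : R[i] :=
  (2 ^+ (N * d))%:C%C * (\1_(dyadic_cube N 0) x)%:C%C * (bump_mass phi)%:C%C -
  (2 ^+ (N * d))%:C%C * (\1_(dyadic_cube N (const_mx (-1))) x)%:C%C * (bump_mass phi)%:C%C.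

Lemma dyadic_cube_translate (n k : 'rV[int]_d) (x : V) :
  dyadic_cube N (n + k) x <-> dyadic_cube N k (x - 2 ^- N *: map_mx intr n).
Proof.
rewrite !dyadic_cubeP.
have e j : 2 ^+ N * (x - 2 ^- N *: map_mx intr n) 0 j = 2 ^+ N * x 0 j - (n 0 j)%:~R.
  by rewrite !mxE mulrBr mulrA divff ?gt_eqF// mul1r.
by split=> h j; have := h j; rewrite e mxE intrD; lra.
Qed.

Lemma indic_cube_translate (n k : 'rV[int]_d) (x : V) :
  \1_(dyadic_cube N (n + k)) x = \1_(dyadic_cube N k) (x - 2 ^- N *: map_mx intr n) :> R.
Proof.
by rewrite !indicE; congr (nat_of_bool _)%:R; apply/idP/idP => /set_mem h;
  apply/mem_set; apply/dyadic_cube_translate.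
Qed.

Lemma atom_mass (F : V -> R) B l z : smooth F -> vanishes_off F B ->
  cintegral setT (fun x => (atom F l z x)%:C%C) = cintegral setT (fun x => (F x)%:C%C).
Proof.
move=> sF vF; have l0 : 0 < 2 ^+ l :> R by rewrite exprn_gt0.
have hF := bounded_cs_real (smooth_continuous sF) vF.
have hFa := bounded_cs_affine (- (2 ^+ l *: z)) l0 hF.
rewrite -[RHS](cintegral_affine (- (2 ^+ l *: z)) l0 hF).
rewrite -[RHS](cintegralZ _ measurableT hFa); congr (cintegral _ _).
by apply/funext => x; rewrite /atom rmorphM.
Qed.

(** In each coordinate the atom stays within [5 / 2 ^ l] of the lattice point, less
    than the side of a dyadic cube, so each half of it is contained in one of the
    two cubes that touch the lattice point diagonally; averaging only keeps the integrals of the halves,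
    which do not depend on [l]. *)
Lemma averaging_atom (n : 'rV[int]_d) l x : (N + 3 <= l)%N ->
  averaging N (fun y => (atom (profile phi) l (2 ^- N *: map_mx intr n) y)%:C%C) x =
  step (x - 2 ^- N *: map_mx intr n).
Proof.
move=> Nl; set z : V := 2 ^- N *: map_mx intr n.
have sp := pos_half_smooth phi_cutoff; have vp := pos_half_supp phi_cutoff.
have sn := neg_half_smooth phi_cutoff; have vn := neg_half_supp phi_cutoff.
have cp := atom_bounded_cs sp vp l z; have cn := atom_bounded_cs sn vn l z.
have -> : (fun y => (atom (profile phi) l z y)%:C%C) =
   (fun y => (atom (pos_half phi) l z y)%:C%C + (-1) * (atom (neg_half phi) l z y)%:C%C)
   :> (V -> R[i]).
  apply/funext => y; rewrite /atom /profile.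
  by apply: complex_eq; rewrite ?Re_complexD ?Im_complexD ?Re_complexM ?Im_complexM /=; ring.
rewrite averagingE cintegralD//; [|exact: measurable_dyadic_cube|exact: bounded_csZ].
rewrite cintegralZ//; last exact: measurable_dyadic_cube.
rewrite mulrDr mulrCA -!averagingE.
pose t : R := 2 ^+ N / 2 ^+ l.
have t0 : 0 < t by rewrite divr_gt0// exprn_gt0.
have t8 : t * 8 <= 1.
  rewrite /t mulrAC ler_pdivrMr ?exprn_gt0// mul1r.
  rewrite (_ : 8 = 2 ^+ 3); last by rewrite -natrX.
  by rewrite -exprD ler_eXn2l// ltr1n.
have coordE (y : V) j : 2 ^+ N * y 0 j - (n 0 j)%:~R = t * (2 ^+ l *: y + - (2 ^+ l *: z)) 0 j.
  rewrite /t /z !mxE; field.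
  by rewrite !expf_neq0.
rewrite (@averaging_in_cube _ _ _ _ (n + 0)); last first.
  move=> y hy; rewrite addr0; apply/dyadic_cubeP => j.
  have : pos_half phi (2 ^+ l *: y + - (2 ^+ l *: z)) != 0.
    apply: contraNneq hy; rewrite /atom => ->; by rewrite mulr0.
  move=> /(pos_half_coord phi_cutoff j); have := coordE y j.
  by move: ((2 ^+ l *: y + - (2 ^+ l *: z)) 0 j) => v; nra.
rewrite (@averaging_in_cube _ _ _ _ (n + const_mx (-1))); last first.
  move=> y hy; apply/dyadic_cubeP => j.
  have : neg_half phi (2 ^+ l *: y + - (2 ^+ l *: z)) != 0.
    apply: contraNneq hy; rewrite /atom => ->; by rewrite mulr0.
  move=> /(neg_half_coord phi_cutoff j); have := coordE y j.
  rewrite !mxE intrD mulrN1z.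
  by move: ((2 ^+ l *: y + - (2 ^+ l *: z)) 0 j) => v; nra.
rewrite (atom_mass l z sp vp) (atom_mass l z sn vn).
rewrite cintegral_pos_half// cintegral_neg_half//.
by rewrite !indic_cube_translate /step mulN1r.
Qed.

Lemma dyadic_cube_bounded (m : 'rV[int]_d) : exists B : R, forall x : V,
  ~ box B x -> ~ dyadic_cube N m x.
Proof.
exists (\sum_j `|(m 0 j)%:~R : R| + 1) => x hx; apply: contra_not hx => /dyadic_cubeP h j.
have N1 : 1 <= 2 ^+ N :> R by rewrite exprn_ege1// ler1n.
have mj : `|(m 0 j)%:~R : R| <= \sum_j `|(m 0 j)%:~R : R|.
  by rewrite (bigD1 j)//= lerDl sumr_ge0.
have hN : `|2 ^+ N * x 0 j| <= `|(m 0 j)%:~R : R| + 1.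
  have := h j; have := ler_norm ((m 0 j)%:~R : R); have := lerNnormlW (lexx `|(m 0 j)%:~R : R|).
  by rewrite ler_norml; lra.
rewrite (@le_trans _ _ `|2 ^+ N * x 0 j|)//; last by lra.
by rewrite normrM ler_peMl// ger0_norm// ltW.
Qed.

Lemma indic_cube_cs (m : 'rV[int]_d) : bounded_cs (fun x : V => (\1_(dyadic_cube N m) x : R)%:C%C).
Proof.
split.
- split => /=; last exact: measurable_cst.
  by apply: measurable_indic; exact: measurable_dyadic_cube.
- exists 1 => x; rewrite normc_real indicE.
  by case: (_ \in _); rewrite ?normr1 ?normr0.
- have [B hB] := dyadic_cube_bounded m; exists B => x /hB h.
  by rewrite indicE memNset.
Qed.

Lemma step_cs : bounded_cs step.
Proof.
rewrite /step; apply: bounded_csD.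
  have := bounded_csZ ((2 ^+ (N * d))%:C%C * (bump_mass phi)%:C%C) (indic_cube_cs 0).
  by congr bounded_cs; apply/funext => x; rewrite mulrAC.
apply: bounded_csN.
have := bounded_csZ ((2 ^+ (N * d))%:C%C * (bump_mass phi)%:C%C) (indic_cube_cs (const_mx (-1))).
by congr bounded_cs; apply/funext => x; rewrite mulrAC.
Qed.

Lemma dot_const (e : R) (x : V) : dot (const_mx e) x = e * \sum_j x 0 j.
Proof. by rewrite /dot mulr_sumr; apply: eq_bigr => j _; rewrite mxE. Qed.

(** The two cubes lie on opposite sides of the hyperplane orthogonal to the
    diagonal, and at this low frequency the sine keeps its sign on each of them;
    as the step changes sign too, the contributions to the imaginary part add
    up. *)
Lemma ift_step_neq0 : (0 < d)%N -> ift step (const_mx ((4 * d%:R)^-1)) != 0.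
Proof.
move=> d0; set e : R := (4 * d%:R)^-1.
have dR : 0 < d%:R :> R by rewrite ltr0n.
have e0 : 0 < e by rewrite invr_gt0 mulr_gt0.
have pi0 := pi_gt0 R.
have c0 : 0 < bump_mass phi by exact: bump_mass_gt0.
pose A : R := 2 ^+ (N * d) * bump_mass phi.
have A0 : 0 < A by rewrite mulr_gt0// exprn_gt0.
pose s (x : V) : R := sin (2 * pi * (e * \sum_j x 0 j)).
pose C0 : set V := dyadic_cube N 0; pose C1 : set V := dyadic_cube N (const_mx (-1)).
have stepE x : complex.Im (step x * character (const_mx e) x) = A * (\1_C0 x - \1_C1 x) * s x.
  by rewrite /s /character dot_const Im_complexM /step /= /A /C0 /C1; ring.
have N1 : 1 <= 2 ^+ N :> R by rewrite exprn_ege1// ler1n.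
have sumb (x : V) (a b : R) : (forall j, a <= x 0 j <= b) ->
    d%:R * a <= \sum_j x 0 j <= d%:R * b.
  move=> h; have cst (u : R) : d%:R * u = \sum_(j < d) u by rewrite sumr_const card_ord mulr_natl.
  by rewrite !cst; apply/andP; split; apply: ler_sum => j _; have /andP[] := h j.
have eE (u : R) : 2 * pi * (e * (d%:R * u)) = pi / 2 * u.
  by rewrite /e; field; rewrite gt_eqF.
have arg_bound (x : V) (a b : R) : (forall j, a <= x 0 j <= b) ->
    pi / 2 * a <= 2 * pi * (e * \sum_j x 0 j) <= pi / 2 * b.
  move=> /sumb /andP[h1 h2]; rewrite -!eE; apply/andP; split;
    by rewrite !ler_pM2l// mulr_gt0.
have inC0 x : C0 x -> forall j, 0 <= x 0 j <= 1.
  move=> /dyadic_cubeP h j; have := h j; rewrite mxE /= => /andP[h1 h2].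
  apply/andP; split; first by rewrite -(pmulr_rge0 _ N_gt0).
  have x0 : 0 <= x 0 j by rewrite -(pmulr_rge0 _ N_gt0).
  nra.
have inC1 x : C1 x -> forall j, -1 <= x 0 j <= 0.
  move=> /dyadic_cubeP h j; have := h j; rewrite mxE mulrN1z /= => /andP[h1 h2].
  have x0 : x 0 j <= 0 by rewrite -(pmulr_rle0 _ N_gt0); lra.
  by apply/andP; split=> //; nra.
have s_C0 x : C0 x -> 0 <= s x.
  move=> /inC0/arg_bound /andP[h1 h2]; apply: sin_ge0_pi.
  by apply/andP; split; lra.
have s_C1 x : C1 x -> s x <= 0.
  move=> /inC1/arg_bound /andP[h1 h2]; rewrite -oppr_ge0 -sinN; apply: sin_ge0_pi.
  by apply/andP; split; lra.
pose w : R := (2 ^+ N)^-1 / 4; have w0 : 0 < w by rewrite divr_gt0// invr_gt0.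
have wN : 2 ^+ N * w = 4^-1 by rewrite /w mulrA divff ?mul1r// gt_eqF.
pose Q : set V := cube_around (const_mx (2 * w)) w.
have inQ x : Q x -> forall j, w <= x 0 j <= 3 * w.
  by move=> h j; have := h j; rewrite mxE ler_norml; lra.
have QC0 x : Q x -> C0 x.
  move=> /inQ h; apply/dyadic_cubeP => j; have /andP[h1 h2] := h j; rewrite mxE /=.
  rewrite add0r; apply/andP; split; first by rewrite mulr_ge0 ?(ltW N_gt0)//; lra.
  have : 2 ^+ N * x 0 j <= 2 ^+ N * (3 * w) by rewrite ler_pM2l.
  by rewrite mulrCA wN; lra.
have w1 : w <= 4^-1 by rewrite -wN ler_peMl// ltW.
have sw0 : 0 < sin (pi / 2 * w).
  apply: sin_gt0_pihalf; apply/andP; split; first by rewrite mulr_gt0// divr_gt0.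
  by rewrite gtr_pMr ?divr_gt0//; lra.
have s_Q x : Q x -> sin (pi / 2 * w) <= s x.
  move=> /inQ/arg_bound /andP[h1 h2]; rewrite /s leNgt; apply/negP.
  rewrite ltr_sin; [by rewrite ltNge h1| |];
    rewrite in_itv/=; apply/andP; split; nra.
have disj x : C0 x -> ~ C1 x.
  move=> /cube_indexP h0 /cube_indexP h1.
  have := congr1 (fun v : 'rV[int]_d => v 0 (Ordinal d0)) (etrans h0 (esym h1)).
  by rewrite !mxE.
have Im_gt0 : 0 < complex.Im (ift step (const_mx e)).
  have hb := bounded_cs_ift (const_mx e) step_cs.
  have [_ hi] := bounded_cs_integrable measurableT hb.
  rewrite /ift /=.
  have mQ : measurable Q by exact: measurable_cube_around.
  have vQ : mu Q = ((2 * w) ^+ d)%:E by exact: cube_around_volume.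
  have lo_gt0 : 0 < A * sin (pi / 2 * w) * (2 * w) ^+ d.
    by rewrite !mulr_gt0// exprn_gt0// mulr_gt0.
  apply: lt_le_trans lo_gt0 _.
  rewrite -lee_fin /Rintegral fineK; last exact: (integrable_fin_num measurableT hi).
  rewrite EFinM -vQ -[X in mu X]setIT -integral_indic//.
  rewrite -ge0_integralZl//; last 2 first.
  - by apply/measurable_EFinP; exact: measurable_indic.
  - by rewrite lee_fin mulr_ge0 ?(ltW A0) ?(ltW sw0).
  apply: ge0_le_integral => //.
  - by move=> x _; rewrite mule_ge0// lee_fin mulr_ge0 ?(ltW A0) ?(ltW sw0).
  - by apply/measurable_EFinP; apply: measurable_funM => //; exact: measurable_indic.
  - exact: (measurable_int _ hi).
  move=> x _; rewrite -[leRHS]/((complex.Im (step x * character (const_mx e) x))%:E).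
  rewrite stepE -EFinM lee_fin -[A * sin _ * _]mulrA -[A * (_ - _) * s x]mulrA (ler_pM2l A0) !indicE.
  have [h0|h0] := pselect (C0 x).
    rewrite (mem_set h0) (memNset (disj _ h0)) subr0 mul1r.
    case: (boolP (x \in Q)) => [/set_mem/s_Q h|_]; first by rewrite mulr1.
    by rewrite mulr0; exact: s_C0.
  rewrite (memNset h0) (memNset (_ : ~ Q x)); last by move=> /QC0.
  rewrite mulr0 sub0r; case: (boolP (x \in C1)) => [/set_mem/s_C1 h|_].
    by rewrite mulN1r oppr_ge0.
  by rewrite oppr0 mul0r.
by apply: contraTneq Im_gt0 => ->; rewrite ltxx.
Qed.

End step_function.

(** * Far apart translates *)

Section translates_lower_bound.
Context {R : realType} {d : nat}.
Local Notation V := 'rV[R]_d.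
Local Notation mu := (@lebesgue_row R d).
Local Notation normc := (@Normc.normc R).
Variable phi : V -> R[i].
Hypothesis phi_cutoff : cutoff phi.
Variable g : V -> R[i].
Hypothesis g_cs : bounded_cs g.

Let G := lp_piece phi 0 (regular_distr g).

Let GE : G = ift (fun xi => phi xi * ift g (- xi)).
Proof. by have [] := lp_piece_ift 0 phi_cutoff g_cs. Qed.

Let G_cs : bounded_cs (fun xi => phi xi * ift g (- xi)).
Proof. by have [] := lp_piece_ift 0 phi_cutoff g_cs. Qed.

Lemma bounded_cs_translate (z : V) : bounded_cs (fun y => g (y - z)).
Proof.
have := bounded_cs_affine (- z) ltr01 g_cs.
by congr bounded_cs; apply/funext => y; rewrite scale1r.
Qed.

Lemma lp_piece_translate z x : lp_piece phi 0 (regular_distr (fun y => g (y - z))) x = G (x - z).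
Proof.
have hp := cutoff_bounded_cs phi_cutoff.
have hh := bounded_cs_ift_translate (x - z) g_cs hp.
rewrite /G !lp_pieceE -[RHS](cintegral_affine (- z) ltr01 hh) expr1n mul1r.
congr (cintegral _ _); apply/funext => y; rewrite scale1r; congr (_ * ift _ _).
by rewrite opprB addrA subrK.
Qed.

Lemma lp_piece_tail (j : 'I_d) : exists2 C, 0 <= C & forall X : V, `|X 0 j| * normc (G X) <= C.
Proof.
have [_ [M hM] [B hB]] := g_cs.
have M0 : 0 <= M by exact: le_trans (normc_ge0 _) (hM 0).
have hp := cutoff_bounded_cs phi_cutoff.
have [C1 C10 h1] := cutoff_decay phi_cutoff 1 j.
have [C0 C00 h0] := ift_bounded hp.
exists (2 * (M * (C1 + `|B| * C0)) * @volume R d B) => [|X].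
  by rewrite mulr_ge0 ?volume_ge0// mulr_ge0// mulr_ge0// addr_ge0// mulr_ge0.
have XM : `|X 0 j| = normc (`|X 0 j|)%:C%C by rewrite normc_real normr_id.
have hh := bounded_cs_ift_translate X g_cs hp.
rewrite XM -Normc.normcM /G lp_pieceE -(cintegralZ _ measurableT hh).
have [mc _ _] := bounded_csZ (`|X 0 j|)%:C%C hh.
apply: normc_cintegral_le => // [y|y hy]; last by rewrite hB// mul0r mulr0.
have [hy|hy] := pselect (box B y); last first.
  rewrite hB// mul0r mulr0 Normc.normc0 mulr_ge0// addr_ge0// mulr_ge0//.
rewrite !Normc.normcM -XM mulrCA; apply: ler_pM; rewrite ?normc_ge0//.
  by rewrite mulr_ge0 ?normc_ge0.
have h1' := h1 (X - y); have h0' := h0 (X - y); rewrite expr1 in h1'.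
have XE : `|X 0 j| <= `|(X - y) 0 j| + `|B|.
  have -> : X 0 j = (X - y) 0 j + y 0 j by rewrite !mxE subrK.
  by rewrite (le_trans (ler_normD _ _))// lerD2l (le_trans (hy j))// ler_norm.
rewrite (le_trans (ler_wpM2r (normc_ge0 _) XE))// mulrDl lerD//.
by rewrite ler_wpM2l.
Qed.

(** Far apart translates of a function with a nonvanishing zeroth piece do not
    interact, so their [p]-th powers add up. *)
Lemma translates_lower_bound (p : R) (j : 'I_d) : 0 < p -> (exists X, G X != 0) ->
  exists2 c, 0 < c & forall L, exists D : nat, forall z : nat -> V,
    (forall i, z i = (i * D)%:R *: delta_mx 0 j) ->
    (((c * L%:R) `^ p^-1)%:E <= 'N[mu]_(p%:E)[(fun x => (normc (lp_piece phi 0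
       (regular_distr (fun y => \sum_(i < L) g (y - z i)%R)) x))%:E)])%E.
Proof.
move=> p0 [X0 GX0].
pose del := normc (G X0) / 3.
have del0 : 0 < del.
  rewrite divr_gt0// lt_neqAle normc_ge0 andbT eq_sym.
  by apply: contra_neq GX0; exact: Normc.eq0_normc.
have [CL CL0 lip] := ift_lipschitz G_cs; rewrite -GE in lip.
pose r := del / (CL * d%:R + 1).
have den0 : 0 < CL * d%:R + 1 by rewrite ltr_wpDl// mulr_ge0.
have r0 : 0 < r by rewrite divr_gt0.
have near x : cube_around X0 r x -> 2 * del <= normc (G x).
  move=> hx; have : normc (G X0 - G x) <= del.
    rewrite (le_trans (lip _ _))// (@le_trans _ _ (CL * (d%:R * r)))//.
      apply: ler_wpM2l => //; rewrite /l1norm.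
      rewrite (_ : d%:R * r = \sum_(j < d) r); last by rewrite sumr_const card_ord mulr_natl.
      by apply: ler_sum => k _; rewrite !mxE distrC; exact: hx.
    by rewrite mulrA /r mulrCA ler_piMr ?(ltW del0)// ler_pdivrMr// mul1r lerDl.
  move=> h1; have := le_normcD (G X0 - G x) (G x); rewrite subrK => h2.
  have h3 : normc (G X0) = 3 * del by rewrite /del mulrC divfK.
  have -> : 2 * del = 3 * del - del by ring.
  by rewrite lerBlDl -h3 (le_trans h2)// lerD2r.
have [C C0 hC] := lp_piece_tail j.
exists (del `^ p * (2 * r) ^+ d); first by rewrite mulr_gt0 ?powR_gt0 ?exprn_gt0// mulr_gt0.
move=> L; pose q := C * L%:R / del.
have q0 : 0 <= q by rewrite divr_ge0 ?(ltW del0)// mulr_ge0.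
pose b := q + `|X0 0 j| + 2 * r + 1.
exists (Num.truncn b).+1; set D := (Num.truncn b).+1 => z zE.
have bD : b < D%:R by exact: truncnS_gt.
have zj i : z i 0 j = i%:R * D%:R by rewrite zE mxE mxE !eqxx mulr1 natrM.
have sep (i k : nat) : i != k -> D%:R <= `|z i 0 j - z k 0 j|.
  move=> ik; rewrite !zj -mulrBl normrM [`|D%:R|]ger0_norm// ler_peMl//.
  have [ltik|ltki|eik] := ltngtP i k; last by rewrite eik eqxx in ik.
    by rewrite distrC -natrB ?(ltnW ltik)// ger0_norm// ler1n subn_gt0.
  by rewrite -natrB ?(ltnW ltki)// ger0_norm// ler1n subn_gt0.
pose Q (i : nat) : set V := cube_around (X0 + z i) r.
have QE i x : Q i x -> cube_around X0 r (x - z i).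
  by move=> h k; have := h k; rewrite !mxE opprD addrA addrAC.
have Qj i x : Q i x -> `|x 0 j - (X0 0 j + z i 0 j)| <= r.
  by move=> h; have := h j; rewrite mxE.
have Qdisj i k x : Q i x -> Q k x -> i = k.
  move=> /Qj h1 /Qj h2; apply/eqP; apply/negPn/negP => ik; have h3 := sep _ _ ik.
  have h4 : `|z i 0 j - z k 0 j| <= 2 * r.
    have -> : z i 0 j - z k 0 j = (x 0 j - (X0 0 j + z k 0 j)) - (x 0 j - (X0 0 j + z i 0 j)) by ring.
    by rewrite (le_trans (ler_normB _ _))//; lra.
  have h5 := normr_ge0 (X0 0 j); move: (le_trans h3 h4) bD; rewrite /b => h6 bD.
  have := lt_le_trans bD h6; rewrite ltNge => /negP; apply.
  by rewrite -[leLHS]add0r -addrA lerD// ?lerDl// addr_ge0.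
(* on Q i the other translates contribute at most del in total *)
have far i k x : Q i x -> k != i -> normc (G (x - z k)) * L%:R <= del.
  move=> /Qj h ki; have h3 := sep _ _ ki.
  have hXq : q < `|(x - z k) 0 j|.
    have -> : (x - z k) 0 j = (x 0 j - (X0 0 j + z i 0 j)) + X0 0 j - (z k 0 j - z i 0 j).
      by rewrite !mxE; ring.
    have h4 := lerB_dist (z k 0 j - z i 0 j) ((x 0 j - (X0 0 j + z i 0 j)) + X0 0 j).
    rewrite distrC in h4.
    have h5 := ler_normD (x 0 j - (X0 0 j + z i 0 j)) (X0 0 j).
    by move: bD h3 h4 h5 h; rewrite /b; lra.
  have G0 := normc_ge0 (G (x - z k)).
  have := hC (x - z k) => hCk.
  have : q * normc (G (x - z k)) <= C.
    by rewrite (le_trans _ hCk)// ler_wpM2r// ltW.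
  have [->|L0] := posnP L; first by rewrite mulr0 => _; exact: ltW.
  have [->|G1] := eqVneq (normc (G (x - z k))) 0; first by rewrite mul0r => _; exact: ltW.
  have Gp : 0 < normc (G (x - z k)) by rewrite lt_neqAle eq_sym G1.
  have LR : 0 < L%:R :> R by rewrite ltr0n.
  move=> h6; rewrite leNgt; apply/negP => h7.
  have Cp : 0 < C.
    by apply: lt_le_trans hCk; rewrite mulr_gt0// (le_lt_trans q0).
  have : C < q * normc (G (x - z k)).
    rewrite /q mulrAC ltr_pdivlMr// -mulrA ltr_pM2l// mulrC; exact: h7.
  by rewrite ltNge h6.
have hz i : bounded_cs (fun y => g (y - z i)) by exact: bounded_cs_translate.
set f := (X in regular_distr X).
have fcs : bounded_cs f by apply: bounded_cs_sum => i; exact: hz.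
have big_on i x : (i < L)%N -> Q i x -> del <= normc (lp_piece phi 0 (regular_distr f) x).
  move=> iL hx; rewrite /f lp_piece_sum//.
  rewrite (eq_bigr (fun k : 'I_L => G (x - z k))) => [|k _]; last exact: lp_piece_translate.
  rewrite (bigD1 (Ordinal iL))//=; set S := \sum_(_ < _ | _) _.
  have hS : normc S <= del.
    have L0 : (0 < L)%N by exact: (leq_ltn_trans (leq0n _) iL).
    have LR : 0 < L%:R :> R by rewrite ltr0n.
    rewrite /S (@le_trans _ _ (\sum_(k < L | k != Ordinal iL) normc (G (x - z k))))//.
      exact: normc_sum.
    rewrite (@le_trans _ _ (\sum_(k < L | k != Ordinal iL) del / L%:R))//.
      apply: ler_sum => k ki; rewrite ler_pdivlMr//; apply: (far i) => //.
    rewrite (@le_trans _ _ (\sum_(k < L) del / L%:R))//.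
      rewrite [leRHS](bigD1 (Ordinal iL))//= lerDr divr_ge0 ?(ltW del0)//.
    by rewrite sumr_const card_ord -[leLHS]mulr_natr divfK// gt_eqF.
  have h1 := near _ (QE _ _ hx); have := le_normcD (G (x - z i) + S) (- S).
  rewrite addrK normcN => h2; have := le_trans h1 h2.
  have -> : 2 * del = del + del by ring.
  by move=> h3; rewrite -(lerD2r del) (le_trans h3)// lerD2l.
rewrite unlock -poweR_EFin.
apply: gt0_ler_poweR.
- by rewrite invr_ge0 ltW.
- rewrite in_itv/= leey andbT lee_fin mulr_ge0// mulr_ge0 ?powR_ge0// exprn_ge0//.
  by rewrite mulr_ge0// ltW.
- by rewrite in_itv/= leey andbT; apply: integral_ge0 => x _; rewrite lee_fin powR_ge0.
have mQ i : measurable (Q i) by exact: measurable_cube_around.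
have vQ i : mu (Q i) = ((2 * r) ^+ d)%:E by exact: cube_around_volume.
have -> : ((del `^ p * (2 * r) ^+ d * L%:R)%:E =
    \int[mu]_x (\sum_(i < L) (del `^ p * \1_(Q i) x)%:E))%E.
  rewrite ge0_integral_sum//; last 2 first.
  - by move=> i; apply/measurable_EFinP; apply: measurable_funM.
  - by move=> i x _; rewrite lee_fin mulr_ge0 ?powR_ge0.
  rewrite (eq_bigr (fun=> (del `^ p * (2 * r) ^+ d)%:E)) => [|i _].
    by rewrite sumEFin sumr_const card_ord mulr_natr.
  under eq_integral do rewrite EFinM.
  rewrite ge0_integralZl//; last 2 first.
  - by apply/measurable_EFinP; exact: measurable_indic.
  - by rewrite lee_fin powR_ge0.
  by rewrite integral_indic// setIT EFinM; congr (_ * _)%E; exact: vQ.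
have -> : (\int[mu]_x (`|(normc (lp_piece phi 0 (regular_distr f) x))%:E| `^ p) =
   \int[mu]_x (normc (lp_piece phi 0 (regular_distr f) x) `^ p)%:E)%E.
  by apply: eq_integral => x _; rewrite /= ger0_norm ?normc_ge0.
apply: ge0_le_integral => //.
- by move=> x _; apply: sume_ge0 => i _; rewrite lee_fin mulr_ge0 ?powR_ge0.
- under eq_fun do rewrite sumEFin.
  by apply/measurable_EFinP; apply: measurable_sum => i; apply: measurable_funM.
- apply/measurable_EFinP; apply: (measurableT_comp (measurable_powR p)); apply: measurable_normc.
  have [-> hb] := lp_piece_ift 0 phi_cutoff fcs.
  by have [] := cbounded_ift hb.
move=> x _; rewrite sumEFin lee_fin.
have [[i hi]|/forallNP h] := pselect (exists i : 'I_L, Q i x).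
  rewrite (bigD1 i)//= indicE (mem_set hi) mulr1 big1 ?addr0.
    apply: ge0_ler_powR; rewrite ?nnegrE ?normc_ge0 ?(ltW del0) ?(ltW p0)//.
    exact: (big_on i).
  move=> k ki; rewrite indicE memNset ?mulr0// => hk.
  by move/eqP: ki; apply; apply/val_inj; exact: (Qdisj _ _ x).
rewrite big1 ?powR_ge0// => i _; rewrite indicE memNset ?mulr0//.
Qed.

End translates_lower_bound.

(** * Unboundedness at the endpoint *)

Theorem theorem10p1 (R : realType) (d : nat) (hd : (1 <= d)%N)
    (p : R) (hp0 : 0 < p) (hp1 : p <= 1)
    (q : \bar R) (hpq : (p%:E < q)%E)
    (phi : 'rV[R]_d -> R[i]) (hphi : cutoff phi) (N : nat) :
  ~ bounded_on_besov phi (d%:R / p - d%:R) p q (averaging N).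
Proof.
move=> [K hK].
have ps := profile_smooth hphi; have pv := profile_supp hphi.
have pm := profile_mean0 hphi.
have [C [e [C0 ep hC]]] := atoms_besov_upper hphi ps pv pm hp0 hp1 hd (erefl _) hpq.
have gcs : bounded_cs (step phi N) by exact: step_cs.
(* phi is 1 at this low frequency, where the transform of the step is not 0 *)
pose xi0 : 'rV[R]_d := const_mx (- (4 * d%:R)^-1).
have nz : exists X, lp_piece phi 0 (regular_distr (step phi N)) X != 0.
  have [GE Gcs] := lp_piece_ift 0 hphi gcs.
  have dR : 0 < d%:R :> R by rewrite ltr0n.
  have pr := smooth_continuous (cutoff_Re hphi).1.
  have pi' := smooth_continuous (cutoff_Im hphi).1.
  have [gr gi] : continuous (fun x : 'rV[R]_d => complex.Re (ift (step phi N) (- x))) /\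
      continuous (fun x : 'rV[R]_d => complex.Im (ift (step phi N) (- x))).
    have [CL _ lip] := ift_lipschitz gcs.
    apply: (clipschitz_continuous (C := CL)) => x y; rewrite (le_trans (lip _ _))//.
    rewrite (_ : l1norm (- x - - y) = l1norm (x - y))// /l1norm.
    by apply: eq_bigr => j _; rewrite !mxE -opprD normrN.
  have [X hX] : exists X, ift (fun xi => phi xi * ift (step phi N) (- xi)) X != 0.
    apply: (ift_injective (x0 := xi0) Gcs).
    - under eq_fun do rewrite Re_complexM.
      exact: (fun x => continuousB (continuousM (pr x) (gr x)) (continuousM (pi' x) (gi x))).
    - under eq_fun do rewrite Im_complexM.
      exact: (fun x => continuousD (continuousM (pr x) (gi x)) (continuousM (pi' x) (gr x))).
    - have [_ p1 _] := hphi; rewrite /= p1 ?mul1r.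
        rewrite (_ : - xi0 = const_mx ((4 * d%:R)^-1)); first exact: ift_step_neq0.
        by apply/rowP => j; rewrite !mxE opprK.
      have hb : box ((4 * d%:R)^-1) xi0.
        by move=> j; rewrite mxE normrN ger0_norm// invr_ge0 mulr_ge0.
      rewrite (le_trans (enorm_le_box hb))// ger0_norm ?invr_ge0 ?mulr_ge0//.
      by rewrite invfM mulrCA divff ?gt_eqF// mulr1 invf_le1// ler1n.
  by exists X; rewrite GE.
have [c c0 hc] := translates_lower_bound hphi gcs (Ordinal hd) hp0 nz.
(* the number of atoms that contradicts the growth rates *)
pose eta := p^-1 - e; have eta0 : 0 < eta by rewrite subr_gt0.
pose A := `|K| * C / c `^ p^-1.
have cp0 : 0 < c `^ p^-1 by exact: powR_gt0.
have A0 : 0 <= A by rewrite divr_ge0 ?(ltW cp0)// mulr_ge0.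
pose L := (Num.truncn (A `^ eta^-1)).+1.
have L0 : 0 < L%:R :> R by rewrite ltr0n.
have AL : A < L%:R `^ eta.
  have -> : A = (A `^ eta^-1) `^ eta.
    by rewrite -powRrM mulVf ?gt_eqF// powRr1.
  apply: gt0_ltr_powR; rewrite ?nnegrE ?powR_ge0 ?(ltW L0)//.
  exact: truncnS_gt.
have [D hD] := hc L.
(* the multiples of D along the first axis, as lattice points of level N *)
pose n i : 'rV[int]_d := (i * D * 2 ^ N)%:Z *: delta_mx 0 (Ordinal hd).
pose z i : 'rV[R]_d := 2 ^- N *: map_mx intr (n i).
have zE i : z i = (i * D)%:R *: delta_mx 0 (Ordinal hd).
  apply/rowP => j; rewrite !mxE eqxx /=; case: (j == _); last by rewrite !mulr0.
  rewrite !mulr1 -[(_%:Z)%:~R]/((i * D * 2 ^ N)%:R : R) [(_ * 2 ^ N)%:R]natrM natrX.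
  by rewrite mulrCA mulVf ?expf_neq0// mulr1.
have {}hD := hD z zE.
pose f y : R[i] := (atom_sum (profile phi) L (N + 3) z y)%:C%C.
have fs : schwartz f.
  split.
    have [_ _ [B hB]] := atom_sum_bounded_cs ps pv L (N + 3) z.
    apply: (@schwartz_vanishes_off _ _ _ B).
      by apply: smooth_sum => i; exact: atom_smooth.
    by move=> x /hB /(congr1 (@complex.Re R)).
  apply: (@schwartz_vanishes_off _ _ _ 0); first exact: (smooth_cst 0).
  by [].
have := hK f fs; apply/negP; rewrite -ltNge.
have avgE : averaging N f = (fun y => \sum_(i < L) step phi N (y - z i)).
  apply/funext => y; rewrite /f atom_sumE averaging_sum; last first.
    by move=> i; exact: (atom_bounded_cs ps pv).
  by apply: eq_bigr => i _; rewrite averaging_atom// leq_addr.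
apply: (@le_lt_trans _ _ (`|K|%:E * (C * L%:R `^ e)%:E)%E).
  apply: (@le_trans _ _ (`|K|%:E * besov_norm phi (d%:R / p - d%:R) p q (regular_distr f))%E).
    by rewrite lee_wpmul2r ?lee_fin ?ler_norm// Lnorm_ge0.
  by rewrite lee_wpmul2l ?lee_fin//; exact: hC.
apply: (@lt_le_trans _ _ ((c * L%:R) `^ p^-1)%:E); last first.
  by rewrite avgE; apply: (le_trans hD); exact: (besov_norm_ge_piece0 _ _ _ hp0).
rewrite -EFinM lte_fin powRM ?(ltW c0) ?(ltW L0)//.
have -> : L%:R `^ p^-1 = L%:R `^ eta * L%:R `^ e.
  rewrite -powRD; last by rewrite (gt_eqF L0) implybT.
  by rewrite subrK.
rewrite !mulrA ltr_pM2r ?powR_gt0//.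
by move: AL; rewrite /A ltr_pdivrMr// [_ * c `^ _]mulrC.
Qed.
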